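(* Let $H$ satisfy (C3), (CNH), (CVX). Fix $T>0$ and a Lipschitz $W:\mathbb{R}\to\mathbb{R}$ with $I^{HJ}_T(W)\neq\emptyset$, and let $U_o^*(x)=\sup\{W(q(T))-\int_0^TL(q(s),\dot q(s))\,ds:\ q\in\mathcal{R}_T,\ q(0)=x\}$. Then for every Lipschitz $U_o:\mathbb{R}\to\mathbb{R}$: $U_o\in I^{HJ}_T(W)$ if and only if (i) $U_o\ge U_o^*$ on $\mathbb{R}$ and (ii) $U_o=U_o^*$ on $\overline{\pi_{W'}(\mathbb{R})}$.
   Context: (C3) $H\in C^3(\mathbb{R}^2;\mathbb{R})$; (CNH) there exists $X>0$ with $\partial_xH(x,p)=0$ whenever $|x|\ge X$; (CVX) for each $x$, $p\mapsto\partial_pH(x,p)$ is an increasing $C^1$-diffeomorphism of $\mathbb{R}$ onto itself. $L(x,v)=\sup_p(pv-H(x,p))$. (HS): $\dot q=\partial_pH(q,p)$, $\dot p=-\partial_xH(q,p)$ (solutions are global). $\mathcal{R}_T$: the $q\in C^1([0,T])$ such that some $p\in C^1([0,T])$ makes $(q,p)$ solve (HS). $S^{HJ}_TU_o$: viscosity solution at time $T$ of $\partial_tU+H(x,\partial_xU)=0$, $U(0)=U_o$; $I^{HJ}_T(W)=\{U_o\text{ Lipschitz}: S^{HJ}_TU_o=W\}$. When $I^{HJ}_T(W)\ne\emptyset$, $W'$ has left traces everywhere and $\pi_{W'}(x)=q(0)$ where $(q,p)$ solves (HS) with $q(T)=x$, $p(T)=W'(x-)$. *)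

(* Defs.v *)
From Stdlib Require Import Reals.
From Coquelicot Require Import Coquelicot.
Open Scope R_scope.

Definition d1 (f : R -> R -> R) (x y : R) : R := Derive (fun z => f z y) x.
Definition d2 (f : R -> R -> R) (x y : R) : R := Derive (fun z => f x z) y.

(* C^k on R^2: continuous, and (for k >= 1) both partials exist everywhere and
   are C^(k-1)  (continuous partials give Frechet differentiability). *)
Fixpoint Ck (k : nat) (f : R -> R -> R) : Prop :=
  match k with
  | O => forall x y, continuity_2d_pt f x y
  | S k' => (forall x y, continuity_2d_pt f x y) /\
            (forall x y, ex_derive (fun z => f z y) x /\ ex_derive (fun z => f x z) y) /\
            Ck k' (d1 f) /\ Ck k' (d2 f)
  end.

Definition C1_1 (g : R -> R) : Prop :=
  (forall x, ex_derive g x) /\ (forall x, continuity_pt (Derive g) x).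

Definition Lipschitz (f : R -> R) : Prop :=
  exists K, forall x y, Rabs (f x - f y) <= K * Rabs (x - y).

Definition hyp_C3 (H : R -> R -> R) : Prop := Ck 3 H.
Definition hyp_CNH (H : R -> R -> R) : Prop :=
  exists X, 0 < X /\ forall x p, X <= Rabs x -> d1 H x p = 0.
Definition hyp_CVX (H : R -> R -> R) : Prop :=
  forall x, let f := fun p => d2 H x p in
    (forall p1 p2, p1 < p2 -> f p1 < f p2) /\ C1_1 f /\
    exists g : R -> R, (forall p, g (f p) = p) /\ (forall y, f (g y) = y) /\ C1_1 g.

(* Legendre transform L(x,v) = sup_p (p v - H(x,p)) (finite under CVX) *)
Definition Lag (H : R -> R -> R) (x v : R) : R :=
  real (Lub_Rbar (fun y => exists p, y = p * v - H x p)).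

Definition HS (H : R -> R -> R) (q p : R -> R) : Prop :=
  forall t, is_derive q t (d2 H (q t) (p t)) /\ is_derive p t (- d1 H (q t) (p t)).

(* R_T: curves q that are (restrictions to [0,T] of) the q-component of a
   solution of (HS); since solutions of (HS) are global this is the same
   class as C^1 curves on [0,T] solving (HS) there. *)
Definition in_RT (H : R -> R -> R) (q : R -> R) : Prop := exists p, HS H q p.

Definition Ustar (H : R -> R -> R) (T : R) (W : R -> R) (x : R) : Rbar :=
  Lub_Rbar (fun y => exists q, in_RT H q /\ q 0 = x /\
              y = W (q T) - RInt (fun s => Lag H (q s) (Derive q s)) 0 T).

Definition visc_sol (H : R -> R -> R) (T : R) (Uo : R -> R) (U : R -> R -> R) : Prop :=
  (forall t x, 0 <= t <= T -> forall eps, 0 < eps -> exists delta, 0 < delta /\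
      forall s y, 0 <= s <= T -> Rabs (s - t) < delta -> Rabs (y - x) < delta ->
        Rabs (U s y - U t x) < eps) /\
  (forall x, U 0 x = Uo x) /\
  (forall (phi : R -> R -> R) t0 x0, Ck 1 phi -> 0 < t0 < T ->
     (exists r, 0 < r /\ forall s y, 0 < s < T -> Rabs (s - t0) < r -> Rabs (y - x0) < r ->
         U s y - phi s y <= U t0 x0 - phi t0 x0) ->
     d1 phi t0 x0 + H x0 (d2 phi t0 x0) <= 0) /\
  (forall (phi : R -> R -> R) t0 x0, Ck 1 phi -> 0 < t0 < T ->
     (exists r, 0 < r /\ forall s y, 0 < s < T -> Rabs (s - t0) < r -> Rabs (y - x0) < r ->
         U t0 x0 - phi t0 x0 <= U s y - phi s y) ->
     0 <= d1 phi t0 x0 + H x0 (d2 phi t0 x0)).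

Definition Lipschitz_strip (T : R) (U : R -> R -> R) : Prop :=
  exists K, forall s t x y, 0 <= s <= T -> 0 <= t <= T ->
    Rabs (U s x - U t y) <= K * (Rabs (s - t) + Rabs (x - y)).

Definition in_IHJ (H : R -> R -> R) (T : R) (W : R -> R) (Uo : R -> R) : Prop :=
  Lipschitz Uo /\
  exists U, Lipschitz_strip T U /\ visc_sol H T Uo U /\ forall x, U T x = W x.

Definition left_trace (W : R -> R) (x l : R) : Prop :=
  forall eps, 0 < eps -> exists delta, 0 < delta /\
    forall y d, x - delta < y < x -> is_derive W y d -> Rabs (d - l) < eps.

Definition piW_image (H : R -> R -> R) (T : R) (W : R -> R) (y : R) : Prop :=
  exists x l q p, left_trace W x l /\ HS H q p /\ q T = x /\ p T = l /\ y = q 0.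

Definition in_closure (A : R -> Prop) (y : R) : Prop :=
  forall eps, 0 < eps -> exists z, A z /\ Rabs (z - y) < eps.

(* Main.v *)
Require Import Defs.
From Stdlib Require Import Reals.
From Stdlib Require Import ZArith Lra Lia Psatz Classical ClassicalEpsilon.
From Coquelicot Require Import Coquelicot.
(* Ranalysis also exports a [d1]. *)
Import Defs.
Open Scope R_scope.

(** The engine is Tonelli's theorem: minimizers of the time-discretized action solve a discrete
    Hamiltonian system with momenta bounded independently of the step, so they converge to
    characteristics, and the value function of a Lipschitz datum is attained along
    characteristics. By dynamic programming it is a Lipschitz viscosity solution.

    Conversely, an arbitrary Lipschitz viscosity solution [U] grows along any C^1 curve by at most
    the action; and every point [(T,x)] is the end of a characteristic along which equality holds
    (a calibrated characteristic): compare [U] from below with the backward value function whose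
    final datum is a cone touching [U T] at [x]; this function is semiconvex, so it can serve as a
    test function, and it is obtained from Tonelli's theorem for the Hamiltonian [H(x,-p)].
    Tilting a calibrated characteristic shows that [W = U T] is semiconcave; hence it has left
    traces, and the characteristics issued from them are limits of calibrated ones, which gives
    [Uo = Ustar] on the image of [pi] and, by continuous dependence, on its closure.

    If [Uo] satisfies (i) and (ii), let [V] be its value function. Condition (i) along a minimizer
    gives [V T >= W], and (ii) along the characteristic issued from the left trace of [W] gives
    [V T <= W]. *)

(** * Derivatives, compactness and test functions *)

(** The obstacle is that no estimate on [H] is uniform in [p]: all constants are local in the
    momentum, so momenta must be bounded before anything else is estimated. Along characteristics
    the bound comes from conservation of energy and coercivity; for discrete minimizers it comes
    from the increments of the scheme in time. Compactness is reduced to real numbers: a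
    characteristic ending at [x] is determined by its final momentum, so a cluster point of the
    final momenta of the discrete minimizers determines the limit curve. Test functions must be C^1
    whereas value functions are only Lipschitz. The remedy is a parabola carried by a
    characteristic, which lies above the value function and meets it at the given point; strict
    monotonicity of [Hp] makes its opening finite. [visc_sol] tests at interior times only. Each
    maximum argument therefore spends a gap [c]: part of it excludes time 0, and a C^1 ramp of
    height [c] excludes time [T]. *)

Lemma is_derive_eq (f : R -> R) (x l l' : R) : is_derive f x l -> l = l' -> is_derive f x l'.
Proof. intros h e; now rewrite <- e. Qed.

Lemma Rabs_square (a : R) : Rabs a * Rabs a = a * a.
Proof. rewrite <- Rabs_mult; apply Rabs_right; nra. Qed.

Lemma Rabs_div_le (h t M : R) : 0 < t -> Rabs h <= M * t -> Rabs (h / t) <= M.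
Proof.
  intros ht hh; unfold Rdiv; rewrite Rabs_mult, Rabs_inv, (Rabs_right t) by lra.
  apply Rmult_le_reg_r with t; [exact ht|]; rewrite Rmult_assoc, Rinv_l by lra; lra.
Qed.

Lemma D_const (c x : R) : is_derive (fun _ : R => c) x 0.
Proof. exact (is_derive_const c x). Qed.

Lemma D_id (x : R) : is_derive (fun t : R => t) x 1.
Proof. exact (is_derive_id x). Qed.

Lemma D_plus (f g : R -> R) (x a b : R) :
  is_derive f x a -> is_derive g x b -> is_derive (fun t => f t + g t) x (a + b).
Proof. intros; now apply (is_derive_plus f g x a b). Qed.

Lemma D_minus (f g : R -> R) (x a b : R) :
  is_derive f x a -> is_derive g x b -> is_derive (fun t => f t - g t) x (a - b).
Proof. intros; now apply (is_derive_minus f g x a b). Qed.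

Lemma D_opp (f : R -> R) (x a : R) : is_derive f x a -> is_derive (fun t => - f t) x (- a).
Proof. intros; now apply (is_derive_opp f x a). Qed.

Lemma D_mult (f g : R -> R) (x a b : R) :
  is_derive f x a -> is_derive g x b -> is_derive (fun t => f t * g t) x (a * g x + f x * b).
Proof.
  intros hf hg; apply (is_derive_mult f g x a b hf hg).
  intros n m; apply Rmult_comm.
Qed.

Lemma D_comp (f g : R -> R) (x a b : R) :
  is_derive f (g x) a -> is_derive g x b -> is_derive (fun t => f (g t)) x (a * b).
Proof.
  intros hf hg; apply is_derive_eq with (scal b a).
  - now apply (is_derive_comp f g x a b).
  - unfold scal; simpl; unfold mult; simpl; ring.
Qed.

Lemma D_mult_l (c x : R) : is_derive (Rmult c) x c.
Proof. apply is_derive_eq with (0 * x + c * 1); [|ring]. apply (D_mult (fun _ => c) (fun t => t)); [apply D_const | apply D_id]. Qed.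

Lemma D_plus_l (c x : R) : is_derive (Rplus c) x 1.
Proof. apply is_derive_eq with (0 + 1); [|ring]. apply (D_plus (fun _ => c) (fun t => t)); [apply D_const | apply D_id]. Qed.

Lemma D_minus_l (c x : R) : is_derive (Rminus c) x (- (1)).
Proof. apply is_derive_eq with (0 - 1); [|ring]. apply (D_minus (fun _ => c) (fun t => t)); [apply D_const | apply D_id]. Qed.

Lemma D_Ropp (x : R) : is_derive Ropp x (- (1)).
Proof. apply (D_opp (fun t => t)), D_id. Qed.

(* Unification eta-reduces e.g. [fun t => c * t] to [Rmult c]. *)
Ltac dv :=
  lazymatch goal with
  | |- is_derive (Rmult _) _ _ => apply D_mult_l
  | |- is_derive (Rplus _) _ _ => apply D_plus_l
  | |- is_derive (Rminus _) _ _ => apply D_minus_l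
  | |- is_derive Ropp _ _ => apply D_Ropp
  | |- is_derive (fun t => _ + _) _ _ => eapply D_plus; dv
  | |- is_derive (fun t => _ - _) _ _ => eapply D_minus; dv
  | |- is_derive (fun t => - _) _ _ => eapply D_opp; dv
  | |- is_derive (fun t => _ * _) _ _ => eapply D_mult; dv
  | |- is_derive (fun t => t) _ _ => apply D_id
  | |- _ => first [eassumption | apply D_const | idtac]
  end.
Ltac dvf := eapply is_derive_eq; [ dv | cbv beta ].

Lemma derive_continuity (f : R -> R) (x l : R) : is_derive f x l -> continuity_pt f x.
Proof.
  intros h; apply continuity_pt_filterlim, (ex_derive_continuous f x); now exists l.
Qed.

Lemma mean_value (f df : R -> R) (a b : R) :
  a <= b -> (forall x, a <= x <= b -> is_derive f x (df x)) ->
  exists c, a <= c <= b /\ f b - f a = df c * (b - a).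
Proof.
  intros hab h.
  destruct (MVT_gen f a b df) as [c [hc e]].
  - intros x; rewrite Rmin_left, Rmax_right by lra; intros; apply h; lra.
  - intros x; rewrite Rmin_left, Rmax_right by lra; intros.
    apply derive_continuity with (df x), h; lra.
  - rewrite Rmin_left, Rmax_right in hc by lra; now exists c.
Qed.

Lemma derive_le (f df : R -> R) (M a b : R) :
  a <= b -> (forall x, a <= x <= b -> is_derive f x (df x)) ->
  (forall x, a <= x <= b -> df x <= M) -> f b - f a <= M * (b - a).
Proof.
  intros hab h hM; destruct (mean_value f df a b hab h) as [c [hc e]].
  rewrite e; apply Rmult_le_compat_r; [lra | now apply hM].
Qed.

Lemma derive_ge (f df : R -> R) (M a b : R) :
  a <= b -> (forall x, a <= x <= b -> is_derive f x (df x)) ->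
  (forall x, a <= x <= b -> M <= df x) -> M * (b - a) <= f b - f a.
Proof.
  intros hab h hM; destruct (mean_value f df a b hab h) as [c [hc e]].
  rewrite e; apply Rmult_le_compat_r; [lra | now apply hM].
Qed.

Lemma derive_Lipschitz (f df : R -> R) (M : R) (a b : R) :
  (forall x, Rmin a b <= x <= Rmax a b -> is_derive f x (df x)) ->
  (forall x, Rmin a b <= x <= Rmax a b -> Rabs (df x) <= M) ->
  Rabs (f a - f b) <= M * Rabs (a - b).
Proof.
  intros h hM.
  assert (G : forall u v, u <= v -> (Rmin a b = u /\ Rmax a b = v) ->
            Rabs (f v - f u) <= M * Rabs (v - u)).
  { intros u v huv [e1 e2].
    destruct (mean_value f df u v huv) as [c [hc e]].
    - intros; apply h; lra.
    - rewrite e, Rabs_mult; apply Rmult_le_compat_r; [apply Rabs_pos|].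
      apply hM; lra. }
  destruct (Rle_dec a b) as [l|l].
  - rewrite Rabs_minus_sym, (Rabs_minus_sym a); apply G; [lra|].
    rewrite Rmin_left, Rmax_right by lra; auto.
  - apply G; [lra|]; rewrite Rmin_right, Rmax_left by lra; auto.
Qed.

(** Maximize in [y] for each [x], then in [x]: uniform continuity on the box makes the partial
    maximum continuous. *)
Lemma box_maximum (f : R -> R -> R) (a b c d : R) :
  a <= b -> c <= d -> (forall x y, continuity_2d_pt f x y) ->
  exists x0 y0, a <= x0 <= b /\ c <= y0 <= d /\
    forall x y, a <= x <= b -> c <= y <= d -> f x y <= f x0 y0.
Proof.
  intros hab hcd hf.
  assert (slice : forall x, exists y, c <= y <= d /\ forall z, c <= z <= d -> f x z <= f x y).
  { intros x; destruct (continuity_ab_maj (f x) c d hcd) as [m [h1 h2]].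
    - intros y _ eps heps; destruct (hf x y (mkposreal eps heps)) as [de hde].
      exists de; split; [apply de | intros z [_ hz]; simpl in *].
      apply hde; [|exact hz]; rewrite Rminus_diag, Rabs_R0; apply de.
    - exists m; auto. }
  set (Y := fun x => proj1_sig (constructive_indefinite_description _ (slice x))).
  assert (HY : forall x, c <= Y x <= d /\ forall z, c <= z <= d -> f x z <= f x (Y x))
    by (intros x; unfold Y; destruct (constructive_indefinite_description _ (slice x)); auto).
  (* Uniform continuity holds on the box only, whereas continuity at an end point looks at both
     sides; composing with the projection onto [[a, b]] reconciles the two. *)
  set (cl := fun x => Rmax a (Rmin b x)).
  assert (Hcl : forall x, a <= cl x <= b)
    by (intros x; unfold cl, Rmax, Rmin; repeat destruct Rle_dec; lra).
  assert (Lcl : forall x y, Rabs (cl x - cl y) <= Rabs (x - y))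
    by (intros x y; unfold cl, Rmax, Rmin; repeat destruct Rle_dec;
        unfold Rabs; repeat destruct Rcase_abs; lra).
  destruct (continuity_ab_maj (fun x => f (cl x) (Y (cl x))) a b hab) as [m [h1 h2]].
  - intros x _ eps heps.
    destruct (uniform_continuity_2d f a b c d (fun x y _ _ => hf x y) (mkposreal eps heps))
      as [de hde].
    exists de; split; [apply de | intros z [_ hz]; simpl in *; unfold R_dist in *].
    assert (K : forall u v, Rabs (u - v) < de -> f (cl u) (Y (cl u)) - f (cl v) (Y (cl v)) < eps).
    { intros u v huv.
      pose proof (proj2 (HY (cl v)) (Y (cl u)) (proj1 (HY (cl u)))).
      pose proof (hde (cl v) (Y (cl u)) (cl u) (Y (cl u)) (Hcl _) (proj1 (HY _)) (Hcl _)
        (proj1 (HY _))) as hh.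
      rewrite Rminus_diag, Rabs_R0 in hh.
      specialize (hh (Rle_lt_trans _ _ _ (Lcl u v) huv) (cond_pos de)).
      apply Rabs_def2 in hh; lra. }
    pose proof (K z x hz); rewrite Rabs_minus_sym in hz; pose proof (K x z hz).
    apply Rabs_def1; lra.
  - exists (cl m), (Y (cl m)); split; [apply Hcl|]; split; [apply HY|].
    intros x y hx hy.
    assert (e : cl x = x) by (unfold cl, Rmax, Rmin; repeat destruct Rle_dec; lra).
    pose proof (h1 x hx) as h; rewrite e in h.
    pose proof (proj2 (HY x) y hy); lra.
Qed.

Lemma box_bounded (f : R -> R -> R) (a b c d : R) :
  a <= b -> c <= d -> (forall x y, continuity_2d_pt f x y) ->
  exists M, 0 <= M /\ forall x y, a <= x <= b -> c <= y <= d -> Rabs (f x y) <= M.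
Proof.
  intros hab hcd hf.
  destruct (box_maximum (fun x y => Rabs (f x y)) a b c d hab hcd) as [x0 [y0 [_ [_ h]]]].
  - intros x y; apply (continuity_1d_2d_pt_comp Rabs); [apply Rcontinuity_abs | apply hf].
  - exists (Rabs (f x0 y0)); split; [apply Rabs_pos | auto].
Qed.

Lemma Lipschitz_continuity_2d (f : R -> R -> R) (K x y : R) :
  (forall u v, Rabs (u - x) < 1 -> Rabs (v - y) < 1 ->
     Rabs (f u v - f x y) <= K * (Rabs (u - x) + Rabs (v - y))) ->
  continuity_2d_pt f x y.
Proof.
  intros h eps.
  assert (hK : 0 < 2 * Rabs K + 1) by (pose proof (Rabs_pos K); lra).
  assert (hd : 0 < Rmin 1 (eps / (2 * Rabs K + 1))).
  { apply Rmin_glb_lt; [lra | apply Rdiv_lt_0_compat; [apply eps | lra]]. }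
  exists (mkposreal _ hd); simpl; intros u v hu hv.
  pose proof (Rmin_l 1 (eps / (2 * Rabs K + 1))).
  pose proof (Rmin_r 1 (eps / (2 * Rabs K + 1))) as hr.
  set (d := Rmin 1 (eps / (2 * Rabs K + 1))) in *.
  apply Rle_lt_trans with (1 := h u v ltac:(lra) ltac:(lra)).
  assert (d * (2 * Rabs K + 1) <= eps).
  { apply Rmult_le_compat_r with (r := 2 * Rabs K + 1) in hr; [|lra].
    unfold Rdiv in hr; rewrite Rmult_assoc, Rinv_l, Rmult_1_r in hr by lra; lra. }
  pose proof (RRle_abs K); pose proof (Rabs_pos (u-x)); pose proof (Rabs_pos (v-y)).
  pose proof (Rabs_pos K).
  nra.
Qed.

Lemma continuity_2d_eps (f : R -> R -> R) (x y : R) :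
  continuity_2d_pt f x y -> forall eps, 0 < eps -> exists d, 0 < d /\
  forall u v, Rabs (u - x) < d -> Rabs (v - y) < d -> Rabs (f u v - f x y) < eps.
Proof.
  intros h eps he; destruct (h (mkposreal eps he)) as [d hd].
  exists d; split; [apply d | exact hd].
Qed.

Lemma continuity_eps (f : R -> R) (x : R) :
  continuity_pt f x <-> forall eps, 0 < eps -> exists d, 0 < d /\
  forall u, Rabs (u - x) < d -> Rabs (f u - f x) < eps.
Proof.
  split; intros h eps he.
  - destruct (h eps he) as [d [hd h1]]; exists d; split; [exact hd|].
    intros u hu; destruct (Req_dec u x) as [->|hne].
    + now rewrite Rminus_diag, Rabs_R0.
    + apply h1; split; [|exact hu]; split; [exact I | auto].
  - destruct (h eps he) as [d [hd h1]]; exists d; split; [exact hd|].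
    intros u [_ hu]; now apply h1.
Qed.

Lemma Ck1_of_derivatives (f f1 f2 : R -> R -> R) :
  (forall x y, is_derive (fun z => f z y) x (f1 x y)) ->
  (forall x y, is_derive (fun z => f x z) y (f2 x y)) ->
  (forall x y, continuity_2d_pt f x y) ->
  (forall x y, continuity_2d_pt f1 x y) -> (forall x y, continuity_2d_pt f2 x y) ->
  Ck 1 f /\ (forall x y, d1 f x y = f1 x y) /\ (forall x y, d2 f x y = f2 x y).
Proof.
  intros h1 h2 c c1 c2.
  assert (e1 : forall x y, d1 f x y = f1 x y) by (intros; apply is_derive_unique, h1).
  assert (e2 : forall x y, d2 f x y = f2 x y) by (intros; apply is_derive_unique, h2).
  split; [|split]; auto; simpl; split; [exact c|].
  split; [intros x y; split; eexists; [apply h1 | apply h2]|].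
  split; intros x y.
  - apply continuity_2d_pt_ext with (2 := c1 x y); intros; now rewrite e1.
  - apply continuity_2d_pt_ext with (2 := c2 x y); intros; now rewrite e2.
Qed.

Ltac cont2d :=
  lazymatch goal with
  | |- continuity_2d_pt (fun u v => _ + _) _ _ => apply continuity_2d_pt_plus; cont2d
  | |- continuity_2d_pt (fun u v => _ - _) _ _ => apply continuity_2d_pt_minus; cont2d
  | |- continuity_2d_pt (fun u v => _ * _) _ _ => apply continuity_2d_pt_mult; cont2d
  | |- _ => first [solve [auto using continuity_2d_pt_id2] | apply continuity_2d_pt_const]
  end.

(** The common shape of the two test functions used below: a parabola in space centred on a moving
    point [ka]. The subsolution argument takes [be = 0] and [C] large; the supersolution argument
    takes for [be] the momentum of a characteristic and [C] nonpositive. *)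
Lemma quadratic_test_function (al be ka dal dbe dka : R -> R) (C : R) :
  (forall s, is_derive al s (dal s)) -> (forall s, is_derive be s (dbe s)) ->
  (forall s, is_derive ka s (dka s)) -> (forall s, continuity_pt dal s) ->
  (forall s, continuity_pt dbe s) -> (forall s, continuity_pt dka s) ->
  let f := fun s z => al s + be s * (z - ka s) + C * ((z - ka s) * (z - ka s)) in
  Ck 1 f /\
  (forall s z, d1 f s z =
     dal s + dbe s * (z - ka s) - be s * dka s - 2 * C * (z - ka s) * dka s) /\
  (forall s z, d2 f s z = be s + 2 * C * (z - ka s)).
Proof.
  intros ha hb hk ca cb ck f.
  assert (C1 : forall g : R -> R, (forall s, continuity_pt g s) ->
    forall s z, continuity_2d_pt (fun u _ => g u) s z).
  { intros g hg s z; apply (continuity_1d_2d_pt_comp g (fun u _ => u)); auto.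
    apply continuity_2d_pt_id1. }
  assert (Cd : forall g dg : R -> R, (forall s, is_derive g s (dg s)) ->
    forall s z, continuity_2d_pt (fun u _ => g u) s z).
  { intros g dg hg; apply C1; intros s; now apply derive_continuity with (dg s). }
  pose proof (Cd _ _ ha) as ka1; pose proof (Cd _ _ hb) as kb1; pose proof (Cd _ _ hk) as kk1.
  pose proof (C1 _ ca) as ka2; pose proof (C1 _ cb) as kb2; pose proof (C1 _ ck) as kk2.
  assert (cz : forall s z, continuity_2d_pt (fun u v => v - ka u) s z).
  { intros; apply continuity_2d_pt_minus; auto; apply continuity_2d_pt_id2. }
  apply (Ck1_of_derivatives f
    (fun s z => dal s + dbe s * (z - ka s) - be s * dka s - 2 * C * (z - ka s) * dka s)
    (fun s z => be s + 2 * C * (z - ka s))).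
  - intros s z; pose proof (ha s); pose proof (hb s); pose proof (hk s); unfold f; dvf; ring.
  - intros s z; unfold f; dvf; ring.
  - intros s z; unfold f; cont2d.
  - intros s z; cont2d.
  - intros s z; cont2d.
Qed.

(** * The Hamiltonian *)

(* All that is used of the Hamiltonian. Everything is local in [p] and uniform in [x], and the
   class is stable under the time reversal [H(x,p) -> H(x,-p)]. *)
Record Ham (H Hx Hp : R -> R -> R) : Prop := {
  ham_dx : forall x p, is_derive (fun z => H z p) x (Hx x p);
  ham_dp : forall x p, is_derive (fun z => H x z) p (Hp x p);
  ham_loc : forall P, exists C, 0 <= C /\ forall x p, Rabs p <= P ->
    Rabs (H x p) <= C /\ Rabs (Hx x p) <= C /\ Rabs (Hp x p) <= C /\
    forall y r, Rabs r <= P ->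
      Rabs (Hx x p - Hx y r) <= C * (Rabs (x - y) + Rabs (p - r)) /\
      Rabs (Hp x p - Hp y r) <= C * (Rabs (x - y) + Rabs (p - r));
  ham_mono : forall P, exists c, 0 < c /\ forall x p r, Rabs p <= P -> Rabs r <= P ->
    p <= r -> c * (r - p) <= Hp x r - Hp x p;
  ham_coer : forall V, exists P, 0 <= P /\ forall x p, Rabs (Hp x p) <= V -> Rabs p <= P;
  ham_surj : forall x v, exists p, Hp x p = v }.

Lemma ham_reverse (H Hx Hp : R -> R -> R) : Ham H Hx Hp ->
  Ham (fun x p => H x (- p)) (fun x p => Hx x (- p)) (fun x p => - Hp x (- p)).
Proof.
  intros [hx hp hl hm hc hs]; constructor.
  - intros x p; apply hx.
  - intros x p; apply is_derive_eq with (Hp x (- p) * - (1)); [|ring].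
    apply (D_comp (fun z => H x z) (fun p => - p)); [apply hp | dvf; ring].
  - intros P; destruct (hl P) as [C [h0 h]]; exists C; split; [exact h0|].
    intros x p hpP; destruct (h x (- p)) as (a & b & c & d); [now rewrite Rabs_Ropp|].
    rewrite Rabs_Ropp; repeat split; auto; destruct (d y (- r)) as [e f];
      try (now rewrite Rabs_Ropp); replace (p - r) with (- (- p - - r)) by ring;
      rewrite Rabs_Ropp; auto.
    rewrite <- Rabs_Ropp; replace (- (- Hp x (- p) - - Hp y (- r)))
      with (Hp x (- p) - Hp y (- r)) by ring; auto.
  - intros P; destruct (hm P) as [c [h0 h]]; exists c; split; [exact h0|].
    intros x p r h1 h2 h3; specialize (h x (- r) (- p)); rewrite !Rabs_Ropp in h.
    specialize (h h2 h1 ltac:(lra)); lra.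
  - intros V; destruct (hc V) as [P [h0 h]]; exists P; split; [exact h0|].
    intros x p; rewrite Rabs_Ropp, <- (Rabs_Ropp p); apply h.
  - intros x v; destruct (hs x (- v)) as [p h]; exists (- p); rewrite Ropp_involutive; lra.
Qed.

(** * From the three hypotheses to estimates uniform in [x] *)

Section FromHypotheses.

Variable H : R -> R -> R.
Hypothesis HC3 : hyp_C3 H.
Hypothesis HCNH : hyp_CNH H.
Hypothesis HCVX : hyp_CVX H.

(** By (CNH), replacing [x] by its projection onto a large interval does not change [H]; bounds on a
    compact box thereby become uniform in [x]. *)
Lemma truncation_Lipschitz (X : R) : exists cl : R -> R,
  (forall x, - Rabs X <= cl x <= Rabs X) /\ (forall x y, Rabs (cl x - cl y) <= Rabs (x - y)) /\
  (forall x, cl x = x \/ (Rabs X <= x /\ cl x = Rabs X) \/ (x <= - Rabs X /\ cl x = - Rabs X)).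
Proof.
  pose proof (Rabs_pos X) as hA; revert hA; generalize (Rabs X); intros A hA.
  exists (fun x => Rmax (- A) (Rmin A x)); split; [|split].
  - intros x; unfold Rmax, Rmin; repeat destruct Rle_dec; lra.
  - intros x y; unfold Rmax, Rmin; repeat destruct Rle_dec;
      unfold Rabs; repeat destruct Rcase_abs; lra.
  - intros x; unfold Rmax, Rmin; repeat destruct Rle_dec; lra.
Qed.

Lemma C1_Lipschitz_box (f fx fp : R -> R -> R) (X P : R) :
  (forall x p, is_derive (fun z => f z p) x (fx x p)) ->
  (forall x p, is_derive (fun z => f x z) p (fp x p)) ->
  (forall x y, continuity_2d_pt fx x y) -> (forall x y, continuity_2d_pt fp x y) ->
  0 <= X -> 0 <= P ->
  exists C, 0 <= C /\ forall x y p r, - X <= x <= X -> - X <= y <= X -> Rabs p <= P ->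
    Rabs r <= P -> Rabs (f x p - f y r) <= C * (Rabs (x - y) + Rabs (p - r)).
Proof.
  intros hx hp cx cp hX hP.
  destruct (box_bounded fx (- X) X (- P) P) as [A [hA0 hA]]; [lra|lra|auto|].
  destruct (box_bounded fp (- X) X (- P) P) as [B [hB0 hB]]; [lra|lra|auto|].
  exists (A + B); split; [lra|]; intros x y p r h1 h2 h3 h4.
  apply Rabs_le_between in h3; apply Rabs_le_between in h4.
  assert (e1 : Rabs (f x p - f y p) <= A * Rabs (x - y)).
  { apply (derive_Lipschitz (fun z => f z p) (fun z => fx z p)); [intros; apply hx|].
    intros z hz; apply hA; auto; revert hz; unfold Rmin, Rmax; destruct Rle_dec; lra. }
  assert (e2 : Rabs (f y p - f y r) <= B * Rabs (p - r)).
  { apply (derive_Lipschitz (fun z => f y z) (fun z => fp y z)); [intros; apply hp|].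
    intros z hz; apply hB; auto; revert hz; unfold Rmin, Rmax; destruct Rle_dec; lra. }
  replace (f x p - f y r) with ((f x p - f y p) + (f y p - f y r)) by ring.
  eapply Rle_trans; [apply Rabs_triang|].
  pose proof (Rabs_pos (x-y)); pose proof (Rabs_pos (p-r)); nra.
Qed.

Lemma d1_is_derive (k : nat) (f : R -> R -> R) (x p : R) :
  Ck (S k) f -> is_derive (fun z => f z p) x (d1 f x p).
Proof. intros [_ [h _]]; apply Derive_correct; exact (proj1 (h x p)). Qed.

Lemma d2_is_derive (k : nat) (f : R -> R -> R) (x p : R) :
  Ck (S k) f -> is_derive (fun z => f x z) p (d2 f x p).
Proof. intros [_ [h _]]; apply Derive_correct; exact (proj2 (h x p)). Qed.

Lemma Ck_continuity (k : nat) (f : R -> R -> R) (x p : R) : Ck k f -> continuity_2d_pt f x p.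
Proof. destruct k; [intros h; apply h | intros [h _]; apply h]. Qed.

Lemma ham_of_hypotheses : Ham H (d1 H) (d2 H).
Proof.
  destruct HCNH as [X [hX hN]].
  destruct (truncation_Lipschitz X) as [cl [cl1 [cl2 cl3]]].
  rewrite (Rabs_right X) in * by lra.
  assert (C0 : Ck 3 H) by exact HC3.
  assert (Cx : Ck 2 (d1 H)) by apply HC3.
  assert (Cp : Ck 2 (d2 H)) by apply HC3.
  assert (Hcl : forall x p, H x p = H (cl x) p).
  { intros x p; destruct (cl3 x) as [e|[[h e]|[h e]]]; rewrite e; auto.
    - pose proof (derive_Lipschitz (fun z => H z p) (fun z => d1 H z p) 0 x X) as K.
      rewrite Rmin_right, Rmax_left in K by lra.
      rewrite Rmult_0_l in K; apply Rminus_diag_uniq.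
      pose proof (Rabs_pos (H x p - H X p)).
      destruct (Req_dec (H x p - H X p) 0) as [q|q]; auto.
      apply Rabs_pos_lt in q; enough (Rabs (H x p - H X p) <= 0) by lra; apply K.
      + intros; now apply d1_is_derive with 2%nat.
      + intros z hz; rewrite hN, Rabs_R0; [lra|]; rewrite Rabs_right; lra.
    - pose proof (derive_Lipschitz (fun z => H z p) (fun z => d1 H z p) 0 x (- X)) as K.
      rewrite Rmin_left, Rmax_right in K by lra.
      rewrite Rmult_0_l in K; apply Rminus_diag_uniq.
      destruct (Req_dec (H x p - H (- X) p) 0) as [q|q]; auto.
      apply Rabs_pos_lt in q; enough (Rabs (H x p - H (- X) p) <= 0) by lra; apply K.
      + intros; now apply d1_is_derive with 2%nat.
      + intros z hz; rewrite hN, Rabs_R0; [lra|]; rewrite Rabs_left1; lra. }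
  (* Differentiating [Hcl] is not possible because [cl] has corners; where [cl] moves the point,
     both sides vanish by (CNH). *)
  assert (Hxcl : forall x p, d1 H x p = d1 H (cl x) p).
  { intros x p; destruct (cl3 x) as [e|[[h e]|[h e]]]; rewrite e; auto;
      rewrite !hN; auto; unfold Rabs; destruct Rcase_abs; lra. }
  assert (Hpcl : forall x p, d2 H x p = d2 H (cl x) p)
    by (intros x p; unfold d2; apply Derive_ext; intros; apply Hcl).
  constructor.
  - intros; now apply d1_is_derive with 2%nat.
  - intros; now apply d2_is_derive with 2%nat.
  - intros P0; set (P := Rabs P0).
    assert (hP : 0 <= P) by apply Rabs_pos.
    destruct (C1_Lipschitz_box (d1 H) (d1 (d1 H)) (d2 (d1 H)) X P) as [A [hA0 hA]]; try lra.
    { intros; now apply d1_is_derive with 1%nat. }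
    { intros; now apply d2_is_derive with 1%nat. }
    { intros; apply Ck_continuity with 1%nat; apply Cx. }
    { intros; apply Ck_continuity with 1%nat; apply Cx. }
    destruct (C1_Lipschitz_box (d2 H) (d1 (d2 H)) (d2 (d2 H)) X P) as [B [hB0 hB]]; try lra.
    { intros; now apply d1_is_derive with 1%nat. }
    { intros; now apply d2_is_derive with 1%nat. }
    { intros; apply Ck_continuity with 1%nat; apply Cp. }
    { intros; apply Ck_continuity with 1%nat; apply Cp. }
    destruct (box_bounded H (- X) X (- P) P) as [M1 [m1 hM1]]; try lra.
    { intros; apply Ck_continuity with 3%nat; auto. }
    destruct (box_bounded (d1 H) (- X) X (- P) P) as [M2 [m2 hM2]]; try lra.
    { intros; apply Ck_continuity with 2%nat; auto. }
    destruct (box_bounded (d2 H) (- X) X (- P) P) as [M3 [m3 hM3]]; try lra.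
    { intros; apply Ck_continuity with 2%nat; auto. }
    assert (hPP : forall p, Rabs p <= P0 -> Rabs p <= P).
    { intros p hp; apply Rle_trans with P0; auto; apply RRle_abs. }
    exists (A + B + M1 + M2 + M3); split; [lra|]; intros x p hp; apply hPP in hp.
    pose proof (hp) as hp'; apply Rabs_le_between in hp'.
    rewrite (Hcl x), (Hxcl x), (Hpcl x).
    split; [apply Rle_trans with M1; [apply hM1; auto | lra]|].
    split; [apply Rle_trans with M2; [apply hM2; auto | lra]|].
    split; [apply Rle_trans with M3; [apply hM3; auto | lra]|].
    intros y r hr; apply hPP in hr; rewrite (Hxcl y), (Hpcl y).
    pose proof (cl2 x y); pose proof (Rabs_pos (cl x - cl y)); pose proof (Rabs_pos (p - r)).
    split; (eapply Rle_trans; [first [apply hA | apply hB]; auto | nra]).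
  - intros P0; set (P := Rabs P0).
    assert (hP : 0 <= P) by apply Rabs_pos.
    assert (hPP : forall p, Rabs p <= P0 -> - P <= p <= P).
    { intros p hp; apply Rabs_le_between, Rle_trans with P0; auto; apply RRle_abs. }
    destruct (box_maximum (fun x p => - d2 (d2 H) x p) (- X) X (- P) P)
      as [x0 [p0 [hx0 [hp0 hm]]]]; try lra.
    { intros; apply continuity_2d_pt_opp, Ck_continuity with 1%nat; apply Cp. }
    exists (d2 (d2 H) x0 p0); split.
    + destruct (HCVX x0) as [inc [_ [g [g1 [_ [g3 _]]]]]].
      assert (D2 : is_derive (fun p => d2 H x0 p) p0 (d2 (d2 H) x0 p0))
        by now apply d2_is_derive with 1%nat.
      (* An increasing map may have a zero derivative; differentiability of the inverse [g] excludes
         it, since the chain rule makes the product of the two derivatives equal to 1. *)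
      assert (n0 : d2 (d2 H) x0 p0 <> 0).
      { intros e; destruct (g3 (d2 H x0 p0)) as [l hl].
        pose proof (D_comp g (fun p => d2 H x0 p) p0 _ _ hl D2) as D3.
        assert (D4 : is_derive (fun p => p) p0 (l * d2 (d2 H) x0 p0)).
        { apply is_derive_ext with (2 := D3); intros t; apply g1. }
        assert (D5 : l * d2 (d2 H) x0 p0 = 1).
        { transitivity (Derive (fun p : R => p) p0); [symmetry|]; apply is_derive_unique;
            [exact D4 | apply D_id]. }
        rewrite e in D5; lra. }
      enough (0 <= d2 (d2 H) x0 p0) by lra.
      apply Rnot_lt_le; intros neg.
      apply is_derive_Reals in D2.
      destruct (D2 (- d2 (d2 H) x0 p0 / 2)) as [de hde]; [lra|].
      specialize (hde (de / 2)); pose proof (cond_pos de).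
      specialize (hde ltac:(lra) ltac:(rewrite Rabs_right; lra)).
      pose proof (inc p0 (p0 + de / 2) ltac:(lra)).
      assert (0 < (d2 H x0 (p0 + de / 2) - d2 H x0 p0) / (de / 2))
        by (apply Rdiv_lt_0_compat; lra).
      apply Rabs_def2 in hde; lra.
    + intros x p r hp hr hpr; apply hPP in hp; apply hPP in hr.
      rewrite (Hpcl x r), (Hpcl x p).
      apply (derive_ge (fun z => d2 H (cl x) z) (fun z => d2 (d2 H) (cl x) z)); auto.
      * intros; now apply d2_is_derive with 1%nat.
      * intros z hz; specialize (hm (cl x) z (cl1 x) ltac:(lra)); lra.
  - intros V.
    assert (ex : forall x w, exists p, d2 H x p = w).
    { intros x w; destruct (HCVX x) as [_ [_ [g [_ [g2 _]]]]]; exists (g w); apply g2. }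
    (* For a fixed velocity [w], the conjugate momentum [G x] is continuous in [x], hence bounded on
       [[-X, X]] and so everywhere. Monotonicity then brackets all velocities between [- V] and
       [V]. *)
    assert (B : forall w, exists P, 0 <= P /\ forall x p, d2 H x p = w -> Rabs p <= P).
    { intros w.
      set (G := fun x => proj1_sig (constructive_indefinite_description _ (ex x w))).
      assert (HG : forall x, d2 H x (G x) = w)
        by (intros x; unfold G; destruct (constructive_indefinite_description _ (ex x w)); auto).
      assert (inj : forall x p, d2 H x p = w -> p = G x).
      { intros x p e; destruct (HCVX x) as [inc _]; pose proof (HG x).
        destruct (Rtotal_order p (G x)) as [l|[l|l]]; auto;
          specialize (inc _ _ l); simpl in inc; lra. }
      (* For [u] near [x], the values of [d2 H u] at [G x - eps/2] and [G x + eps/2] stay on either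
         side of [w], which traps [G u]. *)
      assert (cG : forall x, continuity_pt G x).
      { intros x; apply continuity_eps; intros eps he.
        destruct (HCVX x) as [inc _].
        pose proof (inc (G x - eps/2) (G x) ltac:(lra)) as i1.
        pose proof (inc (G x) (G x + eps/2) ltac:(lra)) as i2; simpl in i1, i2; rewrite HG in i1, i2.
        assert (cc : forall q, continuity_2d_pt (d2 H) x q)
          by (intros; apply Ck_continuity with 2%nat; auto).
        destruct (continuity_2d_eps _ _ _ (cc (G x - eps/2)) (w - d2 H x (G x - eps/2)))
          as [d [hd h1]]; [lra|].
        destruct (continuity_2d_eps _ _ _ (cc (G x + eps/2)) (d2 H x (G x + eps/2) - w))
          as [d' [hd' h2]]; [lra|].
        exists (Rmin d d'); split; [now apply Rmin_glb_lt|]; intros u hu.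
        pose proof (Rmin_l d d'); pose proof (Rmin_r d d').
        specialize (h1 u (G x - eps/2) ltac:(lra)); specialize (h2 u (G x + eps/2) ltac:(lra)).
        rewrite Rminus_diag, Rabs_R0 in h1, h2.
        specialize (h1 hd); specialize (h2 hd').
        apply Rabs_def2 in h1; apply Rabs_def2 in h2.
        destruct (HCVX u) as [incu _]; pose proof (HG u).
        apply Rabs_def1.
        - apply Rnot_le_lt; intros l.
          pose proof (incu (G x + eps/2) (G u) ltac:(lra)) as K; simpl in K; lra.
        - apply Rnot_le_lt; intros l.
          pose proof (incu (G u) (G x - eps/2) ltac:(lra)) as K; simpl in K; lra. }
      destruct (continuity_ab_maj (fun x => Rabs (G x)) (- X) X) as [m [hm _]]; [lra| |].
      { intros c _; apply (continuity_pt_comp G Rabs); [apply cG | apply Rcontinuity_abs]. }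
      exists (Rabs (G m)); split; [apply Rabs_pos|]; intros x p e.
      rewrite Hpcl in e; apply inj in e; rewrite e; apply hm, cl1. }
    destruct (B V) as [P1 [p1 h1]]; destruct (B (- V)) as [P2 [p2 h2]].
    exists (P1 + P2); split; [lra|]; intros x p hp; apply Rabs_le_between in hp.
    destruct (ex x V) as [r1 e1]; destruct (ex x (- V)) as [r2 e2].
    pose proof (h1 _ _ e1) as b1; pose proof (h2 _ _ e2) as b2.
    destruct (HCVX x) as [inc _]; simpl in inc.
    apply Rabs_le_between in b1; apply Rabs_le_between in b2; apply Rabs_le_between; split.
    + apply Rnot_lt_le; intros l; pose proof (inc p r2 ltac:(lra)); lra.
    + apply Rnot_lt_le; intros l; pose proof (inc r1 p ltac:(lra)); lra.
  - intros x v; destruct (HCVX x) as [_ [_ [g [_ [g2 _]]]]]; exists (g v); apply g2.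
Qed.

End FromHypotheses.

(** * The Lagrangian *)

Section Lagrangian.

Variables H Hx Hp : R -> R -> R.
Hypothesis HH : Ham H Hx Hp.

Lemma ham_Lipschitz (P : R) : exists C, 0 <= C /\ forall x y p r, Rabs p <= P -> Rabs r <= P ->
  Rabs (H x p - H y r) <= C * (Rabs (x - y) + Rabs (p - r)).
Proof.
  destruct (ham_loc _ _ _ HH P) as [C [h0 h]]; exists C; split; [exact h0|].
  intros x y p r h1 h2.
  assert (e1 : Rabs (H x p - H y p) <= C * Rabs (x - y)).
  { apply (derive_Lipschitz (fun z => H z p) (fun z => Hx z p)).
    - intros; apply (ham_dx _ _ _ HH).
    - intros z _; now destruct (h z p h1) as (_ & k & _). }
  assert (e2 : Rabs (H y p - H y r) <= C * Rabs (p - r)).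
  { apply (derive_Lipschitz (fun z => H y z) (fun z => Hp y z)).
    - intros; apply (ham_dp _ _ _ HH).
    - intros z hz; destruct (h y z) as (_ & _ & k & _); auto.
      apply Rabs_le_between in h1; apply Rabs_le_between in h2; apply Rabs_le_between.
      revert hz; unfold Rmin, Rmax; destruct Rle_dec; lra. }
  replace (H x p - H y r) with ((H x p - H y p) + (H y p - H y r)) by ring.
  eapply Rle_trans; [apply Rabs_triang | lra].
Qed.

Lemma ham_increasing (x p r : R) : p <= r -> Hp x p <= Hp x r.
Proof.
  intros h; destruct (ham_mono _ _ _ HH (Rmax (Rabs p) (Rabs r))) as [c [h0 hc]].
  specialize (hc x p r (Rmax_l _ _) (Rmax_r _ _) h); nra.
Qed.

Lemma ham_convex (x p r : R) : H x p + Hp x p * (r - p) <= H x r.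
Proof.
  destruct (Rle_dec p r) as [l|l].
  - pose proof (derive_ge (fun z => H x z) (fun z => Hp x z) (Hp x p) p r l) as K.
    enough (Hp x p * (r - p) <= H x r - H x p) by lra; apply K.
    + intros; apply (ham_dp _ _ _ HH).
    + intros; now apply ham_increasing.
  - pose proof (derive_le (fun z => H x z) (fun z => Hp x z) (Hp x p) r p ltac:(lra)) as K.
    enough (H x p - H x r <= Hp x p * (p - r)) by lra; apply K.
    + intros; apply (ham_dp _ _ _ HH).
    + intros; now apply ham_increasing.
Qed.

(** Outside [[-(P+1), P+1]] the slope in [p] is at least 1 in size and points outwards, so [H] grows
    at least linearly, uniformly in [x]. Bounded energy thus means bounded momentum. *)
Lemma ham_coercive (E : R) : exists P, 0 <= P /\ forall x p, H x p <= E -> Rabs p <= P.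
Proof.
  destruct (ham_coer _ _ _ HH 1) as [P [hP h]].
  destruct (ham_loc _ _ _ HH (P + 1)) as [C [h0 hC]].
  (* The zero of [Hp x] lies in [[-P, P]], which fixes the signs at [P + 1] and [- (P + 1)];
     coercivity at level 1 gives the sizes. *)
  assert (big : forall x, 1 <= Hp x (P + 1) /\ Hp x (- (P + 1)) <= - 1).
  { intros x; destruct (ham_surj _ _ _ HH x 0) as [r hr].
    assert (hr' : Rabs r <= P) by (apply (h x); rewrite hr, Rabs_R0; lra).
    apply Rabs_le_between in hr'.
    pose proof (ham_increasing x r (P + 1) ltac:(lra)).
    pose proof (ham_increasing x (- (P + 1)) r ltac:(lra)).
    split; apply Rnot_lt_le; intros l.
    - pose proof (h x (P + 1)) as K; rewrite !Rabs_right in K by lra; lra.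
    - pose proof (h x (- (P + 1))) as K; rewrite !Rabs_left1 in K by lra; lra. }
  exists (P + 1 + Rabs E + C); split; [pose proof (Rabs_pos E); lra|].
  intros x p hE; destruct (big x) as [b1 b2].
  pose proof (RRle_abs E); pose proof (Rabs_pos E).
  destruct (hC x (P + 1)) as [c1 _]; [rewrite Rabs_right; lra|].
  destruct (hC x (- (P + 1))) as [c2 _]; [rewrite Rabs_left1; lra|].
  apply Rabs_le_between in c1; apply Rabs_le_between in c2.
  pose proof (ham_convex x (P + 1) p); pose proof (ham_convex x (- (P + 1)) p).
  apply Rabs_le_between; split; apply Rnot_lt_le; intros l; nra.
Qed.

Lemma ham_expansion (P : R) : exists C, 0 <= C /\ forall x h p, Rabs p <= P ->
  Rabs (H (x + h) p - H x p - Hx x p * h) <= C * (h * h).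
Proof.
  destruct (ham_loc _ _ _ HH P) as [C [h0 hC]]; exists C; split; [exact h0|].
  intros x h p hp.
  assert (hh : Rabs h * Rabs h = h * h)
    by (apply Rabs_square).
  pose proof (derive_Lipschitz (fun z => H z p - Hx x p * z)
    (fun z => Hx z p - Hx x p) (C * Rabs h) (x + h) x) as K.
  replace (x + h - x) with h in K by ring.
  replace (H (x + h) p - H x p - Hx x p * h)
    with (H (x + h) p - Hx x p * (x + h) - (H x p - Hx x p * x)) by ring.
  rewrite <- hh, <- Rmult_assoc; apply K.
  - intros z _; pose proof (ham_dx _ _ _ HH z p); dvf; ring.
  - intros z hz; destruct (hC z p hp) as (_ & _ & _ & k).
    destruct (k x p hp) as [k1 _]; eapply Rle_trans; [exact k1|].
    rewrite (Rminus_diag p), Rabs_R0, Rplus_0_r; apply Rmult_le_compat_l; [exact h0|].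
    revert hz; unfold Rmin, Rmax; destruct Rle_dec; unfold Rabs; repeat destruct Rcase_abs; lra.
Qed.

(** By convexity the supremum is attained at the momentum conjugate to the velocity. As every
    velocity is of the form [Hp x p], the supremum never has to be opened again. *)
Lemma Lag_eq (x p : R) : Lag H x (Hp x p) = p * Hp x p - H x p.
Proof.
  unfold Lag; rewrite (is_lub_Rbar_unique _ (Finite (p * Hp x p - H x p))); [reflexivity|].
  split.
  - intros y [r ->]; simpl; pose proof (ham_convex x p r); nra.
  - intros b hb; apply (hb (p * Hp x p - H x p)); now exists p.
Qed.

Lemma Young (x p v : R) : p * v - H x p <= Lag H x v.
Proof.
  destruct (ham_surj _ _ _ HH x v) as [r <-]; rewrite Lag_eq.
  pose proof (ham_convex x r p); nra.
Qed.

Lemma Lag_attained (V : R) : exists P, 0 <= P /\ forall x v, Rabs v <= V ->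
  exists p, Rabs p <= P /\ Hp x p = v /\ Lag H x v = p * v - H x p.
Proof.
  destruct (ham_coer _ _ _ HH V) as [P [h0 h]]; exists P; split; [exact h0|].
  intros x v hv; destruct (ham_surj _ _ _ HH x v) as [p hp]; exists p.
  split; [apply (h x); now rewrite hp|]; split; [exact hp|].
  rewrite <- hp; apply Lag_eq.
Qed.

Lemma Lag_Lipschitz (V : R) : exists C, 0 <= C /\ forall x y v w, Rabs v <= V -> Rabs w <= V ->
  Rabs (Lag H x v - Lag H y w) <= C * (Rabs (x - y) + Rabs (v - w)).
Proof.
  destruct (Lag_attained V) as [P [hP h]].
  destruct (ham_Lipschitz P) as [C [hC hl]].
  exists (C + P); split; [lra|].
  assert (K : forall x y v w, Rabs v <= V -> 
    Lag H x v - Lag H y w <= (C + P) * (Rabs (x - y) + Rabs (v - w))).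
  { intros x y v w hv; destruct (h x v hv) as [p [h1 [_ ->]]].
    pose proof (Young y p w).
    specialize (hl x y p p h1 h1); rewrite Rminus_diag, Rabs_R0 in hl.
    apply Rabs_le_between in hl.
    assert (p * (v - w) <= P * Rabs (v - w)).
    { apply Rle_trans with (Rabs (p * (v - w))); [apply RRle_abs|].
      rewrite Rabs_mult; apply Rmult_le_compat_r; [apply Rabs_pos | exact h1]. }
    pose proof (Rabs_pos (x - y)); pose proof (Rabs_pos (v - w)); nra. }
  intros x y v w hv hw; pose proof (K x y v w hv) as k1; pose proof (K y x w v hw) as k2.
  rewrite (Rabs_minus_sym y), (Rabs_minus_sym w) in k2.
  apply Rabs_le_between; lra.
Qed.

(** Young's inequality at the two constant momenta [M] and [- M]. *)
Lemma Lag_superlinear (M : R) : 0 <= M -> exists C, 0 <= C /\ forall x v, M * Rabs v - C <= Lag H x v.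
Proof.
  intros hM; destruct (ham_loc _ _ _ HH M) as [C [h0 h]]; exists C; split; [exact h0|].
  intros x v.
  destruct (h x M) as [a _]; [rewrite Rabs_right; lra|].
  destruct (h x (- M)) as [b _]; [rewrite Rabs_left1; lra|].
  apply Rabs_le_between in a; apply Rabs_le_between in b.
  pose proof (Young x M v); pose proof (Young x (- M) v).
  unfold Rabs; destruct Rcase_abs; lra.
Qed.

Lemma Lag_bounded (V : R) : exists C, 0 <= C /\ forall x v, Rabs v <= V -> Rabs (Lag H x v) <= C.
Proof.
  destruct (Lag_attained V) as [P [hP h]]; destruct (ham_loc _ _ _ HH P) as [C [h0 hC]].
  exists (P * Rabs V + C); pose proof (Rabs_pos V); split; [nra|].
  intros x v hv; destruct (h x v hv) as [p [h1 [_ ->]]].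
  destruct (hC x p h1) as [k _].
  assert (Rabs (p * v) <= P * Rabs V).
  { rewrite Rabs_mult; apply Rmult_le_compat; try apply Rabs_pos; auto.
    eapply Rle_trans; [exact hv | apply RRle_abs]. }
  unfold Rminus; eapply Rle_trans; [apply Rabs_triang|]; rewrite Rabs_Ropp; lra.
Qed.

(** Subadditivity of the perspective function [t L(w/t)]: convexity in the form that adds the chords
    of two consecutive time intervals. *)
Lemma Lag_convex (x u w s t : R) : 0 < s -> 0 < t ->
  (s + t) * Lag H x ((u + w) / (s + t)) <= s * Lag H x (u / s) + t * Lag H x (w / t).
Proof.
  intros hs ht; destruct (ham_surj _ _ _ HH x ((u + w) / (s + t))) as [p hp].
  rewrite <- hp, Lag_eq, hp.
  pose proof (Young x p (u / s)) as a; pose proof (Young x p (w / t)) as b.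
  apply Rmult_le_compat_l with (r := s) in a; [|lra].
  apply Rmult_le_compat_l with (r := t) in b; [|lra].
  replace (s * (p * (u / s) - H x p)) with (p * u - s * H x p) in a by (field; lra).
  replace (t * (p * (w / t) - H x p)) with (p * w - t * H x p) in b by (field; lra).
  replace ((s + t) * (p * ((u + w) / (s + t)) - H x p)) with (p * (u + w) - (s + t) * H x p)
    by (field; lra).
  lra.
Qed.

(** Let [q] be conjugate to the new velocity at the new point. Young's inequality at the old point,
    with momentum [q], leaves the linear terms taken at [q] instead of [p]. The mismatch is
    quadratic because [q - p] is itself of first order. This one expansion gives both the discrete
    Euler-Lagrange equation and the semiconcavity of value functions. *)
Lemma Lag_semiconcave (V : R) : exists C, 0 <= C /\ forall x p h w,
  Rabs (Hp x p) <= V -> Rabs h <= 1 -> Rabs w <= 1 ->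
  Lag H (x + h) (Hp x p + w) <= Lag H x (Hp x p) + p * w - Hx x p * h + C * (h * h + w * w).
Proof.
  destruct (ham_coer _ _ _ HH (Rabs V + 1)) as [P [hP hco]].
  destruct (ham_loc _ _ _ HH P) as [A [hA ha]].
  destruct (ham_expansion P) as [B [hB hb]].
  destruct (ham_mono _ _ _ HH P) as [c [hc hm]].
  exists (B + (A + 1) * (A + 1) * / c * 2); split.
  { pose proof (Rinv_0_lt_compat c hc); nra. }
  intros x p h w hv hh hw.
  assert (hv' : Rabs (Hp x p) <= Rabs V) by (apply Rle_trans with V; auto; apply RRle_abs).
  destruct (ham_surj _ _ _ HH (x + h) (Hp x p + w)) as [q hq].
  assert (bp : Rabs p <= P) by (apply (hco x); lra).
  assert (bq : Rabs q <= P).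
  { apply (hco (x + h)); rewrite hq; eapply Rle_trans; [apply Rabs_triang | lra]. }
  rewrite <- hq, Lag_eq, hq.
  pose proof (Young x q (Hp x p)).
  pose proof (hb x h q bq) as e; apply Rabs_le_between in e.
  assert (d1' : Rabs (Hx x p - Hx x q) <= A * Rabs (p - q)).
  { destruct (ha x p bp) as (_ & _ & _ & k); destruct (k x q bq) as [k1 _].
    now rewrite Rminus_diag, Rabs_R0, Rplus_0_l in k1. }
  assert (d2' : Rabs (Hp x q - Hp x p) <= A * Rabs h + Rabs w).
  { destruct (ha x q bq) as (_ & _ & _ & k); destruct (k (x + h) q bq) as [_ k1].
    rewrite Rminus_diag, Rabs_R0, Rplus_0_r in k1.
    replace (x - (x + h)) with (- h) in k1 by ring; rewrite Rabs_Ropp in k1.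
    replace (Hp x q - Hp x p) with ((Hp x q - Hp (x + h) q) + w) by (rewrite hq; ring).
    eapply Rle_trans; [apply Rabs_triang | lra]. }
  (* Strict monotonicity of [Hp] converts the difference of velocities into a bound on [|p - q|] by
     a multiple of [|h| + |w|]. *)
  assert (d3 : c * Rabs (p - q) <= Rabs (Hp x q - Hp x p)).
  { destruct (Rle_dec p q) as [l|l].
    - specialize (hm x p q bp bq l); rewrite Rabs_minus_sym, Rabs_right by lra.
      eapply Rle_trans; [exact hm | apply RRle_abs].
    - specialize (hm x q p bq bp ltac:(lra)); rewrite Rabs_right, Rabs_minus_sym by lra.
      eapply Rle_trans; [exact hm | apply RRle_abs]. }
  set (S := Rabs h + Rabs w).
  assert (hS : S * S <= 2 * (h * h + w * w)).
  { unfold S; assert (Rabs h * Rabs h = h * h) by (apply Rabs_square).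
    assert (Rabs w * Rabs w = w * w) by (apply Rabs_square).
    pose proof (Rle_0_sqr (Rabs h - Rabs w)) as sq; unfold Rsqr in sq; lra. }
  pose proof (Rabs_pos h); pose proof (Rabs_pos w); pose proof (Rabs_pos (p - q)).
  assert (d4 : Rabs (p - q) <= (A + 1) * S * / c).
  { apply Rmult_le_reg_l with c; [exact hc|].
    replace (c * ((A + 1) * S * / c)) with ((A + 1) * S) by (field; lra).
    assert (0 <= A * Rabs w) by (apply Rmult_le_pos; auto).
    replace ((A + 1) * S) with (A * Rabs h + Rabs w + Rabs h + A * Rabs w) by (unfold S; ring); lra. }
  assert (d5 : (q - p) * w - (Hx x q - Hx x p) * h <= (A + 1) * Rabs (p - q) * S).
  { apply Rle_trans with (Rabs (p - q) * Rabs w + A * Rabs (p - q) * Rabs h).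
    - assert ((q - p) * w <= Rabs (p - q) * Rabs w).
      { rewrite Rabs_minus_sym, <- Rabs_mult; apply RRle_abs. }
      assert (- (Hx x q - Hx x p) * h <= A * Rabs (p - q) * Rabs h).
      { apply Rle_trans with (Rabs (Hx x p - Hx x q) * Rabs h).
        - rewrite <- Rabs_mult; replace (- (Hx x q - Hx x p) * h) with ((Hx x p - Hx x q) * h)
            by ring; apply RRle_abs.
        - apply Rmult_le_compat_r; auto. }
      lra.
    - assert (0 <= A * (Rabs (p - q) * Rabs w)) by (repeat apply Rmult_le_pos; auto).
      assert (0 <= Rabs (p - q) * Rabs h) by (repeat apply Rmult_le_pos; auto).
      unfold S; lra. }
  assert (d6 : (A + 1) * Rabs (p - q) * S <= (A + 1) * (A + 1) * / c * 2 * (h * h + w * w)).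
  { assert (hc' : 0 <= / c) by (apply Rlt_le, Rinv_0_lt_compat, hc).
    assert (S0 : 0 <= S) by (unfold S; lra).
    apply Rle_trans with ((A + 1) * ((A + 1) * S * / c) * S).
    - apply Rmult_le_compat_r; auto; apply Rmult_le_compat_l; lra.
    - replace ((A + 1) * ((A + 1) * S * / c) * S) with ((A + 1) * (A + 1) * / c * (S * S)) by ring.
      replace ((A + 1) * (A + 1) * / c * 2 * (h * h + w * w))
        with ((A + 1) * (A + 1) * / c * (2 * (h * h + w * w))) by ring.
      apply Rmult_le_compat_l; auto; apply Rmult_le_pos; auto; nra. }
  set (K := (A + 1) * (A + 1) * / c * 2) in *.
  assert (0 <= h * h + w * w) by nra.
  assert (0 <= B * (w * w)) by (apply Rmult_le_pos; nra).
  nra.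
Qed.

End Lagrangian.

(** * Picard-Lindelof *)

Lemma geometric_limit (u : nat -> R) (m : R) :
  (forall k, Rabs (u (S k) - u k) <= m * (/ 2) ^ k) ->
  exists l, forall k, Rabs (u k - l) <= 2 * m * (/ 2) ^ k.
Proof.
  intros h.
  assert (m0 : 0 <= m) by (specialize (h O); pose proof (Rabs_pos (u 1%nat - u O)); simpl in h; lra).
  assert (hp : forall k, 0 < (/ 2) ^ k) by (intros; apply pow_lt; lra).
  assert (C : forall k n, Rabs (u (n + k)%nat - u k) <= 2 * m * (/ 2) ^ k - 2 * m * (/ 2) ^ (n + k)).
  { intros k n; induction n as [|n IH]; simpl.
    - rewrite Rminus_diag, Rabs_R0; lra.
    - replace (u (S (n + k)) - u k) with ((u (S (n + k)) - u (n + k)%nat) + (u (n + k)%nat - u k)) by ring.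
      eapply Rle_trans; [apply Rabs_triang|]; specialize (h (n + k)%nat).
      set (z := (/ 2) ^ (n + k)) in *; lra. }
  assert (C' : forall k n, (k <= n)%nat -> Rabs (u n - u k) <= 2 * m * (/ 2) ^ k).
  { intros k n hn; specialize (C k (n - k)%nat); replace (n - k + k)%nat with n in C by lia.
    specialize (hp n); assert (0 <= 2 * m * (/ 2) ^ n) by (apply Rmult_le_pos; lra); lra. }
  destruct (Rcomplete.R_complete u) as [l hl].
  - intros eps he.
    destruct (pow_lt_1_zero (/ 2) ltac:(rewrite Rabs_right; lra) (eps / (4 * m + 1)))
      as [N hN]; [apply Rdiv_lt_0_compat; lra|].
    exists N; intros n k hn hk; unfold R_dist.
    specialize (hN N (le_n N)); rewrite Rabs_right in hN by (specialize (hp N); lra).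
    replace (u n - u k) with ((u n - u N) - (u k - u N)) by ring.
    pose proof (C' N n hn); pose proof (C' N k hk).
    eapply Rle_lt_trans; [apply Rabs_triang|]; rewrite Rabs_Ropp.
    apply (Rmult_lt_compat_l (4 * m + 1)) in hN; [|lra].
    replace ((4 * m + 1) * (eps / (4 * m + 1))) with eps in hN by (field; lra).
    specialize (hp N); lra.
  - exists l; intros k; apply le_epsilon; intros eps he.
    destruct (hl eps he) as [N hN]; specialize (hN (N + k)%nat ltac:(lia)).
    unfold R_dist in hN; specialize (C' k (N + k)%nat ltac:(lia)).
    replace (u k - l) with ((u (N + k)%nat - l) - (u (N + k)%nat - u k)) by ring.
    eapply Rle_trans; [apply Rabs_triang|]; rewrite Rabs_Ropp; lra.
Qed.

Lemma is_derive_primitive (c : R) (f : R -> R) (t : R) :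
  (forall s, continuity_pt f s) -> is_derive (fun t => c + RInt f 0 t) t (f t).
Proof.
  intros h.
  assert (hc : forall s, continuous f s) by (intros; apply continuity_pt_filterlim, h).
  apply is_derive_eq with (0 + f t); [|ring].
  apply D_plus; [apply D_const|].
  apply (is_derive_RInt f (fun t => RInt f 0 t) 0 t).
  - exists (mkposreal 1 Rlt_0_1); intros b _; apply (RInt_correct f 0 b), (ex_RInt_continuous f); auto.
  - apply hc.
Qed.

Lemma primitive_at_0 (c : R) (f : R -> R) : c + RInt f 0 0 = c.
Proof. rewrite RInt_point; unfold zero; simpl; ring. Qed.

(** In the norm with weight [exp (la * |t|)], integration gains a factor [1 / la]. Picard iteration
    becomes a contraction on the whole line at once, with no patching of local solutions. *)
Lemma exponential_bound (f df : R -> R) (m la : R) : 0 < la -> f 0 = 0 ->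
  (forall t, is_derive f t (df t)) -> (forall t, Rabs (df t) <= m * exp (la * Rabs t)) ->
  forall t, Rabs (f t) <= m / la * exp (la * Rabs t).
Proof.
  intros hla.
  assert (P : forall f df, f 0 = 0 -> (forall t, is_derive f t (df t)) ->
    (forall t, Rabs (df t) <= m * exp (la * Rabs t)) ->
    forall t, 0 <= t -> f t <= m / la * exp (la * Rabs t)).
  { clear f df; intros f df h0 h hd t ht.
    assert (0 <= m).
    { specialize (hd 0); rewrite Rabs_R0, Rmult_0_r, exp_0 in hd.
      pose proof (Rabs_pos (df 0)); lra. }
    assert (0 <= m / la) by (apply Rmult_le_pos; [lra | apply Rlt_le, Rinv_0_lt_compat; lra]).
    pose proof (derive_le (fun t => f t - m / la * exp (la * t))
      (fun t => df t - m * exp (la * t)) 0 0 t ht) as K.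
    cbv beta in K; rewrite h0, Rmult_0_r, exp_0 in K; rewrite (Rabs_right t) by lra.
    enough (f t - m / la * exp (la * t) - (0 - m / la * 1) <= 0 * (t - 0)) by lra.
    apply K; intros s hs.
    - pose proof (h s).
      assert (is_derive (fun t => exp (la * t)) s (exp (la * s) * la)).
      { apply (D_comp exp (fun t => la * t)); [apply is_derive_exp | dvf; ring]. }
      dvf; field; lra.
    - specialize (hd s); rewrite (Rabs_right s) in hd by lra; apply Rabs_le_between in hd; lra. }
  assert (Q : forall f df, f 0 = 0 -> (forall t, is_derive f t (df t)) ->
    (forall t, Rabs (df t) <= m * exp (la * Rabs t)) ->
    forall t, 0 <= t -> Rabs (f t) <= m / la * exp (la * Rabs t)).
  { intros g dg h0 h hd t ht; apply Rabs_le_between; split.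
    - enough (- g t <= m / la * exp (la * Rabs t)) by lra.
      apply (P (fun t => - g t) (fun t => - dg t)); auto.
      + lra.
      + intros s; now apply D_opp.
      + intros s; now rewrite Rabs_Ropp.
    - now apply (P g dg). }
  intros h0 h hd t; destruct (Rle_dec 0 t) as [l|l]; [now apply (Q f df)|].
  rewrite <- (Rabs_Ropp t).
  replace (f t) with ((fun t => f (- t)) (- t)) by (simpl; now rewrite Ropp_involutive).
  apply (Q (fun t => f (- t)) (fun t => df (- t) * - (1))); [now rewrite Ropp_0| | |lra].
  - intros s; apply (D_comp f (fun t => - t)); [apply h | dvf; ring].
  - intros s; rewrite Rabs_mult, Rabs_Ropp, Rabs_R1, Rmult_1_r, <- (Rabs_Ropp s); apply hd.
Qed.

Section Picard.

Variables (F1 F2 : R -> R -> R) (La B : R).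
Hypothesis La1 : 1 <= La.
Hypothesis F1L : forall x y u v, Rabs (F1 x y - F1 u v) <= La * (Rabs (x - u) + Rabs (y - v)).
Hypothesis F2L : forall x y u v, Rabs (F2 x y - F2 u v) <= La * (Rabs (x - u) + Rabs (y - v)).
Hypothesis F1B : forall x y, Rabs (F1 x y) <= B.
Hypothesis F2B : forall x y, Rabs (F2 x y) <= B.

Lemma continuity_field (F : R -> R -> R) (x y : R -> R) (t : R) :
  (forall x y u v, Rabs (F x y - F u v) <= La * (Rabs (x - u) + Rabs (y - v))) ->
  continuity_pt x t -> continuity_pt y t -> continuity_pt (fun s => F (x s) (y s)) t.
Proof.
  intros hF hx hy; apply continuity_eps; intros eps he.
  assert (he' : 0 < eps / (2 * La)) by (apply Rdiv_lt_0_compat; lra).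
  destruct (proj1 (continuity_eps x t) hx _ he') as [d [hd h1]].
  destruct (proj1 (continuity_eps y t) hy _ he') as [d' [hd' h2]].
  exists (Rmin d d'); split; [now apply Rmin_glb_lt|]; intros u hu.
  pose proof (Rmin_l d d'); pose proof (Rmin_r d d').
  specialize (h1 u ltac:(lra)); specialize (h2 u ltac:(lra)).
  eapply Rle_lt_trans; [apply hF|].
  replace eps with (La * (eps / (2 * La) + eps / (2 * La))) by (field; lra).
  apply Rmult_lt_compat_l; lra.
Qed.

Fixpoint picard (x0 y0 : R) (k : nat) : (R -> R) * (R -> R) :=
  match k with
  | O => (fun _ => x0, fun _ => y0)
  | S k => let '(x, y) := picard x0 y0 k in
      (fun t => x0 + RInt (fun s => F1 (x s) (y s)) 0 t,
       fun t => y0 + RInt (fun s => F2 (x s) (y s)) 0 t)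
  end.

Theorem picard_lindelof (x0 y0 : R) : exists x y : R -> R,
  x 0 = x0 /\ y 0 = y0 /\
  forall t, is_derive x t (F1 (x t) (y t)) /\ is_derive y t (F2 (x t) (y t)).
Proof.
  set (X := fun k => fst (picard x0 y0 k)); set (Y := fun k => snd (picard x0 y0 k)).
  assert (XS : forall k t, X (S k) t = x0 + RInt (fun s => F1 (X k s) (Y k s)) 0 t)
    by (intros k t; unfold X, Y; simpl; now destruct (picard x0 y0 k)).
  assert (YS : forall k t, Y (S k) t = y0 + RInt (fun s => F2 (X k s) (Y k s)) 0 t)
    by (intros k t; unfold X, Y; simpl; now destruct (picard x0 y0 k)).
  assert (B0 : 0 <= B) by (pose proof (F1B 0 0); pose proof (Rabs_pos (F1 0 0)); lra).
  assert (D : forall k, (forall t, continuity_pt (X k) t) -> (forall t, continuity_pt (Y k) t) ->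
    forall t, is_derive (X (S k)) t (F1 (X k t) (Y k t)) /\
              is_derive (Y (S k)) t (F2 (X k t) (Y k t))).
  { intros k hx hy t; split.
    - apply is_derive_ext with (1 := fun t => eq_sym (XS k t)).
      apply (is_derive_primitive x0 (fun s => F1 (X k s) (Y k s))).
      intros; now apply continuity_field.
    - apply is_derive_ext with (1 := fun t => eq_sym (YS k t)).
      apply (is_derive_primitive y0 (fun s => F2 (X k s) (Y k s))).
      intros; now apply continuity_field. }
  assert (C : forall k, (forall t, continuity_pt (X k) t) /\ (forall t, continuity_pt (Y k) t)).
  { induction k as [|k [hx hy]].
    - split; intros t; apply continuity_pt_const; intros u v; reflexivity.
    - split; intros t; [exact (derive_continuity _ t _ (proj1 (D k hx hy t))) |
        exact (derive_continuity _ t _ (proj2 (D k hx hy t)))]. }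
  assert (DX : forall k t, is_derive (X (S k)) t (F1 (X k t) (Y k t))) by (intros k t; destruct (C k); now apply D).
  assert (DY : forall k t, is_derive (Y (S k)) t (F2 (X k t) (Y k t))) by (intros k t; destruct (C k); now apply D).
  assert (X0 : forall k, X k 0 = x0) by (intros [|k]; [reflexivity | rewrite XS; apply primitive_at_0]).
  assert (Y0 : forall k, Y k 0 = y0) by (intros [|k]; [reflexivity | rewrite YS; apply primitive_at_0]).
  (* With this weight one iteration contracts by [2 * La / la = 1/2]; the factor 2 counts the two
     components. *)
  set (la := 4 * La).
  assert (step : forall (F : R -> R -> R) (x y u v f df : R -> R) m,
    (forall x y u v, Rabs (F x y - F u v) <= La * (Rabs (x - u) + Rabs (y - v))) -> f 0 = 0 ->
    (forall t, is_derive f t (F (x t) (y t) - F (u t) (v t))) ->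
    (forall t, Rabs (x t - u t) <= m * exp (la * Rabs t)) ->
    (forall t, Rabs (y t - v t) <= m * exp (la * Rabs t)) ->
    forall t, Rabs (f t) <= m * / 2 * exp (la * Rabs t)).
  { intros F x y u v f df m hF h0 hd hx hy t.
    replace (m * / 2) with (2 * La * m / la) by (unfold la; field; lra).
    apply (exponential_bound f (fun t => F (x t) (y t) - F (u t) (v t))); auto.
    - unfold la; lra.
    - intros s; eapply Rle_trans; [apply hF|]; specialize (hx s); specialize (hy s).
      replace (2 * La * m * exp (la * Rabs s))
        with (La * (m * exp (la * Rabs s) + m * exp (la * Rabs s))) by ring.
      apply Rmult_le_compat_l; lra. }
  assert (E : forall k t, Rabs (X (S k) t - X k t) <= B * exp (la * Rabs t) * (/ 2) ^ k /\
                          Rabs (Y (S k) t - Y k t) <= B * exp (la * Rabs t) * (/ 2) ^ k).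
  { induction k as [|k IH].
    - assert (base : forall f df : R -> R, f 0 = 0 -> (forall t, is_derive f t (df t)) ->
        (forall t, Rabs (df t) <= B) -> forall t, Rabs (f t) <= B * exp (la * Rabs t) * (/ 2) ^ 0).
      { intros f df h0 h hb t; simpl; rewrite Rmult_1_r.
        assert (bb : forall s, B <= B * exp (la * Rabs s)).
        { intros s; rewrite <- (Rmult_1_r B) at 1; apply Rmult_le_compat_l; auto.
          rewrite <- exp_0; destruct (Req_dec (la * Rabs s) 0) as [->|n];
            [lra | apply Rlt_le, exp_increasing; pose proof (Rabs_pos s); unfold la in *; nra]. }
        eapply Rle_trans; [apply (exponential_bound f df B la)|]; auto.
        - unfold la; lra.
        - intros s; eapply Rle_trans; [apply hb | apply bb].
        - apply Rmult_le_compat_r; [apply Rlt_le, exp_pos|].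
          apply Rmult_le_reg_r with la; [unfold la; lra|].
          replace (B / la * la) with B by (field; unfold la; lra); unfold la; nra. }
      intros t; split.
      + apply (base (fun t => X 1%nat t - X O t) (fun t => F1 (X O t) (Y O t))); auto.
        * rewrite !X0; ring.
        * intros s; pose proof (DX O s); apply is_derive_eq with (F1 (X O s) (Y O s) - 0); [|ring].
          apply (D_minus (X 1%nat) (fun _ => x0)); [assumption | apply D_const].
      + apply (base (fun t => Y 1%nat t - Y O t) (fun t => F2 (X O t) (Y O t))); auto.
        * rewrite !Y0; ring.
        * intros s; pose proof (DY O s); apply is_derive_eq with (F2 (X O s) (Y O s) - 0); [|ring].
          apply (D_minus (Y 1%nat) (fun _ => y0)); [assumption | apply D_const].
    - intros t.
      replace (B * exp (la * Rabs t) * (/ 2) ^ S k)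
        with (B * (/ 2) ^ k * / 2 * exp (la * Rabs t)) by (simpl; ring).
      split.
      + apply (step F1 (X (S k)) (Y (S k)) (X k) (Y k) (fun t => X (S (S k)) t - X (S k) t) (fun _ => 0)); auto.
        * rewrite !X0; ring.
        * intros s; apply (D_minus (X (S (S k))) (X (S k))); auto.
        * intros s; destruct (IH s) as [a _]; lra.
        * intros s; destruct (IH s) as [_ a]; lra.
      + apply (step F2 (X (S k)) (Y (S k)) (X k) (Y k) (fun t => Y (S (S k)) t - Y (S k) t) (fun _ => 0)); auto.
        * rewrite !Y0; ring.
        * intros s; apply (D_minus (Y (S (S k))) (Y (S k))); auto.
        * intros s; destruct (IH s) as [a _]; lra.
        * intros s; destruct (IH s) as [_ a]; lra. }
  assert (lim : forall U : nat -> R -> R,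
    (forall t k, Rabs (U (S k) t - U k t) <= B * exp (la * Rabs t) * (/ 2) ^ k) ->
    exists u : R -> R, forall t k, Rabs (U k t - u t) <= 2 * (B * exp (la * Rabs t)) * (/ 2) ^ k).
  { intros U hU.
    assert (ex : forall t, exists l, forall k, Rabs (U k t - l) <= 2 * (B * exp (la * Rabs t)) * (/ 2) ^ k)
      by (intros t; now apply (geometric_limit (fun k => U k t))).
    exists (fun t => proj1_sig (constructive_indefinite_description _ (ex t))); intros t.
    destruct (constructive_indefinite_description _ (ex t)); auto. }
  destruct (lim X (fun t k => proj1 (E k t))) as [x hx].
  destruct (lim Y (fun t k => proj2 (E k t))) as [y hy].
  assert (half : forall m eps : R, 0 < eps -> exists k, Rabs m * (/ 2) ^ k < eps).
  { intros m eps he; pose proof (Rabs_pos m).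
    destruct (pow_lt_1_zero (/ 2) ltac:(rewrite Rabs_right; lra) (eps / (Rabs m + 1)))
      as [N hN]; [apply Rdiv_lt_0_compat; lra|].
    exists N; specialize (hN N (le_n N)).
    assert (0 < (/ 2) ^ N) by (apply pow_lt; lra).
    rewrite Rabs_right in hN by lra.
    apply (Rmult_lt_compat_l (Rabs m + 1)) in hN; [|lra].
    replace ((Rabs m + 1) * (eps / (Rabs m + 1))) with eps in hN by (field; lra); lra. }
  assert (lim0 : forall a m : R, (forall k, Rabs a <= m * (/ 2) ^ k) -> a = 0).
  { intros a m h; destruct (Req_dec a 0) as [|n]; auto; apply Rabs_pos_lt in n.
    destruct (half m (Rabs a) n) as [k hk]; specialize (h k).
    assert (0 < (/ 2) ^ k) by (apply pow_lt; lra); pose proof (RRle_abs m); nra. }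
  assert (cont : forall (U : nat -> R -> R) (u : R -> R), 
    (forall t k, Rabs (U k t - u t) <= 2 * (B * exp (la * Rabs t)) * (/ 2) ^ k) ->
    (forall k s t, Rabs (U k s - U k t) <= B * Rabs (s - t)) -> forall t, continuity_pt u t).
  { intros U u hU hL t.
    assert (L : forall s, Rabs (u s - u t) <= B * Rabs (s - t)).
    { intros s; apply le_epsilon; intros eps he.
      set (m1 := 2 * (B * exp (la * Rabs s))); set (m2 := 2 * (B * exp (la * Rabs t))).
      destruct (half (m1 + m2) eps he) as [k hk].
      pose proof (hU s k) as a1; pose proof (hU t k) as a2; fold m1 in a1; fold m2 in a2.
      assert (0 < (/ 2) ^ k) by (apply pow_lt; lra).
      pose proof (RRle_abs (m1 + m2)).
      replace (u s - u t) with (- (U k s - u s) + (U k t - u t) + (U k s - U k t)) by ring.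
      eapply Rle_trans; [apply Rabs_triang|]; apply Rplus_le_compat_r with (r := 0) in a1.
      pose proof (Rabs_triang (- (U k s - u s)) (U k t - u t)) as tr; rewrite Rabs_Ropp in tr.
      specialize (hL k s t); nra. }
    apply continuity_eps; intros eps he; exists (eps / (B + 1)); split; [apply Rdiv_lt_0_compat; lra|].
    intros s hs; eapply Rle_lt_trans; [apply L|].
    apply (Rmult_lt_compat_l (B + 1)) in hs; [|lra].
    replace ((B + 1) * (eps / (B + 1))) with eps in hs by (field; lra).
    pose proof (Rabs_pos (s - t)); lra. }
  assert (LX : forall k s t, Rabs (X k s - X k t) <= B * Rabs (s - t)).
  { intros [|k] s t.
    - unfold X; simpl; rewrite Rminus_diag, Rabs_R0; apply Rmult_le_pos; [auto | apply Rabs_pos].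
    - apply (derive_Lipschitz _ (fun t => F1 (X k t) (Y k t))); auto. }
  assert (LY : forall k s t, Rabs (Y k s - Y k t) <= B * Rabs (s - t)).
  { intros [|k] s t.
    - unfold Y; simpl; rewrite Rminus_diag, Rabs_R0; apply Rmult_le_pos; [auto | apply Rabs_pos].
    - apply (derive_Lipschitz _ (fun t => F2 (X k t) (Y k t))); auto. }
  pose proof (cont X x hx LX) as cx; pose proof (cont Y y hy LY) as cy.
  (* The limit solves the integral equation: by [step], the next iterate is within a multiple of
     [2^-k] of the primitive taken along the limit. *)
  assert (fin : forall (F : R -> R -> R) (U : nat -> R -> R) (u : R -> R) u0,
    (forall x y u v, Rabs (F x y - F u v) <= La * (Rabs (x - u) + Rabs (y - v))) ->
    (forall t k, Rabs (U k t - u t) <= 2 * (B * exp (la * Rabs t)) * (/ 2) ^ k) ->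
    (forall k t, is_derive (U (S k)) t (F (X k t) (Y k t))) -> (forall k, U k 0 = u0) ->
    forall t, u t = u0 + RInt (fun s => F (x s) (y s)) 0 t).
  { intros F U u u0 hF hU hD hU0 t; apply Rminus_diag_uniq.
    apply (lim0 _ (4 * (B * exp (la * Rabs t)))); intros k.
    assert (Dz : forall s, is_derive (fun t => u0 + RInt (fun s => F (x s) (y s)) 0 t) s (F (x s) (y s)))
      by (intros s; apply (is_derive_primitive u0 (fun s => F (x s) (y s))); intros; now apply continuity_field).
    pose proof (step F (X k) (Y k) x y (fun t => U (S k) t - (u0 + RInt (fun s => F (x s) (y s)) 0 t))
      (fun _ => 0) (2 * B * (/ 2) ^ k) hF) as K.
    cbv beta in K; rewrite hU0, primitive_at_0, Rminus_diag in K; specialize (K eq_refl).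
    assert (K' := K (fun t => D_minus _ _ _ _ _ (hD k t) (Dz t))); clear K.
    specialize (K' (fun t => ltac:(specialize (hx t k); lra)) (fun t => ltac:(specialize (hy t k); lra)) t).
    pose proof (hU t (S k)) as a; simpl in a; rewrite Rabs_minus_sym in a.
    replace (u t - (u0 + RInt (fun s => F (x s) (y s)) 0 t))
      with ((u t - U (S k) t) + (U (S k) t - (u0 + RInt (fun s => F (x s) (y s)) 0 t))) by ring.
    assert (0 < (/ 2) ^ k) by (apply pow_lt; lra).
    assert (0 <= B * exp (la * Rabs t) * (/ 2) ^ k)
      by (repeat apply Rmult_le_pos; auto; [apply Rlt_le, exp_pos | lra]).
    eapply Rle_trans; [apply Rabs_triang|]; lra. }
  pose proof (fin F1 X x x0 F1L hx DX X0) as ex; pose proof (fin F2 Y y y0 F2L hy DY Y0) as ey.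
  exists x, y; split; [rewrite ex; apply primitive_at_0|]; split; [rewrite ey; apply primitive_at_0|].
  intros t; split.
  - apply is_derive_ext with (1 := fun t => eq_sym (ex t)).
    apply (is_derive_primitive x0 (fun s => F1 (x s) (y s))); intros; now apply continuity_field.
  - apply is_derive_ext with (1 := fun t => eq_sym (ey t)).
    apply (is_derive_primitive y0 (fun s => F2 (x s) (y s))); intros; now apply continuity_field.
Qed.

End Picard.

(** * The Hamiltonian flow *)

Definition HSol (Hx Hp : R -> R -> R) (q p : R -> R) : Prop :=
  forall t, is_derive q t (Hp (q t) (p t)) /\ is_derive p t (- Hx (q t) (p t)).

Section Flow.

Variables H Hx Hp : R -> R -> R.
Hypothesis HH : Ham H Hx Hp.

(** Locally Lipschitz partial derivatives give the full differentiability that the chain rule along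
    curves requires. *)
Lemma ham_differentiable (x p : R) : differentiable_pt_lim H x p (Hx x p) (Hp x p).
Proof.
  intros eps.
  destruct (ham_loc _ _ _ HH (Rabs p + 1)) as [A [hA ha]].
  destruct (ham_expansion _ _ _ HH (Rabs p + 1)) as [B [hB hb]].
  set (K := 2 * A + B + 1).
  assert (hd : 0 < Rmin 1 (eps / K))
    by (apply Rmin_glb_lt; [lra | apply Rdiv_lt_0_compat; [apply eps | unfold K; lra]]).
  exists (mkposreal _ hd); simpl; intros u v hu hv.
  pose proof (Rmin_l 1 (eps / K)); pose proof (Rmin_r 1 (eps / K)) as hr.
  set (d := Rmin 1 (eps / K)) in *.
  set (m := Rmax (Rabs (u - x)) (Rabs (v - p))).
  assert (m1 : Rabs (u - x) <= m) by apply Rmax_l.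
  assert (m2 : Rabs (v - p) <= m) by apply Rmax_r.
  assert (m3 : m < d) by (apply Rmax_lub_lt; auto).
  pose proof (Rabs_pos (u - x)); pose proof (Rabs_pos (v - p)).
  assert (bv : Rabs v <= Rabs p + 1).
  { replace v with ((v - p) + p) by ring; eapply Rle_trans; [apply Rabs_triang | lra]. }
  assert (bp : Rabs p <= Rabs p + 1) by lra.
  pose proof (hb x (u - x) v bv) as e1; replace (x + (u - x)) with u in e1 by ring.
  assert (e2 : Rabs ((H x v - Hp x p * v) - (H x p - Hp x p * p)) <= A * m * Rabs (v - p)).
  { apply (derive_Lipschitz (fun z => H x z - Hp x p * z) (fun z => Hp x z - Hp x p)).
    - intros z _; pose proof (ham_dp _ _ _ HH x z); dvf; ring.
    - intros z hz.
      assert (hz1 : Rabs (z - p) <= Rabs (v - p)).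
      { revert hz; unfold Rmin, Rmax; destruct Rle_dec; unfold Rabs; repeat destruct Rcase_abs; lra. }
      assert (hz2 : Rabs z <= Rabs p + 1).
      { replace z with ((z - p) + p) by ring; eapply Rle_trans; [apply Rabs_triang | lra]. }
      destruct (ha x z hz2) as (_ & _ & _ & k); destruct (k x p bp) as [_ k1].
      rewrite (Rminus_diag x), Rabs_R0, Rplus_0_l in k1.
      eapply Rle_trans; [exact k1|]; apply Rmult_le_compat_l; lra. }
  assert (e3 : Rabs ((Hx x v - Hx x p) * (u - x)) <= A * m * m).
  { rewrite Rabs_mult; destruct (ha x v bv) as (_ & _ & _ & k); destruct (k x p bp) as [k1 _].
    rewrite (Rminus_diag x), Rabs_R0, Rplus_0_l in k1.
    apply Rmult_le_compat; try apply Rabs_pos; auto.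
    eapply Rle_trans; [exact k1|]; apply Rmult_le_compat_l; lra. }
  replace (H u v - H x p - (Hx x p * (u - x) + Hp x p * (v - p)))
    with ((H u v - H x v - Hx x v * (u - x)) + ((H x v - Hp x p * v) - (H x p - Hp x p * p))
          + (Hx x v - Hx x p) * (u - x)) by ring.
  eapply Rle_trans; [apply Rabs_triang|].
  pose proof (Rabs_triang (H u v - H x v - Hx x v * (u - x))
    ((H x v - Hp x p * v) - (H x p - Hp x p * p))) as tr.
  assert (e4 : (u - x) * (u - x) <= m * m).
  { replace ((u - x) * (u - x)) with (Rabs (u - x) * Rabs (u - x));
      [apply Rmult_le_compat; auto | apply Rabs_square]. }
  assert (e5 : B * ((u - x) * (u - x)) <= B * (m * m)) by (apply Rmult_le_compat_l; auto).
  assert (e6 : A * m * Rabs (v - p) <= A * m * m)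
    by (apply Rmult_le_compat_l; auto; apply Rmult_le_pos; lra).
  apply Rle_trans with (K * m * m); [assert (0 <= m * m) by nra; unfold K; lra|].
  apply Rmult_le_compat_r; [lra|].
  apply Rle_trans with (K * (eps / K)); [apply Rmult_le_compat_l; unfold K in *; lra|].
  right; field; unfold K; lra.
Qed.

Lemma ham_chain (q p : R -> R) (t dq dp : R) : is_derive q t dq -> is_derive p t dp ->
  is_derive (fun s => H (q s) (p s)) t (Hx (q t) (p t) * dq + Hp (q t) (p t) * dp).
Proof.
  intros hq hp; apply is_derive_Reals, derivable_pt_lim_comp_2d.
  - apply ham_differentiable.
  - now apply is_derive_Reals.
  - now apply is_derive_Reals.
Qed.

Lemma derivative_zero_constant (f : R -> R) : (forall t, is_derive f t 0) -> forall s t, f s = f t.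
Proof.
  intros h s t; apply Rminus_diag_uniq.
  pose proof (derive_Lipschitz f (fun _ => 0) 0 s t) as K.
  destruct (Req_dec (f s - f t) 0) as [|n]; auto; apply Rabs_pos_lt in n.
  enough (Rabs (f s - f t) <= 0 * Rabs (s - t)) by lra.
  apply K; [auto | intros; rewrite Rabs_R0; lra].
Qed.

Lemma energy_conserved (q p : R -> R) : HSol Hx Hp q p -> forall s t, H (q s) (p s) = H (q t) (p t).
Proof.
  intros h; apply (derivative_zero_constant (fun s => H (q s) (p s))); intros t.
  destruct (h t) as [h1 h2]; eapply is_derive_eq; [apply ham_chain; eauto | ring].
Qed.

(** A momentum bound at one time bounds the energy, which is conserved and coercive, so the bound
    holds at all times and for all characteristics alike. *)
Lemma HSol_bounded (P : R) : exists P', 0 <= P' /\ forall q p s, HSol Hx Hp q p ->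
  Rabs (p s) <= P -> forall t, Rabs (p t) <= P'.
Proof.
  destruct (ham_loc _ _ _ HH P) as [C [h0 hC]].
  destruct (ham_coercive _ _ _ HH C) as [P' [hP' h]].
  exists P'; split; [exact hP'|]; intros q p s hs hb t; apply (h (q t)).
  rewrite (energy_conserved q p hs t s); eapply Rle_trans; [apply RRle_abs|]; now apply hC.
Qed.

Lemma HSol_shift (q p : R -> R) (a : R) : HSol Hx Hp q p ->
  HSol Hx Hp (fun t => q (t - a)) (fun t => p (t - a)).
Proof.
  intros h t; destruct (h (t - a)) as [h1 h2]; split.
  - eapply is_derive_eq; [apply (D_comp q (fun t => t - a)); [exact h1 | dv] | ring].
  - eapply is_derive_eq; [apply (D_comp p (fun t => t - a)); [exact h2 | dv] | ring].
Qed.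

Lemma Lipschitz_product (f g : R -> R -> R) (A B A' B' : R) :
  (forall x y, Rabs (f x y) <= A) -> (forall x y, Rabs (g x y) <= B) ->
  (forall x y u v, Rabs (f x y - f u v) <= A' * (Rabs (x - u) + Rabs (y - v))) ->
  (forall x y u v, Rabs (g x y - g u v) <= B' * (Rabs (x - u) + Rabs (y - v))) ->
  forall x y u v, Rabs (f x y * g x y - f u v * g u v) <=
    (A * B' + A' * B) * (Rabs (x - u) + Rabs (y - v)).
Proof.
  intros fA gB fl gl x y u v.
  replace (f x y * g x y - f u v * g u v)
    with (f x y * (g x y - g u v) + (f x y - f u v) * g u v) by ring.
  eapply Rle_trans; [apply Rabs_triang|]; rewrite !Rabs_mult.
  specialize (gl x y u v); specialize (fl x y u v); specialize (fA x y); specialize (gB u v).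
  set (d := Rabs (x - u) + Rabs (y - v)) in *.
  apply Rle_trans with (A * (B' * d) + A' * d * B); [|lra].
  apply Rplus_le_compat; apply Rmult_le_compat; auto; apply Rabs_pos.
Qed.

(* The field is cut off by a function of the energy, which is still conserved by the truncated
   system, so that the truncation is never felt by the solution constructed here. *)
Theorem flow_exists (t0 q0 p0 : R) : exists q p, HSol Hx Hp q p /\ q t0 = q0 /\ p t0 = p0.
Proof.
  set (E := H q0 p0).
  destruct (ham_coercive _ _ _ HH (E + 1)) as [P [hP hco]].
  set (R0 := P + 1).
  destruct (ham_loc _ _ _ HH R0) as [C [hC hc]].
  destruct (ham_Lipschitz _ _ _ HH R0) as [D [hD hl]].
  set (cl := fun p => Rmax (- R0) (Rmin R0 p)).
  assert (clB : forall p, Rabs (cl p) <= R0).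
  { intros p; apply Rabs_le_between; unfold cl, R0, Rmax, Rmin; repeat destruct Rle_dec; lra. }
  assert (clL : forall p r, Rabs (cl p - cl r) <= Rabs (p - r)).
  { intros p r; unfold cl, R0, Rmax, Rmin; repeat destruct Rle_dec;
      unfold Rabs; repeat destruct Rcase_abs; lra. }
  assert (clI : forall p, Rabs p <= R0 -> cl p = p).
  { intros p h; apply Rabs_le_between in h; unfold cl, Rmax, Rmin; repeat destruct Rle_dec; lra. }
  assert (clO : forall p, R0 < Rabs p -> Rabs (cl p) = R0).
  { intros p; unfold cl, R0, Rmax, Rmin; repeat destruct Rle_dec; unfold Rabs; repeat destruct Rcase_abs; lra. }
  (* A cut-off equal to 1 up to energy [E] and to 0 from energy [E + 1] on. *)
  set (chi := fun e => Rmax 0 (Rmin 1 (E + 1 - e))).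
  assert (chiB : forall e, 0 <= chi e <= 1)
    by (intros e; unfold chi, Rmax, Rmin; repeat destruct Rle_dec; lra).
  assert (chiL : forall e f, Rabs (chi e - chi f) <= Rabs (e - f)).
  { intros p r; unfold chi, Rmax, Rmin; repeat destruct Rle_dec;
      unfold Rabs; repeat destruct Rcase_abs; lra. }
  set (X := fun q p => chi (H q (cl p))).
  assert (XB : forall x y, Rabs (X x y) <= 1).
  { intros x y; unfold X; pose proof (chiB (H x (cl y))); rewrite Rabs_right; lra. }
  assert (XL : forall x y u v, Rabs (X x y - X u v) <= D * (Rabs (x - u) + Rabs (y - v))).
  { intros x y u v; eapply Rle_trans; [apply chiL|]; eapply Rle_trans; [apply hl; auto|].
    apply Rmult_le_compat_l; auto; pose proof (clL y v); lra. }
  (* Where [cl] really truncates, the momentum [cl p] has size [P + 1], its energy exceeds [E + 1],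
     and the field vanishes. *)
  assert (X0 : forall x p, R0 < Rabs p -> X x p = 0).
  { intros x p h; unfold X, chi.
    enough (E + 1 < H x (cl p)) by (unfold Rmax, Rmin; repeat destruct Rle_dec; lra).
    apply Rnot_le_lt; intros l; apply hco in l; rewrite clO in l by auto; unfold R0 in l; lra. }
  assert (loc1 : forall x y u v, Rabs (Hp x (cl y) - Hp u (cl v)) <= C * (Rabs (x - u) + Rabs (y - v))).
  { intros x y u v; destruct (hc x (cl y) (clB y)) as (_ & _ & _ & k).
    destruct (k u (cl v) (clB v)) as [_ k2]; eapply Rle_trans; [exact k2|].
    apply Rmult_le_compat_l; auto; pose proof (clL y v); lra. }
  assert (loc2 : forall x y u v, Rabs (- Hx x (cl y) - - Hx u (cl v)) <= C * (Rabs (x - u) + Rabs (y - v))).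
  { intros x y u v; destruct (hc x (cl y) (clB y)) as (_ & _ & _ & k).
    destruct (k u (cl v) (clB v)) as [k2 _].
    rewrite <- Rabs_Ropp; replace (- (- Hx x (cl y) - - Hx u (cl v)))
      with (Hx x (cl y) - Hx u (cl v)) by ring.
    eapply Rle_trans; [exact k2|].
    apply Rmult_le_compat_l; auto; pose proof (clL y v); lra. }
  assert (bd1 : forall x y, Rabs (Hp x (cl y)) <= C) by (intros; now apply hc).
  assert (bd2 : forall x y, Rabs (- Hx x (cl y)) <= C) by (intros; rewrite Rabs_Ropp; now apply hc).
  pose proof (Lipschitz_product X (fun x y => Hp x (cl y)) 1 C D C XB bd1 XL loc1) as L1.
  pose proof (Lipschitz_product X (fun x y => - Hx x (cl y)) 1 C D C XB bd2 XL loc2) as L2.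
  assert (weak : forall F : R -> R -> R,
    (forall x y u v, Rabs (F x y - F u v) <= (1 * C + D * C) * (Rabs (x - u) + Rabs (y - v))) ->
    forall x y u v, Rabs (F x y - F u v) <= (1 + 1 * C + D * C) * (Rabs (x - u) + Rabs (y - v))).
  { intros F h x y u v; eapply Rle_trans; [apply h|].
    pose proof (Rabs_pos (x - u)); pose proof (Rabs_pos (y - v)).
    apply Rmult_le_compat_r; lra. }
  assert (prod : forall a b, Rabs a <= 1 -> Rabs b <= C -> Rabs (a * b) <= C).
  { intros a b ha hb; rewrite Rabs_mult, <- (Rmult_1_l C); apply Rmult_le_compat; auto; apply Rabs_pos. }
  destruct (picard_lindelof _ _ (1 + 1 * C + D * C) C ltac:(nra) (weak _ L1) (weak _ L2)
    (fun x y => prod _ _ (XB x y) (bd1 x y)) (fun x y => prod _ _ (XB x y) (bd2 x y)) q0 p0)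
    as (q & p & hq & hp & hd).
  (* For [|p| <= R0] the field is a multiple of the Hamiltonian one, hence tangent to the energy
     levels; elsewhere it is zero. *)
  assert (cons : forall t, H (q t) (p t) = E).
  { intros t; unfold E; replace (H q0 p0) with (H (q 0) (p 0)) by now rewrite hq, hp.
    apply (derivative_zero_constant (fun s => H (q s) (p s))); intros s.
    destruct (hd s) as [h1 h2]; eapply is_derive_eq; [apply ham_chain; eauto|].
    destruct (Rle_dec (Rabs (p s)) R0) as [l|l].
    - rewrite (clI _ l); ring.
    - rewrite X0 by lra; ring. }
  assert (small : forall t, Rabs (p t) <= R0).
  { intros t; apply Rle_trans with P; [|unfold R0; lra]; apply (hco (q t)); rewrite cons; lra. }
  assert (X1 : forall t, X (q t) (p t) = 1).
  { intros t; unfold X; rewrite clI, cons by auto; unfold chi, Rmax, Rmin; repeat destruct Rle_dec; lra. }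
  exists (fun t => q (t - t0)), (fun t => p (t - t0)); split; [|rewrite Rminus_diag; auto].
  apply HSol_shift; intros t; destruct (hd t) as [h1 h2].
  rewrite X1, clI in h1, h2 by auto; rewrite Rmult_1_l in h1, h2; auto.
Qed.

(** Gronwall in both time directions for the squared distance [D], which is differentiable, unlike
    the sum of absolute values. The factor 2 in [K] pays for the comparison of the two norms. *)
Lemma HSol_dependence (P T : R) : exists K, 0 <= K /\ forall q p q' p',
  HSol Hx Hp q p -> HSol Hx Hp q' p' -> (forall t, Rabs (p t) <= P) -> (forall t, Rabs (p' t) <= P) ->
  forall s t, Rabs (t - s) <= T ->
  Rabs (q t - q' t) + Rabs (p t - p' t) <= K * (Rabs (q s - q' s) + Rabs (p s - p' s)).
Proof.
  destruct (ham_loc _ _ _ HH P) as [C [hC hc]].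
  set (K := 2 * exp (4 * C * Rabs T)).
  assert (K1 : 2 <= K).
  { unfold K; destruct (Req_dec (4 * C * Rabs T) 0) as [->|n]; [rewrite exp_0; lra|].
    assert (0 < 4 * C * Rabs T) by (pose proof (Rabs_pos T); nra).
    pose proof (exp_increasing 0 _ H0); rewrite exp_0 in H1; lra. }
  exists K; split; [lra|].
  intros q p q' p' h h' b b' s t hst.
  set (D := fun t => (q t - q' t) * (q t - q' t) + (p t - p' t) * (p t - p' t)).
  set (dD := fun t => 2 * (q t - q' t) * (Hp (q t) (p t) - Hp (q' t) (p' t))
                    - 2 * (p t - p' t) * (Hx (q t) (p t) - Hx (q' t) (p' t))).
  assert (der : forall u, is_derive D u (dD u)).
  { intros u; destruct (h u) as [h1 h2]; destruct (h' u) as [h3 h4]; unfold D, dD; dvf; ring. }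
  assert (bnd : forall u, Rabs (dD u) <= 4 * C * D u).
  { intros u; unfold dD, D.
    set (a := q u - q' u); set (e := p u - p' u).
    destruct (hc (q u) (p u) (b u)) as (_ & _ & _ & k).
    destruct (k (q' u) (p' u) (b' u)) as [k1 k2]; fold a e in k1, k2.
    unfold Rminus at 1; eapply Rle_trans; [apply Rabs_triang|].
    rewrite Rabs_Ropp, !Rabs_mult, (Rabs_right 2) by lra.
    pose proof (Rabs_pos a); pose proof (Rabs_pos e).
    assert (Rabs a * Rabs a = a * a) by (apply Rabs_square).
    assert (Rabs e * Rabs e = e * e) by (apply Rabs_square).
    pose proof (Rle_0_sqr (Rabs a - Rabs e)) as sq; unfold Rsqr in sq.
    apply Rle_trans with (2 * Rabs a * (C * (Rabs a + Rabs e)) + 2 * Rabs e * (C * (Rabs a + Rabs e))).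
    - apply Rplus_le_compat; apply Rmult_le_compat_l; auto; lra.
    - replace (2 * Rabs a * (C * (Rabs a + Rabs e)) + 2 * Rabs e * (C * (Rabs a + Rabs e)))
        with (2 * C * ((Rabs a + Rabs e) * (Rabs a + Rabs e))) by ring.
      replace (4 * C * (a * a + e * e)) with (2 * C * (2 * (a * a + e * e))) by ring.
      apply Rmult_le_compat_l; nra. }
  assert (D0 : forall u, 0 <= D u) by (intros; apply Rplus_le_le_0_compat; apply Rle_0_sqr).
  assert (gr : D t <= exp (4 * C * Rabs (t - s)) * D s).
  { assert (ex : forall c u, is_derive (fun z => exp (c * z)) u (exp (c * u) * c)).
    { intros c u; apply (D_comp exp (fun z => c * z)); [apply is_derive_exp | dvf; ring]. }
    destruct (Rle_dec s t) as [l|l].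
    - rewrite Rabs_right by lra.
      pose proof (derive_le (fun u => exp (- (4 * C) * u) * D u)
        (fun u => exp (- (4 * C) * u) * - (4 * C) * D u + exp (- (4 * C) * u) * dD u) 0 s t l) as M.
      assert (M' : exp (- (4 * C) * t) * D t <= exp (- (4 * C) * s) * D s).
      { enough (exp (- (4 * C) * t) * D t - exp (- (4 * C) * s) * D s <= 0 * (t - s)) by lra.
        apply M; intros u _; [apply (D_mult (fun z => exp (- (4 * C) * z)) D); auto|].
        specialize (bnd u); apply Rabs_le_between in bnd.
        pose proof (exp_pos (- (4 * C) * u)); nra. }
      apply Rmult_le_compat_l with (r := exp (4 * C * t)) in M'; [|apply Rlt_le, exp_pos].
      rewrite <- !Rmult_assoc, <- !exp_plus in M'.
      replace (4 * C * t + - (4 * C) * t) with 0 in M' by ring.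
      replace (4 * C * t + - (4 * C) * s) with (4 * C * (t - s)) in M' by ring.
      rewrite exp_0 in M'; lra.
    - rewrite Rabs_left by lra.
      pose proof (derive_ge (fun u => exp (4 * C * u) * D u)
        (fun u => exp (4 * C * u) * (4 * C) * D u + exp (4 * C * u) * dD u) 0 t s ltac:(lra)) as M.
      assert (M' : exp (4 * C * t) * D t <= exp (4 * C * s) * D s).
      { enough (0 * (s - t) <= exp (4 * C * s) * D s - exp (4 * C * t) * D t) by lra.
        apply M; intros u _; [apply (D_mult (fun z => exp (4 * C * z)) D); auto|].
        specialize (bnd u); apply Rabs_le_between in bnd.
        pose proof (exp_pos (4 * C * u)); nra. }
      apply Rmult_le_compat_l with (r := exp (- (4 * C) * t)) in M'; [|apply Rlt_le, exp_pos].
      rewrite <- !Rmult_assoc, <- !exp_plus in M'.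
      replace (- (4 * C) * t + 4 * C * t) with 0 in M' by ring.
      replace (- (4 * C) * t + 4 * C * s) with (4 * C * - (t - s)) in M' by ring.
      rewrite exp_0 in M'; lra. }
  assert (mono : exp (4 * C * Rabs (t - s)) <= K / 2).
  { unfold K; replace (2 * exp (4 * C * Rabs T) / 2) with (exp (4 * C * Rabs T)) by field.
    assert (le : 4 * C * Rabs (t - s) <= 4 * C * Rabs T).
    { apply Rmult_le_compat_l; [lra|]; apply Rle_trans with T; auto; apply RRle_abs. }
    destruct le as [l | -> ]; [apply Rlt_le, exp_increasing, l | lra]. }
  apply Rsqr_incr_0_var; [|apply Rmult_le_pos; [lra|]; pose proof (Rabs_pos (q s - q' s)); pose proof (Rabs_pos (p s - p' s)); lra].
  assert (sq : forall a e, (Rabs a + Rabs e) * (Rabs a + Rabs e) <= 2 * (a * a + e * e) /\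
                           a * a + e * e <= (Rabs a + Rabs e) * (Rabs a + Rabs e)).
  { intros a e; pose proof (Rabs_pos a); pose proof (Rabs_pos e).
    assert (Rabs a * Rabs a = a * a) by (apply Rabs_square).
    assert (Rabs e * Rabs e = e * e) by (apply Rabs_square).
    pose proof (Rle_0_sqr (Rabs a - Rabs e)) as sq; unfold Rsqr in sq; split; nra. }
  unfold Rsqr; destruct (sq (q t - q' t) (p t - p' t)) as [s1 _].
  destruct (sq (q s - q' s) (p s - p' s)) as [_ s2].
  fold (D t) in s1; fold (D s) in s2.
  set (S := Rabs (q s - q' s) + Rabs (p s - p' s)) in *.
  assert (D t <= K / 2 * (S * S)).
  { eapply Rle_trans; [exact gr|]; apply Rmult_le_compat; auto; apply Rlt_le, exp_pos. }
  assert (0 <= S * S) by nra.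
  apply Rle_trans with (K * (S * S)); [lra|].
  replace (K * S * (K * S)) with (K * (K * (S * S))) by ring; nra.
Qed.

End Flow.

(** * The discrete Bolza problem *)

(** Testing with [h = - a s] for a small [s], the linear term beats the quadratic one. This yields
    stationarity for functions that only have a quadratic upper expansion. *)
Lemma first_order_condition (a C t : R) : 0 < t -> 0 <= C ->
  (forall h, Rabs h <= t -> 0 <= a * h + C * (h * h)) -> a = 0.
Proof.
  intros ht hC h; destruct (Req_dec a 0) as [|n]; auto; exfalso.
  pose proof (Rabs_pos a).
  set (s := Rmin (t / (Rabs a + 1)) (/ (C + 1))).
  assert (s1 : s <= t / (Rabs a + 1)) by apply Rmin_l.
  assert (s2 : s <= / (C + 1)) by apply Rmin_r.
  assert (s0 : 0 < s)
    by (apply Rmin_glb_lt; [apply Rdiv_lt_0_compat; lra | apply Rinv_0_lt_compat; lra]).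
  specialize (h (- (a * s))).
  assert (Rabs (- (a * s)) <= t).
  { rewrite Rabs_Ropp, Rabs_mult, (Rabs_right s) by lra.
    apply Rmult_le_compat_l with (r := Rabs a + 1) in s1; [|lra].
    replace ((Rabs a + 1) * (t / (Rabs a + 1))) with t in s1 by (field; lra); lra. }
  specialize (h H0).
  apply Rmult_le_compat_l with (r := C + 1) in s2; [|lra]; rewrite Rinv_r in s2 by lra.
  assert (0 < a * a) by nra.
  replace (a * - (a * s) + C * (- (a * s) * - (a * s))) with (a * a * s * (C * s - 1)) in h by ring.
  assert (0 < a * a * s) by nra; nra.
Qed.

Definition LipK (K : R) (f : R -> R) : Prop := forall x y, Rabs (f x - f y) <= K * Rabs (x - y).

Section Scheme.

Variables H Hx Hp : R -> R -> R.
Hypothesis HH : Ham H Hx Hp.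

(** One step of a Lax-Oleinik scheme, with the cost taken at the arrival point. Velocities are cut
    off at [V] so that the infimum is attained; [scheme_bounds] provides a cut-off that is never
    felt. *)
Definition lax_step (V tau : R) (f : R -> R) (x : R) : R :=
  real (Glb_Rbar (fun y => exists v, Rabs v <= V /\ y = f (x - tau * v) + tau * Lag H x v)).

Lemma lax_step_spec (V tau K : R) (f : R -> R) (x : R) : 0 <= V -> 0 < tau -> LipK K f ->
  (forall v, Rabs v <= V -> lax_step V tau f x <= f (x - tau * v) + tau * Lag H x v) /\
  exists v, Rabs v <= V /\ lax_step V tau f x = f (x - tau * v) + tau * Lag H x v.
Proof.
  intros hV ht hf.
  destruct (Lag_Lipschitz _ _ _ HH (V + 1)) as [C [hC hL]].
  destruct (continuity_ab_min (fun v => f (x - tau * v) + tau * Lag H x v) (- V) V)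
    as [m [h1 h2]]; [lra| |].
  - intros c hc; apply continuity_eps; intros eps he.
    set (A := tau * (Rabs K + C) + 1); pose proof (Rabs_pos K).
    assert (hA : 0 < A) by (unfold A; assert (0 <= tau * (Rabs K + C)) by (apply Rmult_le_pos; lra); lra).
    exists (Rmin 1 (eps / A)); split; [apply Rmin_glb_lt; [lra | apply Rdiv_lt_0_compat; lra]|].
    intros u hu; pose proof (Rmin_l 1 (eps / A)); pose proof (Rmin_r 1 (eps / A)).
    assert (bc : Rabs c <= V + 1) by (apply Rabs_le_between; lra).
    assert (bu : Rabs u <= V + 1).
    { apply Rabs_le_between; assert (hu' : Rabs (u - c) < 1) by lra; apply Rabs_def2 in hu'; lra. }
    pose proof (hL x x u c bu bc) as e1; rewrite (Rminus_diag x), Rabs_R0, Rplus_0_l in e1.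
    pose proof (hf (x - tau * u) (x - tau * c)) as e2.
    replace (x - tau * u - (x - tau * c)) with (- (tau * (u - c))) in e2 by ring.
    rewrite Rabs_Ropp, Rabs_mult, (Rabs_right tau) in e2 by lra.
    replace (f (x - tau * u) + tau * Lag H x u - (f (x - tau * c) + tau * Lag H x c))
      with ((f (x - tau * u) - f (x - tau * c)) + tau * (Lag H x u - Lag H x c)) by ring.
    eapply Rle_lt_trans; [apply Rabs_triang|]; rewrite (Rabs_mult tau), (Rabs_right tau) by lra.
    pose proof (Rabs_pos (u - c)); pose proof (RRle_abs K).
    assert (tau * Rabs (Lag H x u - Lag H x c) <= tau * (C * Rabs (u - c)))
      by (apply Rmult_le_compat_l; lra).
    assert (K * (tau * Rabs (u - c)) <= Rabs K * (tau * Rabs (u - c))).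
    { apply Rmult_le_compat_r; auto; apply Rmult_le_pos; lra. }
    apply Rle_lt_trans with ((A - 1) * Rabs (u - c)); [unfold A; lra|].
    apply Rle_lt_trans with (A * Rabs (u - c)); [lra|].
    replace eps with (A * (eps / A)) by (field; lra); apply Rmult_lt_compat_l; lra.
  - assert (e : lax_step V tau f x = f (x - tau * m) + tau * Lag H x m).
    { unfold lax_step; rewrite (is_glb_Rbar_unique _ (Finite (f (x - tau * m) + tau * Lag H x m)));
        [reflexivity|]; split.
      - intros y [v [hv ->]]; apply Rabs_le_between in hv; simpl; now apply h1.
      - intros b hb; apply hb; exists m; split; [apply Rabs_le_between; lra | reflexivity]. }
    split.
    + intros v hv; rewrite e; apply h1; now apply Rabs_le_between in hv.
    + exists m; split; [apply Rabs_le_between; lra | exact e].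
Qed.

(** The constant depends on the cut-off, so it cannot serve to choose the cut-off. It only keeps
    each iterate Lipschitz, so that the minimum of the next step is attained. *)
Lemma lax_step_Lipschitz (V tau : R) : 0 <= V -> 0 < tau -> exists C, forall K f,
  LipK K f -> LipK (K + tau * C) (lax_step V tau f).
Proof.
  intros hV ht; destruct (Lag_Lipschitz _ _ _ HH V) as [C [hC hL]]; exists C; intros K f hf.
  assert (G : forall x y, lax_step V tau f x - lax_step V tau f y <= (K + tau * C) * Rabs (x - y)).
  { intros x y; destruct (lax_step_spec V tau K f y hV ht hf) as [_ [v [hv e]]].
    destruct (lax_step_spec V tau K f x hV ht hf) as [k _]; specialize (k v hv).
    pose proof (hL x y v v hv hv) as a; rewrite (Rminus_diag v), Rabs_R0, Rplus_0_r in a.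
    pose proof (hf (x - tau * v) (y - tau * v)) as b.
    replace (x - tau * v - (y - tau * v)) with (x - y) in b by ring.
    apply Rabs_le_between in a; apply Rabs_le_between in b.
    assert (tau * (Lag H x v - Lag H y v) <= tau * (C * Rabs (x - y))) by (apply Rmult_le_compat_l; lra).
    lra. }
  intros x y; pose proof (G x y); pose proof (G y x) as g; rewrite Rabs_minus_sym in g.
  apply Rabs_le_between; lra.
Qed.

Fixpoint scheme (V tau : R) (f : R -> R) (k : nat) : R -> R :=
  match k with O => f | S k => lax_step V tau (scheme V tau f k) end.

(* The bound on the increments in time is propagated by the monotonicity of the scheme; it bounds
   the spatial difference quotients at scale [tau], hence the optimal velocities, uniformly
   in [tau] and [k]. *)
Lemma scheme_bounds (K : R) : exists V, 0 <= V /\ forall f tau, LipK K f -> 0 < tau ->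
  forall k x,
    (forall v, scheme (V + 1) tau f (S k) x <= scheme (V + 1) tau f k (x - tau * v) + tau * Lag H x v) /\
    exists v, Rabs v <= V /\
      scheme (V + 1) tau f (S k) x = scheme (V + 1) tau f k (x - tau * v) + tau * Lag H x v.
Proof.
  destruct (Lag_bounded _ _ _ HH 1) as [CL [hCL bL]].
  destruct (Lag_superlinear _ _ _ HH (Rabs K) (Rabs_pos K)) as [CK [hCK sK]].
  (* [C1] bounds the increment in time per unit of [tau]: from above by staying at rest, from below
     by superlinearity with slope [|K|] against the Lipschitz datum. [C2] then bounds the gain of a
     displacement at velocity at most 1. *)
  set (C1 := CL + CK); set (C2 := C1 + CL).
  destruct (Lag_superlinear _ _ _ HH (C2 + 1) ltac:(unfold C2, C1; lra)) as [C3 [hC3 s3]].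
  set (V := C1 + C2 + C3).
  assert (hV : 0 <= V) by (unfold V, C2, C1; lra).
  exists V; split; [exact hV|]; intros f tau hf ht.
  set (U := scheme (V + 1) tau f).
  assert (Lp : forall k, exists K', LipK K' (U k)).
  { destruct (lax_step_Lipschitz (V + 1) tau ltac:(lra) ht) as [C hC].
    induction k as [|k [K' IH]]; [now exists K|]; exists (K' + tau * C); now apply hC. }
  assert (sp : forall k x, (forall v, Rabs v <= V + 1 -> U (S k) x <= U k (x - tau * v) + tau * Lag H x v) /\
    exists v, Rabs v <= V + 1 /\ U (S k) x = U k (x - tau * v) + tau * Lag H x v).
  { intros k x; destruct (Lp k) as [K' h]; apply (lax_step_spec (V + 1) tau K' (U k) x); auto; lra. }
  assert (tm : forall k x, Rabs (U (S k) x - U k x) <= tau * C1).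
  { induction k as [|k IH]; intros x.
    - destruct (sp O x) as [a [v [hv e]]].
      specialize (a 0 ltac:(rewrite Rabs_R0; lra)); rewrite Rmult_0_r, Rminus_0_r in a.
      pose proof (bL x 0 ltac:(rewrite Rabs_R0; lra)) as b0; apply Rabs_le_between in b0.
      pose proof (sK x v) as s.
      pose proof (hf (x - tau * v) x) as l; replace (x - tau * v - x) with (- (tau * v)) in l by ring.
      rewrite Rabs_Ropp, Rabs_mult, (Rabs_right tau) in l by lra.
      apply Rabs_le_between in l; change (U O) with f in *.
      assert (tau * (Rabs K * Rabs v - CK) <= tau * Lag H x v) by (apply Rmult_le_compat_l; lra).
      assert (tau * Lag H x 0 <= tau * CL) by (apply Rmult_le_compat_l; lra).
      assert (0 <= tau * CK) by (apply Rmult_le_pos; lra).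
      assert (0 <= tau * CL) by (apply Rmult_le_pos; lra).
      assert (K * (tau * Rabs v) <= Rabs K * (tau * Rabs v)).
      { apply Rmult_le_compat_r; [apply Rmult_le_pos; [lra | apply Rabs_pos] | apply RRle_abs]. }
      apply Rabs_le_between; unfold C1; lra.
    - destruct (sp (S k) x) as [a [v [hv e]]]; destruct (sp k x) as [a' [v' [hv' e']]].
      specialize (a v' hv'); specialize (a' v hv).
      pose proof (IH (x - tau * v)) as i; pose proof (IH (x - tau * v')) as i'.
      apply Rabs_le_between in i; apply Rabs_le_between in i'; apply Rabs_le_between; lra. }
  assert (one : forall k x v, Rabs v <= 1 -> U k x - U k (x - tau * v) <= tau * C2).
  { intros k x v hv; destruct (sp k x) as [a _]; specialize (a v ltac:(lra)).
    pose proof (tm k x) as t; apply Rabs_le_between in t.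
    pose proof (bL x v hv) as b; apply Rabs_le_between in b.
    assert (tau * Lag H x v <= tau * CL) by (apply Rmult_le_compat_l; lra).
    unfold C2; lra. }
  (* A fast displacement is split into [n] displacements at velocity at most 1, so that its gain is
     linear in the velocity with slope [C2]. *)
  assert (many : forall k v n x, Rabs v <= 1 -> U k x - U k (x - INR n * (tau * v)) <= INR n * (tau * C2)).
  { intros k v n; induction n as [|n IH]; intros x hv.
    - simpl; rewrite !Rmult_0_l, Rminus_0_r; lra.
    - rewrite S_INR; specialize (IH (x - tau * v) hv); pose proof (one k x v hv).
      replace (x - (INR n + 1) * (tau * v)) with (x - tau * v - INR n * (tau * v)) by ring; lra. }
  assert (any : forall k x v, U k x - U k (x - tau * v) <= tau * C2 * (Rabs v + 1)).
  { intros k x v; destruct (archimed (Rabs v)) as [u1 u2]; pose proof (Rabs_pos v).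
    assert (0 < up (Rabs v))%Z by (apply lt_IZR; lra).
    set (n := Z.to_nat (up (Rabs v))).
    assert (en : INR n = IZR (up (Rabs v))) by (unfold n; rewrite INR_IZR_INZ, Z2Nat.id by lia; auto).
    assert (n0 : 0 < INR n) by lra.
    pose proof (many k (v / INR n) n x) as m.
    replace (INR n * (tau * (v / INR n))) with (tau * v) in m by (field; lra).
    eapply Rle_trans; [apply m|].
    - apply Rabs_div_le; lra.
    - replace (tau * C2 * (Rabs v + 1)) with ((Rabs v + 1) * (tau * C2)) by ring.
      apply Rmult_le_compat_r; [|lra]; apply Rmult_le_pos; unfold C2, C1; lra. }
  (* The cost of a velocity grows with slope [C2 + 1], its gain only with slope [C2]. The difference
     absorbs the constants [C1], [C2] and [C3] as soon as [|v|] exceeds [V], so such velocities are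
     never useful. *)
  intros k x; split.
  - intros v; destruct (Rle_dec (Rabs v) (V + 1)) as [l|l]; [now apply sp|].
    pose proof (any k x v) as a; pose proof (s3 x v) as s; pose proof (tm k x) as t.
    apply Rabs_le_between in t.
    assert (tau * ((C2 + 1) * Rabs v - C3) <= tau * Lag H x v) by (apply Rmult_le_compat_l; lra).
    assert (tau * (C1 + C2 + C3) <= tau * Rabs v) by (apply Rmult_le_compat_l; unfold V in *; lra).
    fold U; lra.
  - destruct (sp k x) as [_ [v [hv e]]]; exists v; split; [|exact e].
    pose proof (any k x v) as a; pose proof (s3 x v) as s; pose proof (tm k x) as t.
    apply Rabs_le_between in t.
    assert (tau * ((C2 + 1) * Rabs v - C3) <= tau * Lag H x v) by (apply Rmult_le_compat_l; lra).
    apply Rmult_le_reg_l with tau; [exact ht|]; unfold V; lra.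
Qed.

(** Moving an interior node of a minimizer changes two steps only, and stationarity of their sum is
    a discrete Hamiltonian system. The bound [P] is chosen before the datum and the step. *)
Theorem discrete_minimizers (K : R) : exists P, 0 <= P /\
  forall f tau, LipK K f -> 0 < tau <= 1 -> exists U : nat -> R -> R,
    U O = f /\ (forall k x v, U (S k) x <= U k (x - tau * v) + tau * Lag H x v) /\
    forall N x, exists xs ps : nat -> R, xs N = x /\
      (forall k, (k < N)%nat -> Rabs (ps (S k)) <= P /\
         xs k = xs (S k) - tau * Hp (xs (S k)) (ps (S k)) /\
         U (S k) (xs (S k)) = U k (xs k) + tau * Lag H (xs (S k)) (Hp (xs (S k)) (ps (S k)))) /\
      (forall k, (S k < N)%nat -> ps (S (S k)) = ps (S k) - tau * Hx (xs (S k)) (ps (S k))).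
Proof.
  destruct (scheme_bounds K) as [V [hV hs]].
  destruct (ham_coer _ _ _ HH V) as [P [hP hc]].
  destruct (Lag_semiconcave _ _ _ HH V) as [C [hC sc]].
  exists P; split; [exact hP|]; intros f tau hf ht.
  exists (scheme (V + 1) tau f); set (U := scheme (V + 1) tau f).
  specialize (hs f tau hf (proj1 ht)); fold U in hs.
  split; [reflexivity|]; split; [intros k x v; now destruct (hs k x)|].
  assert (chain : forall N x, exists xs : nat -> R, xs N = x /\ forall k, (k < N)%nat ->
    Rabs ((xs (S k) - xs k) / tau) <= V /\
    U (S k) (xs (S k)) = U k (xs k) + tau * Lag H (xs (S k)) ((xs (S k) - xs k) / tau)).
  { induction N as [|N IH]; intros x.
    - exists (fun _ => x); split; [reflexivity|]; intros; lia.
    - destruct (hs N x) as [_ [v [hv e]]].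
      destruct (IH (x - tau * v)) as [xs [h1 h2]].
      exists (fun k => if Nat.leb k N then xs k else x); split.
      + replace (Nat.leb (S N) N) with false by (symmetry; apply Nat.leb_gt; lia); reflexivity.
      + intros k hk; replace (Nat.leb k N) with true by (symmetry; apply Nat.leb_le; lia).
        destruct (Nat.eq_dec k N) as [->|n].
        * replace (Nat.leb (S N) N) with false by (symmetry; apply Nat.leb_gt; lia).
          rewrite h1; replace ((x - (x - tau * v)) / tau) with v by (field; lra); auto.
        * replace (Nat.leb (S k) N) with true by (symmetry; apply Nat.leb_le; lia).
          apply h2; lia. }
  intros N x; destruct (chain N x) as [xs [h1 h2]].
  (* [ps (S k)] is conjugate, at the arrival point, to the velocity of the step from [k] to [S k].
     The value [ps 0], given by [Nat.pred 0 = 0], has no meaning, which is why the conclusions start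
     at index 1. *)
  set (ps := fun k => proj1_sig (constructive_indefinite_description _
    (ham_surj _ _ _ HH (xs k) ((xs k - xs (Nat.pred k)) / tau)))).
  assert (hps : forall k, Hp (xs (S k)) (ps (S k)) = (xs (S k) - xs k) / tau).
  { intros k; unfold ps; destruct (constructive_indefinite_description _ _) as [p hp]; exact hp. }
  exists xs, ps; split; [exact h1|]; split.
  - intros k hk; destruct (h2 k hk) as [a b]; rewrite hps; split; [|split; [|exact b]].
    + apply (hc (xs (S k))); now rewrite hps.
    + field; lra.
  - intros k hk; destruct (h2 k ltac:(lia)) as [a b]; destruct (h2 (S k) hk) as [a' b'].
    symmetry; apply Rminus_diag_uniq.
    (* A move [h] of the node changes the two velocities by [h / tau] and [- h / tau], which
       [|h| <= tau] keeps within the range of [Lag_semiconcave]. The constant blows up with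
       [1 / tau], but only stationarity is retained. *)
    apply (first_order_condition _ (C * (tau + 2 / tau)) tau).
    { lra. }
    { apply Rmult_le_pos; auto; apply Rplus_le_le_0_compat; [lra|].
      apply Rlt_le, Rdiv_lt_0_compat; lra. }
    intros h hh.
    destruct (hs (S k) (xs (S (S k)))) as [m _].
    specialize (m ((xs (S (S k)) - (xs (S k) + h)) / tau)).
    destruct (hs k (xs (S k) + h)) as [m' _].
    specialize (m' ((xs (S k) + h - xs k) / tau)).
    replace (xs (S (S k)) - tau * ((xs (S (S k)) - (xs (S k) + h)) / tau)) with (xs (S k) + h) in m
      by (field; lra).
    replace (xs (S k) + h - tau * ((xs (S k) + h - xs k) / tau)) with (xs k) in m' by (field; lra).
    assert (ht' : Rabs (h / tau) <= 1).
    { apply Rabs_div_le; lra. }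
    rewrite <- hps in a, a', b, b'.
    pose proof (sc (xs (S k)) (ps (S k)) h (h / tau) a ltac:(lra) ht') as s1.
    pose proof (sc (xs (S (S k))) (ps (S (S k))) 0 (- (h / tau)) a'
      ltac:(rewrite Rabs_R0; lra) ltac:(rewrite Rabs_Ropp; lra)) as s2.
    replace (Hp (xs (S k)) (ps (S k)) + h / tau) with ((xs (S k) + h - xs k) / tau) in s1
      by (rewrite hps; field; lra).
    replace (Hp (xs (S (S k))) (ps (S (S k))) + - (h / tau))
      with ((xs (S (S k)) - (xs (S k) + h)) / tau) in s2 by (rewrite hps; field; lra).
    rewrite Rplus_0_r in s2.
    apply Rmult_le_compat_l with (r := tau) in s1; [|lra].
    apply Rmult_le_compat_l with (r := tau) in s2; [|lra].
    set (x1 := xs (S k)) in *; set (x2 := xs (S (S k))) in *.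
    set (p1 := ps (S k)) in *; set (p2 := ps (S (S k))) in *.
    set (w := h / tau) in *.
    assert (ew : tau * w = h) by (unfold w; field; lra).
    replace (C * (tau + 2 / tau) * (h * h)) with (tau * (C * (h * h + w * w)) + tau * (C * (w * w)))
      by (unfold w; field; lra).
    replace ((p1 - tau * Hx x1 p1 - p2) * h) with (p1 * (tau * w) - tau * (Hx x1 p1 * h) - p2 * (tau * w))
      by (rewrite ew; ring).
    nra.
Qed.

End Scheme.

(** * Action and admissible curves *)

(** The Lagrangian density written through the momentum, as [p v - H] with [v = Hp q p]: it is
    locally Lipschitz in [(q, p)] and does not involve the derivative of [q]. *)
Definition Act (H Hp : R -> R -> R) (q p : R -> R) (t : R) : R :=
  0 + RInt (fun s => p s * Hp (q s) (p s) - H (q s) (p s)) 0 t.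

(* [a] bounds the action along [ga], in a form that only involves chords, so that it survives
   concatenation and can be compared with the discrete scheme directly. *)
Definition Adm (L : R -> R -> R) (ga a : R -> R) (t0 t : R) : Prop :=
  exists C, 0 <= C /\ forall r s, t0 <= r -> r < s -> s <= t ->
    Rabs (ga s - ga r) <= C * (s - r) /\
    (s - r) * L (ga s) ((ga s - ga r) / (s - r)) <= a s - a r + C * ((s - r) * (s - r)).

Section Tonelli.

Variables H Hx Hp : R -> R -> R.
Hypothesis HH : Ham H Hx Hp.

Lemma lagrangian_density_Lipschitz (P : R) : exists C, 0 <= C /\ forall x y p r,
  Rabs p <= P -> Rabs r <= P ->
  Rabs (p * Hp x p - H x p - (r * Hp y r - H y r)) <= C * (Rabs (x - y) + Rabs (p - r)).
Proof.
  destruct (ham_loc _ _ _ HH P) as [A [hA ha]]; destruct (ham_Lipschitz _ _ _ HH P) as [B [hB hb]].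
  exists (Rabs P * A + A + B); split; [pose proof (Rabs_pos P); nra|].
  intros x y p r h1 h2.
  replace (p * Hp x p - H x p - (r * Hp y r - H y r))
    with (p * (Hp x p - Hp y r) + (p - r) * Hp y r + - (H x p - H y r)) by ring.
  eapply Rle_trans; [apply Rabs_triang|]; rewrite Rabs_Ropp.
  pose proof (Rabs_triang (p * (Hp x p - Hp y r)) ((p - r) * Hp y r)) as tr.
  rewrite !Rabs_mult in tr; pose proof (hb x y p r h1 h2).
  destruct (ha x p h1) as (_ & _ & _ & k); destruct (k y r h2) as [_ k2].
  destruct (ha y r h2) as (_ & _ & k3 & _).
  assert (Rabs p <= Rabs P) by (apply Rle_trans with P; auto; apply RRle_abs).
  set (d := Rabs (x - y) + Rabs (p - r)) in *.
  assert (Rabs p * Rabs (Hp x p - Hp y r) <= Rabs P * (A * d))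
    by (apply Rmult_le_compat; auto; apply Rabs_pos).
  assert (Rabs (p - r) * Rabs (Hp y r) <= d * A).
  { apply Rmult_le_compat; auto; try apply Rabs_pos; unfold d; pose proof (Rabs_pos (x - y)); lra. }
  lra.
Qed.

Lemma HSol_continuity (q p : R -> R) : HSol Hx Hp q p ->
  (forall t, continuity_pt q t) /\ (forall t, continuity_pt p t).
Proof.
  intros h; split; intros t.
  - exact (derive_continuity q t _ (proj1 (h t))).
  - exact (derive_continuity p t _ (proj2 (h t))).
Qed.

Lemma continuity_along (F : R -> R -> R) (q p : R -> R) (t : R) :
  (forall P, exists C, 0 <= C /\ forall x y u v, Rabs u <= P -> Rabs v <= P ->
     Rabs (F x u - F y v) <= C * (Rabs (x - y) + Rabs (u - v))) ->
  continuity_pt q t -> continuity_pt p t -> continuity_pt (fun s => F (q s) (p s)) t.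
Proof.
  intros hF hq hp; destruct (hF (Rabs (p t) + 1)) as [C [hC h]].
  apply continuity_eps; intros eps he.
  assert (he' : 0 < eps / (2 * (C + 1))) by (apply Rdiv_lt_0_compat; lra).
  destruct (proj1 (continuity_eps q t) hq _ he') as [d [hd h1]].
  destruct (proj1 (continuity_eps p t) hp _ he') as [d' [hd' h2]].
  destruct (proj1 (continuity_eps p t) hp 1 Rlt_0_1) as [d3 [hd3 h3]].
  exists (Rmin d (Rmin d' d3)); split; [repeat apply Rmin_glb_lt; auto|]; intros u hu.
  pose proof (Rmin_l d (Rmin d' d3)); pose proof (Rmin_r d (Rmin d' d3)).
  pose proof (Rmin_l d' d3); pose proof (Rmin_r d' d3).
  specialize (h1 u ltac:(lra)); specialize (h2 u ltac:(lra)); specialize (h3 u ltac:(lra)).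
  eapply Rle_lt_trans; [apply h|].
  - replace (p u) with ((p u - p t) + p t) by ring; eapply Rle_trans; [apply Rabs_triang|lra].
  - lra.
  - replace eps with ((C + 1) * (eps / (2 * (C + 1)) + eps / (2 * (C + 1)))) by (field; lra).
    pose proof (Rabs_pos (q u - q t)); pose proof (Rabs_pos (p u - p t)).
    apply Rle_lt_trans with ((C + 1) * (Rabs (q u - q t) + Rabs (p u - p t)));
      [apply Rmult_le_compat_r; lra | apply Rmult_lt_compat_l; lra].
Qed.

Lemma continuity_Hp_along (q p : R -> R) (t : R) : HSol Hx Hp q p ->
  continuity_pt (fun s => Hp (q s) (p s)) t.
Proof.
  intros h; destruct (HSol_continuity q p h); apply continuity_along; auto.
  intros P; destruct (ham_loc _ _ _ HH P) as [C [hC k]]; exists C; split; auto.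
  intros x y u v hu hv; destruct (k x u hu) as (_ & _ & _ & l); now apply l.
Qed.

Lemma continuity_Hx_along (q p : R -> R) (t : R) : HSol Hx Hp q p ->
  continuity_pt (fun s => Hx (q s) (p s)) t.
Proof.
  intros h; destruct (HSol_continuity q p h); apply continuity_along; auto.
  intros P; destruct (ham_loc _ _ _ HH P) as [C [hC k]]; exists C; split; auto.
  intros x y u v hu hv; destruct (k x u hu) as (_ & _ & _ & l); now apply l.
Qed.

Lemma continuity_density_along (q p : R -> R) (t : R) : HSol Hx Hp q p ->
  continuity_pt (fun s => p s * Hp (q s) (p s) - H (q s) (p s)) t.
Proof.
  intros h; destruct (HSol_continuity q p h).
  apply (continuity_along (fun x p => p * Hp x p - H x p)); auto.
  intros P; destruct (lagrangian_density_Lipschitz P) as [C [hC k]]; exists C; auto.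
Qed.

Lemma Act_derive (q p : R -> R) (t : R) : HSol Hx Hp q p ->
  is_derive (Act H Hp q p) t (p t * Hp (q t) (p t) - H (q t) (p t)).
Proof.
  intros h; apply (is_derive_primitive 0 (fun s => p s * Hp (q s) (p s) - H (q s) (p s))).
  intros s; now apply continuity_density_along.
Qed.

Lemma Act_0 (q p : R -> R) : Act H Hp q p 0 = 0.
Proof. apply primitive_at_0. Qed.

(** Jensen's inequality by differentiation: with [p] conjugate to the velocity of the chord at its
    end point, Young's inequality bounds the derivative of [p * ga - a] by [H (ga s) p] up to
    [O(s - r)]. *)
Lemma Adm_C1 (ga a w b : R -> R) (t0 t M : R) :
  (forall r, t0 <= r <= t -> is_derive ga r (w r)) -> (forall r, t0 <= r <= t -> is_derive a r (b r)) ->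
  (forall r, t0 <= r <= t -> Rabs (w r) <= M) -> (forall r, t0 <= r <= t -> Lag H (ga r) (w r) <= b r) ->
  Adm (Lag H) ga a t0 t.
Proof.
  intros hg ha hw hb.
  destruct (Lag_attained _ _ _ HH M) as [P [hP hatt]].
  destruct (ham_Lipschitz _ _ _ HH P) as [C [hC hl]].
  exists (Rabs M + C * Rabs M); pose proof (Rabs_pos M); split; [nra|].
  intros r s hr hrs hs.
  assert (lip : forall u v, r <= u <= s -> r <= v <= s -> Rabs (ga u - ga v) <= M * Rabs (u - v)).
  { intros u v hu hv; apply (derive_Lipschitz ga w); intros z hz;
      [apply hg | apply hw]; revert hz; unfold Rmin, Rmax; destruct Rle_dec; lra. }
  assert (hM : M <= Rabs M) by apply RRle_abs.
  assert (l1 : Rabs (ga s - ga r) <= M * (s - r)).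
  { rewrite <- (Rabs_right (s - r)) by lra; apply lip; lra. }
  split.
  { eapply Rle_trans; [exact l1|]; apply Rmult_le_compat_r; nra. }
  assert (hv : Rabs ((ga s - ga r) / (s - r)) <= M).
  { apply Rabs_div_le; lra. }
  destruct (hatt (ga s) _ hv) as [p [hp [_ ->]]].
  replace ((s - r) * (p * ((ga s - ga r) / (s - r)) - H (ga s) p))
    with (p * (ga s - ga r) - H (ga s) p * (s - r)) by (field; lra).
  pose proof (derive_le (fun u => p * ga u - a u) (fun u => p * w u - b u)
    (H (ga s) p + C * (Rabs M * (s - r))) r s ltac:(lra)) as K.
  cbv beta in K.
  enough (p * ga s - a s - (p * ga r - a r) <= (H (ga s) p + C * (Rabs M * (s - r))) * (s - r)).
  { assert (0 <= Rabs M * ((s - r) * (s - r))) by (apply Rmult_le_pos; nra). nra. }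
  apply K; intros u hu.
  - pose proof (hg u ltac:(lra)); pose proof (ha u ltac:(lra)); dvf; ring.
  - pose proof (hb u ltac:(lra)); pose proof (Young _ _ _ HH (ga u) p (w u)).
    pose proof (hl (ga u) (ga s) p p hp hp) as e; rewrite (Rminus_diag p), Rabs_R0, Rplus_0_r in e.
    apply Rabs_le_between in e.
    pose proof (lip u s ltac:(lra) ltac:(lra)) as l.
    rewrite Rabs_minus_sym, (Rabs_minus_sym u), (Rabs_right (s - u)) in l by lra.
    rewrite Rabs_minus_sym in e.
    assert (Rabs (ga s - ga u) <= Rabs M * (s - r)).
    { eapply Rle_trans; [exact l|]; pose proof (Rabs_pos (w u)); pose proof (hw u ltac:(lra)).
      apply Rmult_le_compat; lra. }
    assert (C * Rabs (ga s - ga u) <= C * (Rabs M * (s - r))) by (apply Rmult_le_compat_l; auto).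
    lra.
Qed.

Lemma Adm_HSol (q p : R -> R) (t0 t P : R) : HSol Hx Hp q p -> (forall s, Rabs (p s) <= P) ->
  Adm (Lag H) q (Act H Hp q p) t0 t.
Proof.
  intros h hP; destruct (ham_loc _ _ _ HH P) as [C [hC hc]].
  apply (Adm_C1 _ _ (fun s => Hp (q s) (p s)) (fun s => p s * Hp (q s) (p s) - H (q s) (p s)) t0 t C).
  - intros; apply h.
  - intros; now apply Act_derive.
  - intros r _; now apply hc.
  - intros r _; rewrite (Lag_eq _ _ _ HH); lra.
Qed.

(** A discrete Gronwall estimate run backwards in the index, because the two trajectories are
    compared from their final data. *)
Lemma euler_error (P T : R) : 0 <= T -> exists La, 0 <= La /\ forall q p (xs ps : nat -> R) N tau,
  HSol Hx Hp q p -> (forall s, Rabs (p s) <= P) -> 0 < tau -> INR N * tau <= T ->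
  (forall k, (k < N)%nat -> Rabs (ps (S k)) <= P /\ xs k = xs (S k) - tau * Hp (xs (S k)) (ps (S k))) ->
  (forall k, (S k < N)%nat -> ps (S (S k)) = ps (S k) - tau * Hx (xs (S k)) (ps (S k))) ->
  let E := exp (La * T) * (Rabs (xs N - q (INR N * tau)) + Rabs (ps N - p (INR N * tau)) + La * T * tau) in
  (forall k, (k <= N)%nat -> Rabs (xs k - q (INR k * tau)) <= E) /\
  (forall k, (k < N)%nat ->
     Rabs (xs (S k) - q (INR (S k) * tau)) + Rabs (ps (S k) - p (INR (S k) * tau)) <= E).
Proof.
  intros hT; destruct (ham_loc _ _ _ HH P) as [C [hC hc]].
  (* [2 * C] bounds the growth of the sum of the two errors; [6 * C * C] collects three consistency
     errors [2 * C * C * tau^2], one for the position and two for the momentum. *)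
  set (La := 2 * C + 6 * C * C); assert (hLa : 0 <= La) by (unfold La; nra).
  exists La; split; [exact hLa|]; intros q p xs ps N tau hs hb ht hN h1 h2 E.
  set (e := fun k => Rabs (xs k - q (INR k * tau)) + Rabs (ps k - p (INR k * tau))).
  assert (dq : forall u v, Rabs (q u - q v) <= C * Rabs (u - v)).
  { intros u v; apply (derive_Lipschitz q (fun s => Hp (q s) (p s))); intros; [apply hs | now apply hc]. }
  assert (dp : forall u v, Rabs (p u - p v) <= C * Rabs (u - v)).
  { intros u v; apply (derive_Lipschitz p (fun s => - Hx (q s) (p s))); intros;
      [apply hs | rewrite Rabs_Ropp; now apply hc]. }
  assert (loc : forall s, Rabs (q s - (q (s + tau) - tau * Hp (q (s + tau)) (p (s + tau)))) <= 2 * C * C * (tau * tau) /\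
                Rabs (p s - (p (s + tau) + tau * Hx (q (s + tau)) (p (s + tau)))) <= 2 * C * C * (tau * tau)).
  { intros s; set (t' := s + tau).
    assert (near : forall z, Rmin s t' <= z <= Rmax s t' -> 
      Rabs (Hx (q z) (p z) - Hx (q t') (p t')) <= 2 * C * C * tau /\
      Rabs (Hp (q z) (p z) - Hp (q t') (p t')) <= 2 * C * C * tau).
    { intros z hz; destruct (hc (q z) (p z) (hb z)) as (_ & _ & _ & k).
      destruct (k (q t') (p t') (hb t')) as [k1 k2].
      pose proof (dq z t'); pose proof (dp z t').
      assert (Rabs (z - t') <= tau).
      { revert hz; unfold t', Rmin, Rmax; destruct Rle_dec; unfold Rabs; destruct Rcase_abs; lra. }
      assert (C * (Rabs (q z - q t') + Rabs (p z - p t')) <= 2 * C * C * tau).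
      { replace (2 * C * C * tau) with (C * (C * tau + C * tau)) by ring.
        assert (C * Rabs (z - t') <= C * tau) by (apply Rmult_le_compat_l; auto).
        apply Rmult_le_compat_l; lra. }
      split; lra. }
    assert (et : Rabs (s - t') = tau) by (unfold t'; rewrite Rabs_left; lra).
    split.
    - replace (q s - (q t' - tau * Hp (q t') (p t')))
        with (q s - Hp (q t') (p t') * s - (q t' - Hp (q t') (p t') * t')) by (unfold t'; ring).
      replace (2 * C * C * (tau * tau)) with (2 * C * C * tau * Rabs (s - t')) by (rewrite et; ring).
      apply (derive_Lipschitz (fun z => q z - Hp (q t') (p t') * z)
        (fun z => Hp (q z) (p z) - Hp (q t') (p t'))); intros z hz; [|now apply near].
      destruct (hs z); dvf; ring.
    - replace (p s - (p t' + tau * Hx (q t') (p t')))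
        with (p s + Hx (q t') (p t') * s - (p t' + Hx (q t') (p t') * t')) by (unfold t'; ring).
      replace (2 * C * C * (tau * tau)) with (2 * C * C * tau * Rabs (s - t')) by (rewrite et; ring).
      apply (derive_Lipschitz (fun z => p z + Hx (q t') (p t') * z)
        (fun z => - (Hx (q z) (p z) - Hx (q t') (p t')))); intros z hz;
        [|rewrite Rabs_Ropp; now apply near].
      destruct (hs z); dvf; ring. }
  assert (CC : 0 <= C * C * (tau * tau)) by (apply Rmult_le_pos; nra).
  assert (stepx : forall k, (k < N)%nat -> Rabs (xs k - q (INR k * tau)) <=
     Rabs (xs (S k) - q (INR (S k) * tau)) + tau * (C * e (S k)) + 2 * C * C * (tau * tau)).
  { intros k hk; destruct (h1 k hk) as [b ->].
    rewrite S_INR; replace ((INR k + 1) * tau) with (INR k * tau + tau) by ring.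
    set (s := INR k * tau); destruct (loc s) as [l _].
    unfold e; rewrite S_INR; replace ((INR k + 1) * tau) with (s + tau) by (unfold s; ring).
    destruct (hc (xs (S k)) (ps (S k)) b) as (_ & _ & _ & m).
    destruct (m (q (s + tau)) (p (s + tau)) (hb _)) as [_ m2].
    replace (xs (S k) - tau * Hp (xs (S k)) (ps (S k)) - q s)
      with ((xs (S k) - q (s + tau)) + - (tau * (Hp (xs (S k)) (ps (S k)) - Hp (q (s + tau)) (p (s + tau))))
        + - (q s - (q (s + tau) - tau * Hp (q (s + tau)) (p (s + tau))))) by ring.
    eapply Rle_trans; [apply Rabs_triang|]; rewrite Rabs_Ropp; apply Rplus_le_compat; auto.
    eapply Rle_trans; [apply Rabs_triang|]; rewrite Rabs_Ropp; apply Rplus_le_compat_l.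
    rewrite Rabs_mult, (Rabs_right tau) by lra; apply Rmult_le_compat_l; lra. }
  (* The momentum recursion evaluates [Hx] at the node [S k], not at [S (S k)]; [m2] and [cl] move
     it there for one more term of order [tau^2]. *)
  assert (stepe : forall k, (S k < N)%nat -> e (S k) <= (1 + La * tau) * e (S (S k)) + La * (tau * tau)).
  { intros k hk; pose proof (stepx (S k) hk) as sx; destruct (h1 (S k) hk) as [b xk].
    destruct (h1 k ltac:(lia)) as [b1 _]; pose proof (h2 k hk) as pk.
    set (t' := INR (S (S k)) * tau) in *.
    assert (es : INR (S k) * tau + tau = t') by (unfold t'; rewrite (S_INR (S k)); ring).
    destruct (loc (INR (S k) * tau)) as [_ l]; rewrite es in l.
    destruct (hc (xs (S (S k))) (ps (S (S k))) b) as (_ & _ & B2 & m).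
    destruct (m (q t') (p t') (hb _)) as [m1 _].
    destruct (hc (xs (S k)) (ps (S k)) b1) as (_ & B1 & _ & m').
    destruct (m' (xs (S (S k))) (ps (S (S k))) b) as [m2 _].
    set (x1 := xs (S k)) in *; set (x2 := xs (S (S k))) in *.
    set (p1 := ps (S k)) in *; set (p2 := ps (S (S k))) in *.
    assert (cl : Rabs (x1 - x2) + Rabs (p1 - p2) <= 2 * C * tau).
    { replace (x1 - x2) with (- (tau * Hp x2 p2)) by (rewrite xk; ring).
      replace (p1 - p2) with (tau * Hx x1 p1) by (rewrite pk; ring).
      rewrite Rabs_Ropp, !Rabs_mult, (Rabs_right tau) by lra.
      assert (tau * Rabs (Hp x2 p2) <= tau * C) by (apply Rmult_le_compat_l; lra).
      assert (tau * Rabs (Hx x1 p1) <= tau * C) by (apply Rmult_le_compat_l; lra).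
      lra. }
    assert (sp : Rabs (p1 - p (INR (S k) * tau)) <= Rabs (p2 - p t') + tau * (C * e (S (S k)))
        + 2 * C * C * (tau * tau) + 2 * C * C * (tau * tau)).
    { replace (p1 - p (INR (S k) * tau)) with ((p2 - p t') + tau * (Hx x2 p2 - Hx (q t') (p t'))
        + tau * (Hx x1 p1 - Hx x2 p2)
        + - (p (INR (S k) * tau) - (p t' + tau * Hx (q t') (p t')))) by (rewrite pk; ring).
      eapply Rle_trans; [apply Rabs_triang|]; rewrite Rabs_Ropp; apply Rplus_le_compat; auto.
      eapply Rle_trans; [apply Rabs_triang|]; apply Rplus_le_compat.
      - eapply Rle_trans; [apply Rabs_triang|]; apply Rplus_le_compat_l.
        rewrite Rabs_mult, (Rabs_right tau) by lra; apply Rmult_le_compat_l; [lra | exact m1].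
      - rewrite Rabs_mult, (Rabs_right tau) by lra.
        replace (2 * C * C * (tau * tau)) with (tau * (C * (2 * C * tau))) by ring.
        apply Rmult_le_compat_l; [lra|]; eapply Rle_trans; [exact m2|].
        apply Rmult_le_compat_l; auto. }
    assert (e0 : 0 <= e (S (S k))) by (unfold e; pose proof (Rabs_pos (x2 - q t')); pose proof (Rabs_pos (p2 - p t')); unfold x2, p2, t' in *; lra).
    assert (0 <= C * (tau * tau)) by (apply Rmult_le_pos; nra).
    assert (0 <= C * C * (tau * e (S (S k)))) by (repeat apply Rmult_le_pos; auto; lra).
    assert (e (S k) <= e (S (S k)) + 2 * (tau * (C * e (S (S k)))) + 6 * C * C * (tau * tau)).
    { unfold e at 1 2; fold x1 x2 p1 p2 t'; lra. }
    unfold La; lra. }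
  assert (e0 : forall k, 0 <= e k).
  { intros k; unfold e; pose proof (Rabs_pos (xs k - q (INR k * tau))); pose proof (Rabs_pos (ps k - p (INR k * tau))); lra. }
  assert (ind : forall j, (j < N)%nat ->
    e (N - j)%nat <= exp (La * (INR j * tau)) * (e N + INR j * (La * (tau * tau)))).
  { induction j as [|j IH]; intros hj.
    - simpl; rewrite !Rmult_0_l, Rmult_0_r, exp_0, Nat.sub_0_r; lra.
    - specialize (IH ltac:(lia)).
      pose proof (stepe (N - j - 2)%nat ltac:(lia)) as st.
      replace (S (N - j - 2)) with (N - S j)%nat in st by lia.
      replace (S (N - S j)) with (N - j)%nat in st by lia.
      rewrite S_INR.
      replace (La * ((INR j + 1) * tau)) with (La * tau + La * (INR j * tau)) by ring.
      rewrite exp_plus.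
      pose proof (exp_ineq1_le (La * tau)) as ei; pose proof (exp_pos (La * (INR j * tau))).
      assert (0 <= La * tau) by (apply Rmult_le_pos; lra).
      set (A := exp (La * tau)) in *; set (B := exp (La * (INR j * tau))) in *.
      assert (B1 : 1 <= B).
      { unfold B; pose proof (exp_ineq1_le (La * (INR j * tau))); pose proof (pos_INR j).
        assert (0 <= La * (INR j * tau)) by (apply Rmult_le_pos; auto; apply Rmult_le_pos; lra); lra. }
      assert (0 <= La * (tau * tau)) by (apply Rmult_le_pos; nra).
      set (X := e N + INR j * (La * (tau * tau))) in *.
      assert (hX : 0 <= X) by (unfold X; pose proof (e0 N); pose proof (pos_INR j); assert (0 <= INR j * (La * (tau * tau))) by (apply Rmult_le_pos; auto); lra).
      replace (e N + (INR j + 1) * (La * (tau * tau))) with (X + La * (tau * tau)) by (unfold X; ring).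
      assert ((1 + La * tau) * e (N - j)%nat <= A * (B * X)).
      { apply Rmult_le_compat; auto; lra. }
      assert (La * (tau * tau) <= A * B * (La * (tau * tau))).
      { assert (1 <= A * B) by nra.
        rewrite <- (Rmult_1_l (La * (tau * tau))) at 1; apply Rmult_le_compat_r; auto. }
      lra. }
  assert (expm : forall j, INR j * tau <= T -> exp (La * (INR j * tau)) <= exp (La * T)).
  { intros j hj; assert (le : La * (INR j * tau) <= La * T) by (apply Rmult_le_compat_l; auto).
    destruct le as [l | ->]; [apply Rlt_le, exp_increasing, l | lra]. }
  assert (fin : forall j, (j <= N)%nat ->
    exp (La * (INR j * tau)) * (e N + INR j * (La * (tau * tau))) <= E).
  { intros j hj; unfold E; fold (e N).
    assert (jT : INR j * tau <= T).
    { apply Rle_trans with (INR N * tau); auto; apply Rmult_le_compat_r; [lra | now apply le_INR]. }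
    pose proof (pos_INR j).
    apply Rmult_le_compat; auto.
    - apply Rlt_le, exp_pos.
    - pose proof (e0 N); assert (0 <= INR j * (La * (tau * tau))) by (apply Rmult_le_pos; auto; apply Rmult_le_pos; nra); lra.
    - replace (INR j * (La * (tau * tau))) with (La * (INR j * tau) * tau) by ring.
      apply Rplus_le_compat_l, Rmult_le_compat_r; [lra|]; apply Rmult_le_compat_l; auto. }
  assert (G : forall k, (k < N)%nat -> e (S k) <= E).
  { intros k hk; pose proof (ind (N - S k)%nat ltac:(lia)) as i.
    replace (N - (N - S k))%nat with (S k) in i by lia.
    eapply Rle_trans; [exact i|]; apply fin; lia. }
  split; [|exact G].
  (* Since [ps 0] is unconstrained, index 0 is reached from index 1 by one step on the position
     alone. *)
  intros [|k] hk; [|pose proof (G k ltac:(lia)) as g; unfold e in g;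
    pose proof (Rabs_pos (ps (S k) - p (INR (S k) * tau))); lra].
  destruct N as [|N].
  - pose proof (fin O (le_n O)) as f; simpl in f; rewrite Rmult_0_l, Rmult_0_r, exp_0 in f.
    pose proof (Rabs_pos (ps O - p (INR 0 * tau))); unfold e in f; simpl in *; lra.
  - pose proof (stepx O ltac:(lia)) as sx; pose proof (ind N ltac:(lia)) as i.
    replace (S N - N)%nat with 1%nat in i by lia.
    assert (a1 : Rabs (xs 1%nat - q (INR 1 * tau)) <= e 1%nat)
      by (unfold e; pose proof (Rabs_pos (ps 1%nat - p (INR 1 * tau))); lra).
    pose proof (fin (S N) (le_n _)) as f; rewrite S_INR in f.
    replace (La * ((INR N + 1) * tau)) with (La * tau + La * (INR N * tau)) in f by ring.
    rewrite exp_plus in f.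
    pose proof (exp_ineq1_le (La * tau)) as ei.
    assert (0 <= La * tau) by (apply Rmult_le_pos; lra).
    set (A := exp (La * tau)) in *; set (B := exp (La * (INR N * tau))) in *.
    assert (B1 : 1 <= B).
    { unfold B; pose proof (exp_ineq1_le (La * (INR N * tau))); pose proof (pos_INR N).
      assert (0 <= La * (INR N * tau)) by (apply Rmult_le_pos; auto; apply Rmult_le_pos; lra); lra. }
    set (X := e (S N) + INR N * (La * (tau * tau))) in *.
    replace (e (S N) + (INR N + 1) * (La * (tau * tau))) with (X + La * (tau * tau)) in f by (unfold X; ring).
    assert (0 <= La * (tau * tau)) by (apply Rmult_le_pos; nra).
    assert ((1 + La * tau) * e 1%nat <= A * (B * X)).
    { apply Rmult_le_compat; auto; lra. }
    assert (La * (tau * tau) <= A * B * (La * (tau * tau))).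
    { assert (1 <= A * B) by nra.
      rewrite <- (Rmult_1_l (La * (tau * tau))) at 1; apply Rmult_le_compat_r; auto. }
    assert (tau * (C * e 1%nat) <= La * tau * e 1%nat).
    { replace (tau * (C * e 1%nat)) with (C * tau * e 1%nat) by ring.
      apply Rmult_le_compat_r; auto; apply Rmult_le_compat_r; unfold La; nra. }
    assert (2 * C * C * (tau * tau) <= La * (tau * tau)).
    { apply Rmult_le_compat_r; unfold La; nra. }
    lra.
Qed.

End Tonelli.

(** * Tonelli's theorem *)

Lemma bounded_cluster_point (u : nat -> R) (P : R) : (forall n, Rabs (u n) <= P) ->
  exists l, Rabs l <= P /\
    forall eps N, 0 < eps -> exists n, (N <= n)%nat /\ Rabs (u n - l) < eps.
Proof.
  intros h.
  destruct (Bolzano_Weierstrass u (fun x => - P <= x <= P)) as [l hl].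
  - apply compact_P3.
  - intros n; specialize (h n); now apply Rabs_le_between in h.
  - assert (A : forall eps N, 0 < eps -> exists n, (N <= n)%nat /\ Rabs (u n - l) < eps).
    { intros eps N he.
      destruct (hl (disc l (mkposreal eps he)) N) as [n [hn hd]].
      - exists (mkposreal eps he); intros x hx; exact hx.
      - exists n; split; [exact hn | exact hd]. }
    exists l; split; [|exact A].
    apply le_epsilon; intros eps he; destruct (A eps O he) as [n [_ hn]].
    specialize (h n); rewrite Rabs_minus_sym in hn.
    replace l with ((l - u n) + u n) by ring; eapply Rle_trans; [apply Rabs_triang | lra].
Qed.

Section TonelliTheorem.

Variables H Hx Hp : R -> R -> R.
Hypothesis HH : Ham H Hx Hp.

Lemma Act_increment (P : R) : exists C, 0 <= C /\ forall q p s tau, HSol Hx Hp q p ->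
  (forall s, Rabs (p s) <= P) -> 0 <= tau ->
  Rabs (Act H Hp q p (s + tau) - Act H Hp q p s
    - tau * (p (s + tau) * Hp (q (s + tau)) (p (s + tau)) - H (q (s + tau)) (p (s + tau))))
  <= C * (tau * tau).
Proof.
  destruct (ham_loc _ _ _ HH P) as [A [hA ha]].
  destruct (lagrangian_density_Lipschitz _ _ _ HH P) as [B [hB hb]].
  exists (2 * A * B); split; [nra|]; intros q p s tau h hp ht.
  set (l := fun s => p s * Hp (q s) (p s) - H (q s) (p s)); fold (l (s + tau)).
  pose proof (derive_Lipschitz (fun u => Act H Hp q p u - l (s + tau) * u)
    (fun u => l u - l (s + tau)) (2 * A * B * tau) (s + tau) s) as K; cbv beta in K.
  replace (s + tau - s) with tau in K by ring; rewrite (Rabs_right tau) in K by lra.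
  replace (Act H Hp q p (s + tau) - Act H Hp q p s - tau * l (s + tau))
    with (Act H Hp q p (s + tau) - l (s + tau) * (s + tau) - (Act H Hp q p s - l (s + tau) * s)) by ring.
  replace (2 * A * B * (tau * tau)) with (2 * A * B * tau * tau) by ring; apply K.
  - intros u _; pose proof (Act_derive _ _ _ HH q p u h); unfold l; dvf; ring.
  - intros u hu.
    assert (hu' : Rabs (u - (s + tau)) <= tau).
    { revert hu; unfold Rmin, Rmax; destruct Rle_dec; unfold Rabs; destruct Rcase_abs; lra. }
    assert (dq : Rabs (q u - q (s + tau)) <= A * tau).
    { eapply Rle_trans; [apply (derive_Lipschitz q (fun s => Hp (q s) (p s)) A)|];
        [intros; apply h | intros; now apply ha | apply Rmult_le_compat_l; auto]. }
    assert (dp : Rabs (p u - p (s + tau)) <= A * tau).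
    { eapply Rle_trans; [apply (derive_Lipschitz p (fun s => - Hx (q s) (p s)) A)|];
        [intros; apply h | intros; rewrite Rabs_Ropp; now apply ha | apply Rmult_le_compat_l; auto]. }
    eapply Rle_trans; [apply hb; auto|].
    replace (2 * A * B * tau) with (B * (A * tau + A * tau)) by ring.
    apply Rmult_le_compat_l; lra.
Qed.

(** [P] precedes [f]: the momentum bound depends on the datum only through its Lipschitz
    constant. *)
Theorem tonelli (K T : R) : 0 < T -> exists P, 0 <= P /\ forall f, LipK K f ->
  forall t x, 0 <= t <= T -> exists q p, HSol Hx Hp q p /\ q t = x /\ (forall s, Rabs (p s) <= P) /\
    forall ga a, Adm (Lag H) ga a 0 t -> ga t = x ->
      f (q 0) + Act H Hp q p t <= f (ga 0) + a t - a 0.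
Proof.
  intros hT; destruct (discrete_minimizers _ _ _ HH K) as [P0 [hP0 hd]].
  destruct (HSol_bounded _ _ _ HH P0) as [P1 [hP1 hbd]].
  set (P := P0 + P1).
  destruct (euler_error _ _ _ HH P T ltac:(lra)) as [La [hLa hee]].
  destruct (Act_increment P) as [CA [hCA hinc]].
  destruct (lagrangian_density_Lipschitz _ _ _ HH P) as [B [hB hb]].
  exists P; split; [unfold P; lra|]; intros f hf t x ht.
  (* The time step [t / N] must be positive, so [t = 0] is treated apart. *)
  destruct (Req_dec t 0) as [t0|t0].
  { subst t; destruct (flow_exists _ _ _ HH 0 x 0) as (q & p & h & h1 & h2).
    exists q, p; split; [exact h|]; split; [exact h1|]; split.
    - intros s; apply Rle_trans with P1; [|unfold P; lra].
      apply (hbd q p 0); auto; rewrite h2, Rabs_R0; lra.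
    - intros ga a _ e; rewrite h1, e, Act_0; lra. }
  assert (tp : 0 < t) by lra.
  destruct (archimed t) as [u1 _].
  set (N0 := Z.to_nat (up t)).
  assert (hN0 : t < INR N0).
  { unfold N0; rewrite INR_IZR_INZ, Z2Nat.id; [lra|]; apply le_IZR; lra. }
  (* The shift by [N0 > t] makes every step at most 1, as [discrete_minimizers] demands. *)
  set (N := fun n => (S n + N0)%nat); set (tau := fun n => t / INR (N n)).
  assert (Npos : forall n, 0 < INR (N n)) by (intros; unfold N; apply lt_0_INR; lia).
  assert (Nge : forall n, INR N0 <= INR (N n)) by (intros; unfold N; apply le_INR; lia).
  assert (tau_pos : forall n, 0 < tau n <= 1).
  { intros n; unfold tau; split; [apply Rdiv_lt_0_compat; auto|].
    apply Rmult_le_reg_r with (INR (N n)); auto; unfold Rdiv; rewrite Rmult_assoc, Rinv_l by (specialize (Npos n); lra).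
    specialize (Nge n); lra. }
  assert (Ntau : forall n, INR (N n) * tau n = t) by (intros n; unfold tau; field; specialize (Npos n); lra).
  set (spec := fun n (z : (nat -> R -> R) * ((nat -> R) * (nat -> R))) =>
    let U := fst z in let xs := fst (snd z) in let ps := snd (snd z) in
    U O = f /\ (forall k x v, U (S k) x <= U k (x - tau n * v) + tau n * Lag H x v) /\
    xs (N n) = x /\
    (forall k, (k < N n)%nat -> Rabs (ps (S k)) <= P0 /\
       xs k = xs (S k) - tau n * Hp (xs (S k)) (ps (S k)) /\
       U (S k) (xs (S k)) = U k (xs k) + tau n * Lag H (xs (S k)) (Hp (xs (S k)) (ps (S k)))) /\
    (forall k, (S k < N n)%nat -> ps (S (S k)) = ps (S k) - tau n * Hx (xs (S k)) (ps (S k)))).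
  assert (D : forall n, exists z, spec n z).
  { intros n; destruct (hd f (tau n) hf (tau_pos n)) as [U [h1 [h2 h3]]].
    destruct (h3 (N n) x) as [xs [ps h4]]; exists (U, (xs, ps)); unfold spec; simpl; tauto. }
  set (Z := fun n => proj1_sig (constructive_indefinite_description _ (D n))).
  assert (D3 : forall n, spec n (Z n)).
  { intros n; unfold Z; destruct (constructive_indefinite_description _ (D n)); auto. }
  set (UU := fun n => fst (Z n)); set (XX := fun n => fst (snd (Z n))); set (PP := fun n => snd (snd (Z n))).
  destruct (bounded_cluster_point (fun n => PP n (N n)) P0) as [pb [hpb acc]].
  { intros n; destruct (D3 n) as (_ & _ & _ & h & _); apply (h (n + N0)%nat); unfold N; lia. }
  destruct (flow_exists _ _ _ HH t x pb) as (q & p & hs & hqt & hpt).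
  assert (hb1 : forall s, Rabs (p s) <= P).
  { intros s; apply Rle_trans with P1; [|unfold P; lra].
    apply (hbd q p t); auto; now rewrite hpt. }
  exists q, p; split; [exact hs|]; split; [exact hqt|]; split; [exact hb1|].
  intros ga a [Ca [hCa hadm]] hga.
  set (A0 := exp (La * T)).
  (* [low] bounds the action of the characteristic by the discrete value; [up] bounds the discrete
     value by the admissible curve sampled on the grid. The errors come from sampling ([Ca]), from
     quadrature and Euler steps ([CA], [B]), and from the displaced starting point seen by [f]
     ([K]). *)
  assert (main : forall n, f (q 0) + Act H Hp q p t <= f (ga 0) + a t - a 0 +
    (T * (Ca * tau n) + T * (B * (A0 * (Rabs (PP n (N n) - pb) + La * T * tau n)) + CA * tau n)
     + Rabs K * (A0 * (Rabs (PP n (N n) - pb) + La * T * tau n)))).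
  { intros n; pose proof (D3 n) as sp; unfold spec in sp; fold (UU n) (XX n) (PP n) in sp.
    destruct sp as (U0 & Um & Xn & St & El).
    pose proof (tau_pos n) as tn; pose proof (Ntau n) as nt.
    destruct (hee q p (XX n) (PP n) (N n) (tau n) hs hb1 (proj1 tn) ltac:(lra)) as [e1 e2].
    { intros k hk; destruct (St k hk) as (b & c & _); split; auto; unfold P; lra. }
    { exact El. }
    rewrite nt, Xn, hqt, hpt, Rminus_diag, Rabs_R0, Rplus_0_l in e1, e2; fold A0 in e1, e2.
    set (E := A0 * (Rabs (PP n (N n) - pb) + La * T * tau n)) in *.
    assert (E0 : 0 <= E) by (specialize (e1 O ltac:(lia)); eapply Rle_trans; [apply Rabs_pos | exact e1]).
    assert (low : forall k, (k <= N n)%nat ->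
      Act H Hp q p (INR k * tau n) <= UU n k (XX n k) - f (XX n O) + INR k * (tau n * (B * E) + CA * (tau n * tau n))).
    { induction k as [|k IH]; intros hk.
      - simpl; rewrite !Rmult_0_l, Act_0, U0; lra.
      - specialize (IH ltac:(lia)); destruct (St k ltac:(lia)) as (b & _ & ->).
        specialize (e2 k ltac:(lia)); rewrite (Lag_eq _ _ _ HH).
        rewrite S_INR in e2 |- *; replace ((INR k + 1) * tau n) with (INR k * tau n + tau n) in e2 |- * by ring.
        pose proof (hinc q p (INR k * tau n) (tau n) hs hb1 ltac:(lra)) as i; apply Rabs_le_between in i.
        set (s := INR k * tau n + tau n) in *.
        pose proof (hb (q s) (XX n (S k)) (p s) (PP n (S k)) (hb1 s) ltac:(unfold P; lra)) as l.
        rewrite (Rabs_minus_sym (q s)), (Rabs_minus_sym (p s)) in l.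
        apply Rabs_le_between in l.
        set (l1 := p s * Hp (q s) (p s) - H (q s) (p s)) in *.
        set (l2 := PP n (S k) * Hp (XX n (S k)) (PP n (S k)) - H (XX n (S k)) (PP n (S k))) in *.
        assert (B * (Rabs (XX n (S k) - q s) + Rabs (PP n (S k) - p s)) <= B * E)
          by (apply Rmult_le_compat_l; auto).
        assert (tau n * l1 <= tau n * (l2 + B * E)) by (apply Rmult_le_compat_l; lra).
        lra. }
    assert (up : forall k, (k <= N n)%nat ->
      UU n k (ga (INR k * tau n)) <= f (ga 0) + a (INR k * tau n) - a 0 + INR k * (Ca * (tau n * tau n))).
    { induction k as [|k IH]; intros hk.
      - simpl; rewrite !Rmult_0_l, U0; lra.
      - specialize (IH ltac:(lia)).
        rewrite S_INR; replace ((INR k + 1) * tau n) with (INR k * tau n + tau n) by ring.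
        set (r := INR k * tau n) in *; set (s := r + tau n).
        assert (r0 : 0 <= r) by (unfold r; pose proof (pos_INR k); nra).
        assert (st : s <= t).
        { rewrite <- nt; unfold s, r; replace (INR k * tau n + tau n) with (INR (S k) * tau n) by (rewrite S_INR; ring).
          apply Rmult_le_compat_r; [lra | now apply le_INR]. }
        destruct (hadm r s r0 ltac:(unfold s; lra) st) as [_ ad].
        replace (s - r) with (tau n) in ad by (unfold s; ring).
        pose proof (Um k (ga s) ((ga s - ga r) / tau n)) as m.
        replace (ga s - tau n * ((ga s - ga r) / tau n)) with (ga r) in m by (field; lra).
        lra. }
    specialize (low (N n) (le_n _)); specialize (up (N n) (le_n _)).
    rewrite nt in low, up; rewrite hga in up; rewrite Xn in low.
    pose proof (hf (q 0) (XX n O)) as hf0; apply Rabs_le_between in hf0.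
    specialize (e1 O ltac:(lia)); simpl (INR 0) in e1; rewrite Rmult_0_l, Rabs_minus_sym in e1.
    assert (K * Rabs (q 0 - XX n O) <= Rabs K * E).
    { eapply Rle_trans; [apply RRle_abs|]; rewrite Rabs_mult, Rabs_Rabsolu.
      apply Rmult_le_compat_l; auto; apply Rabs_pos. }
    assert (INR (N n) * (Ca * (tau n * tau n)) <= T * (Ca * tau n)).
    { replace (INR (N n) * (Ca * (tau n * tau n))) with (INR (N n) * tau n * (Ca * tau n)) by ring.
      rewrite nt; apply Rmult_le_compat_r; [apply Rmult_le_pos; lra | lra]. }
    assert (INR (N n) * (tau n * (B * E) + CA * (tau n * tau n)) <= T * (B * E + CA * tau n)).
    { replace (INR (N n) * (tau n * (B * E) + CA * (tau n * tau n)))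
        with (INR (N n) * tau n * (B * E + CA * tau n)) by ring.
      rewrite nt; apply Rmult_le_compat_r; [|lra].
      apply Rplus_le_le_0_compat; apply Rmult_le_pos; lra. }
    lra. }
  apply le_epsilon; intros eps he.
  (* [M1] collects the coefficients of [tau n], and [M2] those of the distance to the cluster point
     [pb]. *)
  set (M1 := T * Ca + T * (B * (A0 * (La * T)) + CA) + Rabs K * (A0 * (La * T)) + 1).
  set (M2 := T * B * A0 + Rabs K * A0 + 1).
  assert (A0p : 0 < A0) by apply exp_pos.
  assert (hM1 : 0 < M1).
  { pose proof (Rabs_pos K).
    assert (0 <= T * Ca) by (apply Rmult_le_pos; lra).
    assert (0 <= A0 * (La * T)) by (repeat apply Rmult_le_pos; lra).
    assert (0 <= T * (B * (A0 * (La * T)) + CA)) by (apply Rmult_le_pos; [lra|]; apply Rplus_le_le_0_compat; auto; apply Rmult_le_pos; lra).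
    assert (0 <= Rabs K * (A0 * (La * T))) by (apply Rmult_le_pos; lra).
    unfold M1; lra. }
  assert (hM2 : 0 < M2).
  { pose proof (Rabs_pos K).
    assert (0 <= T * B * A0) by (repeat apply Rmult_le_pos; lra).
    assert (0 <= Rabs K * A0) by (apply Rmult_le_pos; lra).
    unfold M2; lra. }
  destruct (archimed (2 * M1 * t / eps)) as [w1 _].
  destruct (acc (eps / (2 * M2)) (Z.to_nat (Z.max 0 (up (2 * M1 * t / eps))))) as [n [hn hpn]];
    [apply Rdiv_lt_0_compat; lra|].
  specialize (main n).
  assert (t1 : tau n * M1 <= eps / 2).
  { assert (hw : 2 * M1 * t / eps <= INR (N n)).
    { apply Rle_trans with (INR n); [|apply le_INR; unfold N; lia].
      apply Rle_trans with (INR (Z.to_nat (Z.max 0 (up (2 * M1 * t / eps))))); [|now apply le_INR].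
      rewrite INR_IZR_INZ, Z2Nat.id by lia.
      apply Rle_trans with (IZR (up (2 * M1 * t / eps))); [lra | apply IZR_le; lia]. }
    unfold tau; apply Rmult_le_reg_r with (INR (N n) * 2 / eps).
    { apply Rdiv_lt_0_compat; auto; specialize (Npos n); lra. }
    replace (t / INR (N n) * M1 * (INR (N n) * 2 / eps)) with (2 * M1 * t / eps)
      by (field; specialize (Npos n); lra).
    replace (eps / 2 * (INR (N n) * 2 / eps)) with (INR (N n)) by (field; lra); exact hw. }
  assert (t2 : Rabs (PP n (N n) - pb) * M2 <= eps / 2).
  { apply Rlt_le, Rlt_le_trans with (eps / (2 * M2) * M2); [apply Rmult_lt_compat_r; auto|].
    right; field; lra. }
  set (z := Rabs (PP n (N n) - pb)) in *.
  assert (0 <= z) by apply Rabs_pos.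
  destruct (tau_pos n).
  eapply Rle_trans; [exact main|]; apply Rplus_le_compat_l.
  apply Rle_trans with (tau n * M1 + z * M2); [|lra].
  unfold M1, M2; lra.
Qed.

End TonelliTheorem.

(** * The value function *)

Lemma Ck1_chain (phi : R -> R -> R) (ga : R -> R) (t dg : R) : Ck 1 phi -> is_derive ga t dg ->
  is_derive (fun s => phi s (ga s)) t (d1 phi t (ga t) + d2 phi t (ga t) * dg).
Proof.
  intros hphi hg.
  pose proof hphi as [_ [_ [c1 _]]]; simpl in c1.
  apply is_derive_eq with (d1 phi t (ga t) * 1 + d2 phi t (ga t) * dg); [|ring].
  apply is_derive_Reals, (derivable_pt_lim_comp_2d phi (fun s => s) ga t).
  - apply filterdiff_differentiable_pt_lim.
    apply (is_derive_filterdiff phi t (ga t) (d1 phi) (d2 phi t (ga t))).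
    + apply filter_forall; intros u; now apply d1_is_derive with O.
    + now apply d2_is_derive with O.
    + apply (proj1 (continuity_2d_pt_filterlim (d1 phi) t (ga t)) (c1 t (ga t))).
  - apply derivable_pt_lim_id.
  - now apply is_derive_Reals.
Qed.

(** One-sided, because dynamic programming compares a point with earlier times only. *)
Lemma left_derivative_le (f : R -> R) (t l c r : R) : is_derive f t l -> 0 < r ->
  (forall s, t - r < s < t -> f t - f s <= c * (t - s)) -> l <= c.
Proof.
  intros h hr hc; apply le_epsilon; intros eps he.
  apply is_derive_Reals in h; destruct (h eps he) as [d hd].
  set (k := Rmin (d / 2) (r / 2)).
  assert (k1 : k <= d / 2) by apply Rmin_l; assert (k2 : k <= r / 2) by apply Rmin_r.
  pose proof (cond_pos d); assert (k0 : 0 < k) by (apply Rmin_glb_lt; lra).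
  specialize (hd (- k) ltac:(lra) ltac:(rewrite Rabs_left; lra)).
  specialize (hc (t + - k) ltac:(lra)).
  apply Rabs_def2 in hd; replace (t - (t + - k)) with k in hc by ring.
  assert ((f (t + - k) - f t) / - k <= c).
  { apply Rmult_le_reg_r with k; auto.
    replace ((f (t + - k) - f t) / - k * k) with (f t - f (t + - k)) by (field; lra); lra. }
  lra.
Qed.

Section Value.

Variables H Hx Hp : R -> R -> R.
Hypothesis HH : Ham H Hx Hp.

(** Only chords across the junction need an argument: convexity splits such a chord at time [s]. *)
Lemma Adm_concatenation (ga1 a1 ga2 a2 : R -> R) (s t : R) : 0 <= s <= t ->
  Adm (Lag H) ga1 a1 0 s -> Adm (Lag H) ga2 a2 s t -> ga1 s = ga2 s ->
  Adm (Lag H) (fun r => if Rle_dec r s then ga1 r else ga2 r)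
    (fun r => if Rle_dec r s then a1 r else a1 s + a2 r - a2 s) 0 t.
Proof.
  intros hst [C1 [h1 k1]] [C2 [h2 k2]] e.
  destruct (Lag_Lipschitz _ _ _ HH C1) as [C [hC hL]].
  exists (C1 + C2 + C * C2); split; [nra|]; intros r u hr hru hu.
  assert (cc : 0 <= C * C2) by nra.
  assert (sq : 0 <= (u - r) * (u - r)) by nra.
  destruct (Rle_dec r s) as [l|l]; destruct (Rle_dec u s) as [m|m].
  - destruct (k1 r u hr hru m) as [x y]; split; [eapply Rle_trans; [exact x | nra]|].
    eapply Rle_trans; [exact y|]; nra.
  - destruct (Req_dec r s) as [->|n].
    { rewrite e; destruct (k2 s u ltac:(lra) hru hu) as [x y]; split; [eapply Rle_trans; [exact x | nra]|].
      eapply Rle_trans; [exact y|]; nra. }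
    destruct (k1 r s hr ltac:(lra) ltac:(lra)) as [x1 y1].
    destruct (k2 s u ltac:(lra) ltac:(lra) hu) as [x2 y2].
    rewrite e in x1, y1.
    split.
    + replace (ga2 u - ga1 r) with ((ga2 u - ga2 s) + (ga2 s - ga1 r)) by ring.
      eapply Rle_trans; [apply Rabs_triang|].
      assert (0 <= C1 * (u - s)) by nra; assert (0 <= C2 * (s - r)) by nra.
      assert (0 <= C * C2 * (u - r)) by nra; lra.
    (* Both pieces come out with the cost at [ga2 u]; moving the base point of the first one to
       [ga2 s] costs a multiple of [(u - s) * (s - r)], hence is of second order. *)
    + pose proof (Lag_convex _ _ _ HH (ga2 u) (ga2 u - ga2 s) (ga2 s - ga1 r) (u - s) (s - r)
        ltac:(lra) ltac:(lra)) as cv.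
      replace (u - s + (s - r)) with (u - r) in cv by ring.
      replace (ga2 u - ga2 s + (ga2 s - ga1 r)) with (ga2 u - ga1 r) in cv by ring.
      assert (bw : Rabs ((ga2 s - ga1 r) / (s - r)) <= C1).
      { apply Rabs_div_le; lra. }
      pose proof (hL (ga2 u) (ga2 s) _ _ bw bw) as lp.
      rewrite (Rminus_diag ((ga2 s - ga1 r) / (s - r))), Rabs_R0, Rplus_0_r in lp.
      apply Rabs_le_between in lp.
      assert (C * Rabs (ga2 u - ga2 s) <= C * (C2 * (u - s))) by (apply Rmult_le_compat_l; auto).
      assert (m1 : (s - r) * Lag H (ga2 u) ((ga2 s - ga1 r) / (s - r)) <=
        (s - r) * (Lag H (ga2 s) ((ga2 s - ga1 r) / (s - r)) + C * (C2 * (u - s))))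
        by (apply Rmult_le_compat_l; lra).
      assert (0 <= C1 * ((u - r) * (u - r) - (s - r) * (s - r))) by (apply Rmult_le_pos; nra).
      assert (0 <= C2 * ((u - r) * (u - r) - (u - s) * (u - s))) by (apply Rmult_le_pos; nra).
      assert (0 <= C * C2 * ((u - r) * (u - r) - (s - r) * (u - s))) by (apply Rmult_le_pos; nra).
      lra.
  - exfalso; lra.
  - destruct (k2 r u ltac:(lra) hru hu) as [x y]; split; [eapply Rle_trans; [exact x | nra]|].
    eapply Rle_trans; [exact y|]; nra.
Qed.

Lemma Adm_line (x v c s t : R) : s <= t ->
  (forall r, s <= r <= t -> Lag H (x + v * (r - t)) v <= c) ->
  Adm (Lag H) (fun r => x + v * (r - t)) (fun r => c * r) s t.
Proof.
  intros hst hc; apply (Adm_C1 _ _ _ HH _ _ (fun _ => v) (fun _ => c) s t (Rabs v)); auto.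
  - intros; dvf; ring.
  - intros; dvf; ring.
  - intros; apply Rle_refl.
Qed.

Section ValueFunction.

Variables (K T P : R) (f : R -> R) (V : R -> R -> R).
Hypothesis hK : 0 <= K.
Hypothesis hT : 0 < T.
Hypothesis hf : LipK K f.
Hypothesis V_attained : forall t x, 0 <= t <= T -> exists q p, HSol Hx Hp q p /\ q t = x /\
  (forall s, Rabs (p s) <= P) /\ V t x = f (q 0) + Act H Hp q p t.
Hypothesis V_minimal : forall t ga a, 0 <= t <= T -> Adm (Lag H) ga a 0 t ->
  V t (ga t) <= f (ga 0) + a t - a 0.

Lemma value_HSol (q p : R -> R) (t : R) : HSol Hx Hp q p -> 0 <= t <= T ->
  V t (q t) <= f (q 0) + Act H Hp q p t.
Proof.
  intros h ht; destruct (HSol_bounded _ _ _ HH (Rabs (p 0))) as [P' [_ hb]].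
  pose proof (V_minimal t q (Act H Hp q p) ht) as m; rewrite Act_0, Rminus_0_r in m.
  apply m, (Adm_HSol _ _ _ HH) with P'; auto; intros s; apply (hb q p 0); auto; lra.
Qed.

Lemma value_dynamic_programming (ga a : R -> R) (s t : R) : 0 <= s <= t -> t <= T ->
  Adm (Lag H) ga a s t -> V t (ga t) <= V s (ga s) + a t - a s.
Proof.
  intros hs ht hA.
  destruct (V_attained s (ga s) ltac:(lra)) as (q & p & h & e & hb & ->).
  pose proof (Adm_concatenation q (Act H Hp q p) ga a s t hs (Adm_HSol _ _ _ HH q p 0 s P h hb) hA e) as C.
  apply V_minimal in C; [|lra].
  destruct (Rle_dec 0 s) as [l|l]; [|lra]; rewrite Act_0 in C.
  destruct (Rle_dec t s) as [m|m]; [|lra].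
  replace t with s by lra; rewrite <- e.
  pose proof (value_HSol q p s h ltac:(lra)); lra.
Qed.

(** Translating a minimizer by [d] changes its cost at a rate of at most [C * |d|], since its
    velocity is bounded by [A]. *)
Lemma value_Lipschitz_space : exists C, 0 <= C /\ forall t x y, 0 <= t <= T ->
  Rabs (V t x - V t y) <= C * Rabs (x - y).
Proof.
  destruct (ham_loc _ _ _ HH P) as [A [hA ha]].
  destruct (Lag_Lipschitz _ _ _ HH A) as [C [hC hL]].
  exists (K + C * T); split; [nra|].
  assert (G : forall t x y, 0 <= t <= T -> V t x - V t y <= (K + C * T) * Rabs (x - y)).
  { intros t x y ht; destruct (V_attained t y ht) as (q & p & h & e & hb & ->).
    set (d := x - y).
    pose proof (V_minimal t (fun r => q r + d) (fun r => Act H Hp q p r + C * Rabs d * r) ht) as m.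
    cbv beta in m; rewrite Act_0, e in m; replace (y + d) with x in m by (unfold d; ring).
    pose proof (hf (q 0 + d) (q 0)) as l; replace (q 0 + d - q 0) with d in l by ring.
    apply Rabs_le_between in l.
    assert (C * Rabs d * t <= C * Rabs d * T)
      by (apply Rmult_le_compat_l; [apply Rmult_le_pos; auto; apply Rabs_pos | lra]).
    enough (V t x <= f (q 0 + d) + (Act H Hp q p t + C * Rabs d * t) - (0 + C * Rabs d * 0)) by lra.
    apply m, (Adm_C1 _ _ _ HH _ _ (fun s => Hp (q s) (p s))
      (fun s => p s * Hp (q s) (p s) - H (q s) (p s) + C * Rabs d) 0 t A).
    - intros r _; destruct (h r); dvf; ring.
    - intros r _; pose proof (Act_derive _ _ _ HH q p r h); dvf; ring.
    - intros r _; now apply ha.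
    - intros r _; rewrite <- (Lag_eq _ _ _ HH).
      assert (b : Rabs (Hp (q r) (p r)) <= A) by now apply ha.
      pose proof (hL (q r + d) (q r) _ _ b b) as k.
      rewrite (Rminus_diag (Hp (q r) (p r))), Rabs_R0, Rplus_0_r in k.
      replace (q r + d - q r) with d in k by ring; apply Rabs_le_between in k; lra. }
  intros t x y ht; pose proof (G t x y ht); pose proof (G t y x ht) as g.
  rewrite Rabs_minus_sym in g; apply Rabs_le_between; lra.
Qed.

(** In time, the upper bound comes from staying at rest and the lower one from following the
    minimizer back to the earlier time. *)
Lemma value_Lipschitz : Lipschitz_strip T V.
Proof.
  destruct value_Lipschitz_space as [A [hA ha]].
  destruct (Lag_bounded _ _ _ HH 0) as [B [hB hb]].
  destruct (ham_loc _ _ _ HH P) as [C [hC hc]].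
  set (C2 := B + A * C + (Rabs P * C + C)).
  pose proof (Rabs_pos P).
  assert (C20 : 0 <= C2) by (unfold C2; nra).
  assert (tm : forall s t y, 0 <= s <= t -> t <= T -> Rabs (V t y - V s y) <= C2 * (t - s)).
  { intros s t y hs ht; apply Rabs_le_between; split.
    - destruct (V_attained t y ltac:(lra)) as (q & p & h & e & b & ->).
      pose proof (value_HSol q p s h ltac:(lra)) as v.
      pose proof (ha s (q s) y ltac:(lra)) as l; apply Rabs_le_between in l.
      assert (dq : Rabs (q s - y) <= C * (t - s)).
      { rewrite <- e, Rabs_minus_sym, <- (Rabs_right (t - s)) by lra.
        apply (derive_Lipschitz q (fun s => Hp (q s) (p s))); intros; [apply h | now apply hc]. }
      pose proof (derive_ge (Act H Hp q p) (fun s => p s * Hp (q s) (p s) - H (q s) (p s))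
        (- (Rabs P * C + C)) s t ltac:(lra)) as da.
      assert (da' : - (Rabs P * C + C) * (t - s) <= Act H Hp q p t - Act H Hp q p s).
      { apply da; intros u _; [exact (Act_derive _ _ _ HH q p u h)|].
        destruct (hc (q u) (p u) (b u)) as (c1 & _ & c2 & _); apply Rabs_le_between in c1.
        assert (Rabs (p u * Hp (q u) (p u)) <= Rabs P * C).
        { rewrite Rabs_mult; apply Rmult_le_compat; auto; try apply Rabs_pos.
          apply Rle_trans with P; auto; apply RRle_abs. }
        apply Rabs_le_between in H1; lra. }
      assert (A * Rabs (q s - y) <= A * (C * (t - s))) by (apply Rmult_le_compat_l; auto).
      assert (0 <= B * (t - s)) by nra.
      unfold C2; lra.
    - pose proof (value_dynamic_programming (fun r => y + 0 * (r - t)) (fun r => B * r) s t hs ht) as d.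
      cbv beta in d; rewrite !Rmult_0_l, Rplus_0_r in d.
      enough (V t y <= V s y + B * t - B * s).
      { assert (0 <= (A * C + (Rabs P * C + C)) * (t - s)) by (apply Rmult_le_pos; nra).
        unfold C2; lra. }
      apply d; apply Adm_line; [lra|]; intros r _.
      pose proof (hb (y + 0 * (r - t)) 0 ltac:(rewrite Rabs_R0; lra)) as k.
      apply Rabs_le_between in k; lra. }
  exists (A + C2); intros s t x y hs ht.
  assert (tm' : Rabs (V s y - V t y) <= C2 * Rabs (s - t)).
  { destruct (Rle_dec s t).
    - rewrite Rabs_minus_sym, (Rabs_left1 (s - t)) by lra; replace (- (s - t)) with (t - s) by ring.
      apply tm; lra.
    - rewrite (Rabs_right (s - t)) by lra; apply tm; lra. }
  pose proof (ha s x y hs).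
  replace (V s x - V t y) with ((V s x - V s y) + (V s y - V t y)) by ring.
  eapply Rle_trans; [apply Rabs_triang|].
  pose proof (Rabs_pos (s - t)); pose proof (Rabs_pos (x - y)); nra.
Qed.

Lemma value_initial (x : R) : V 0 x = f x.
Proof.
  destruct (V_attained 0 x ltac:(lra)) as (q & p & h & e & _ & ->); rewrite Act_0, e; ring.
Qed.

(** Subsolution: dynamic programming along the straight line whose velocity [v] is conjugate to the
    slope of the test function, where Young's inequality is an equality. Supersolution: follow a
    minimizer backwards and use convexity of [H]. *)
Theorem value_viscosity_solution : visc_sol H T f V.
Proof.
  destruct value_Lipschitz as [C hC].
  split; [|split; [exact value_initial | split]].
  - intros t x ht eps he.
    assert (hd : 0 < eps / (2 * (Rabs C + 1))) by (pose proof (Rabs_pos C); apply Rdiv_lt_0_compat; lra).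
    exists (eps / (2 * (Rabs C + 1))); split; [exact hd|]; intros s y hs h1 h2.
    eapply Rle_lt_trans; [apply hC; auto|].
    set (d := eps / (2 * (Rabs C + 1))) in *.
    assert (ed : eps = (Rabs C + 1) * (d + d)) by (unfold d; field; pose proof (Rabs_pos C); lra).
    pose proof (RRle_abs C); pose proof (Rabs_pos C); pose proof (Rabs_pos (s - t)); pose proof (Rabs_pos (y - x)).
    rewrite ed; apply Rle_lt_trans with ((Rabs C + 1) * (Rabs (s - t) + Rabs (y - x))); [|nra].
    apply Rmult_le_compat_r; lra.
  - intros phi t0 x0 hphi ht0 [r [hr hmax]].
    set (p := d2 phi t0 x0); set (v := Hp x0 p).
    assert (gl : d1 phi t0 x0 + p * v <= Lag H x0 v).
    { apply le_epsilon; intros eta heta.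
      destruct (Lag_Lipschitz _ _ _ HH (Rabs v)) as [A [hA hL]].
      set (ga := fun s => x0 + v * (s - t0)).
      assert (eg : ga t0 = x0) by (unfold ga; ring).
      assert (dg : is_derive ga t0 v) by (unfold ga; dvf; ring).
      pose proof (Ck1_chain phi ga t0 v hphi dg) as dphi; rewrite eg in dphi; fold p in dphi.
      set (M := Rabs v + 1); pose proof (Rabs_pos v).
      set (k := Rmin (Rmin (r / M) t0) (eta / ((A + 1) * M))).
      assert (M0 : 1 <= M) by (unfold M; lra).
      assert (A0 : 0 < (A + 1) * M) by nra.
      assert (k0 : 0 < k).
      { repeat apply Rmin_glb_lt; try lra; apply Rdiv_lt_0_compat; lra. }
      assert (k1 : k <= r / M) by (eapply Rle_trans; [apply Rmin_l | apply Rmin_l]).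
      assert (k2 : k <= t0) by (eapply Rle_trans; [apply Rmin_l | apply Rmin_r]).
      assert (k3 : k <= eta / ((A + 1) * M)) by apply Rmin_r.
      apply Rmult_le_compat_r with (r := M) in k1; [|lra].
      replace (r / M * M) with r in k1 by (field; lra).
      apply Rmult_le_compat_r with (r := (A + 1) * M) in k3; [|lra].
      replace (eta / ((A + 1) * M) * ((A + 1) * M)) with eta in k3 by (field; lra).
      assert (near : forall s, t0 - k < s < t0 -> Rabs (ga s - x0) < r /\ A * Rabs (ga s - x0) <= eta).
      { intros s hs; replace (ga s - x0) with (v * (s - t0)) by (unfold ga; ring).
        rewrite Rabs_mult, (Rabs_left (s - t0)) by lra.
        assert (hk : Rabs v * - (s - t0) <= Rabs v * k) by (apply Rmult_le_compat_l; lra).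
        split; [unfold M in *; lra|].
        apply Rle_trans with (A * (Rabs v * k)); [apply Rmult_le_compat_l; lra|].
        assert (0 <= A * k) by nra; unfold M in *; nra. }
      apply (left_derivative_le (fun s => phi s (ga s)) t0 _ _ k dphi k0).
      intros s hs; rewrite eg; destruct (near s hs) as [n1 n2].
      specialize (hmax s (ga s) ltac:(lra)).
      assert (m1 : 1 * k <= M * k) by (apply Rmult_le_compat_r; lra).
      specialize (hmax ltac:(rewrite Rabs_left; lra) n1).
      pose proof (value_dynamic_programming ga (fun u => (Lag H x0 v + eta) * u) s t0 ltac:(lra) ltac:(lra)) as dp.
      rewrite eg in dp; cbv beta in dp.
      enough (V t0 x0 <= V s (ga s) + (Lag H x0 v + eta) * t0 - (Lag H x0 v + eta) * s) by lra.
      apply dp; apply Adm_line; [lra|]; intros u hu.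
      fold (ga u); pose proof (hL (ga u) x0 v v (Rle_refl _) (Rle_refl _)) as l.
      rewrite (Rminus_diag v), Rabs_R0, Rplus_0_r in l; apply Rabs_le_between in l.
      destruct (Req_dec u t0) as [->|n].
      - rewrite eg, Rminus_diag, Rabs_R0, Rmult_0_r in l; rewrite eg; lra.
      - destruct (near u ltac:(lra)); lra. }
    unfold v in gl; rewrite (Lag_eq _ _ _ HH) in gl; lra.
  - intros phi t0 x0 hphi ht0 [r [hr hmin]].
    destruct (V_attained t0 x0 ltac:(lra)) as (q & p & h & e & hb & ev).
    pose proof (Ck1_chain phi q t0 _ hphi (proj1 (h t0))) as dphi; rewrite e in dphi.
    pose proof (Act_derive _ _ _ HH q p t0 h) as da; rewrite e in da.
    destruct (proj1 (continuity_eps q t0) (proj1 (HSol_continuity _ _ q p h) t0) r hr) as [d [hd hq]].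
    rewrite e in hq.
    set (k := Rmin (Rmin d r) t0).
    assert (k0 : 0 < k) by (repeat apply Rmin_glb_lt; lra).
    assert (k1 : k <= d) by (eapply Rle_trans; [apply Rmin_l | apply Rmin_l]).
    assert (k2 : k <= r) by (eapply Rle_trans; [apply Rmin_l | apply Rmin_r]).
    assert (k3 : k <= t0) by apply Rmin_r.
    assert (G : (p t0 * Hp x0 (p t0) - H x0 (p t0)) - (d1 phi t0 x0 + d2 phi t0 x0 * Hp x0 (p t0)) <= 0).
    { apply (left_derivative_le (fun s => Act H Hp q p s - phi s (q s)) t0 _ 0 k); auto.
      - now apply D_minus.
      - intros s hs; rewrite e.
        specialize (hmin s (q s) ltac:(lra) ltac:(rewrite Rabs_left; lra)
          (hq s ltac:(rewrite Rabs_left; lra))).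
        pose proof (value_HSol q p s h ltac:(lra)); lra. }
    pose proof (ham_convex _ _ _ HH x0 (p t0) (d2 phi t0 x0)); lra.
Qed.

End ValueFunction.

Theorem value_function (K T : R) : 0 < T -> exists P, 0 <= P /\ forall f, LipK K f ->
  exists V : R -> R -> R,
    (forall t x, 0 <= t <= T -> exists q p, HSol Hx Hp q p /\ q t = x /\
      (forall s, Rabs (p s) <= P) /\ V t x = f (q 0) + Act H Hp q p t) /\
    (forall t ga a, 0 <= t <= T -> Adm (Lag H) ga a 0 t -> V t (ga t) <= f (ga 0) + a t - a 0).
Proof.
  intros hT; destruct (tonelli _ _ _ HH K T hT) as [P [hP h]]; exists P; split; [exact hP|].
  intros f hf; specialize (h f hf).
  assert (D : forall t x, exists v, 0 <= t <= T -> exists q p, HSol Hx Hp q p /\ q t = x /\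
    (forall s, Rabs (p s) <= P) /\ v = f (q 0) + Act H Hp q p t /\
    forall ga a, Adm (Lag H) ga a 0 t -> ga t = x -> v <= f (ga 0) + a t - a 0).
  { intros t x; destruct (classic (0 <= t <= T)) as [c|c]; [|now exists 0].
    destruct (h t x c) as (q & p & h1 & h2 & h3 & h4).
    exists (f (q 0) + Act H Hp q p t); intros _; exists q, p; auto. }
  set (V := fun t x => proj1_sig (constructive_indefinite_description _ (D t x))).
  assert (HV : forall t x, 0 <= t <= T -> exists q p, HSol Hx Hp q p /\ q t = x /\
    (forall s, Rabs (p s) <= P) /\ V t x = f (q 0) + Act H Hp q p t /\
    forall ga a, Adm (Lag H) ga a 0 t -> ga t = x -> V t x <= f (ga 0) + a t - a 0).
  { intros t x; unfold V; destruct (constructive_indefinite_description _ (D t x)); auto. }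
  exists V; split.
  - intros t x ht; destruct (HV t x ht) as (q & p & h1 & h2 & h3 & h4 & _); exists q, p; auto.
  - intros t ga a ht hA; destruct (HV t (ga t) ht) as (_ & _ & _ & _ & _ & _ & m); now apply m.
Qed.

End Value.

(** * Subsolutions along curves *)

(** Extends functions on the strip to all times, so that maxima over a box can rely on continuity on
    the whole plane. *)
Definition clip (T s : R) : R := Rmax 0 (Rmin T s).

Lemma clip_id (T s : R) : 0 <= s <= T -> clip T s = s.
Proof. intros h; unfold clip, Rmax, Rmin; repeat destruct Rle_dec; lra. Qed.

Lemma clip_range (T s : R) : 0 <= T -> 0 <= clip T s <= T.
Proof. intros h; unfold clip, Rmax, Rmin; repeat destruct Rle_dec; lra. Qed.

Lemma clip_Lipschitz (T s t : R) : 0 <= T -> Rabs (clip T s - clip T t) <= Rabs (s - t).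
Proof.
  intros h; unfold clip, Rmax, Rmin; repeat destruct Rle_dec; unfold Rabs; repeat destruct Rcase_abs; lra.
Qed.

Lemma Lipschitz_strip_continuity (T : R) (U : R -> R -> R) : 0 <= T -> Lipschitz_strip T U ->
  forall s z, continuity_2d_pt (fun s z => U (clip T s) z) s z.
Proof.
  intros hT [K hK] s z; apply (Lipschitz_continuity_2d _ (Rabs K)); intros u v _ _.
  eapply Rle_trans; [apply hK; now apply clip_range|].
  pose proof (clip_Lipschitz T u s hT); pose proof (Rabs_pos (clip T u - clip T s)).
  pose proof (Rabs_pos (v - z)); pose proof (RRle_abs K); pose proof (Rabs_pos K).
  apply Rle_trans with (Rabs K * (Rabs (clip T u - clip T s) + Rabs (v - z)));
    [apply Rmult_le_compat_r; lra | apply Rmult_le_compat_l; lra].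
Qed.

Lemma Lipschitz_strip_nonneg (T : R) (U : R -> R -> R) : Lipschitz_strip T U ->
  exists K, 0 <= K /\ forall s t x y, 0 <= s <= T -> 0 <= t <= T ->
    Rabs (U s x - U t y) <= K * (Rabs (s - t) + Rabs (x - y)).
Proof.
  intros [K hK]; exists (Rabs K); split; [apply Rabs_pos|]; intros s t x y hs ht.
  eapply Rle_trans; [now apply hK|].
  apply Rmult_le_compat_r; [|apply RRle_abs].
  pose proof (Rabs_pos (s - t)); pose proof (Rabs_pos (x - y)); lra.
Qed.

(* A C^1 penalty forcing extrema away from the final time. *)
Definition ramp (b s : R) : R := Rmax 0 (s - b) * Rmax 0 (s - b).

Lemma ramp_derive (b s : R) : is_derive (ramp b) s (2 * Rmax 0 (s - b)).
Proof.
  apply is_derive_Reals; intros eps he; exists (mkposreal eps he); simpl; intros h h0 hh.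
  assert (e : Rabs (ramp b (s + h) - ramp b s - 2 * Rmax 0 (s - b) * h) <= h * h).
  { unfold ramp, Rmax; repeat destruct Rle_dec; apply Rabs_le_between; split; nra. }
  replace ((ramp b (s + h) - ramp b s) / h - 2 * Rmax 0 (s - b))
    with ((ramp b (s + h) - ramp b s - 2 * Rmax 0 (s - b) * h) / h) by (field; auto).
  unfold Rdiv; rewrite Rabs_mult, Rabs_inv.
  pose proof (Rabs_pos_lt h h0); rewrite <- Rabs_square in e.
  apply Rle_lt_trans with (Rabs h); auto.
  apply Rmult_le_reg_r with (Rabs h); auto; rewrite Rmult_assoc, Rinv_l by lra; lra.
Qed.

Lemma ramp_derivative_continuity (b s : R) : continuity_pt (fun s => 2 * Rmax 0 (s - b)) s.
Proof.
  apply continuity_eps; intros eps he; exists (eps / 2); split; [lra|]; intros u hu.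
  apply Rle_lt_trans with (2 * Rabs (u - s)); [|lra].
  unfold Rmax; repeat destruct Rle_dec; unfold Rabs; repeat destruct Rcase_abs; lra.
Qed.

Lemma ramp_nonneg (b s : R) : 0 <= ramp b s.
Proof. unfold ramp; apply Rle_0_sqr. Qed.

Lemma ramp_zero (b s : R) : s <= b -> ramp b s = 0.
Proof. intros h; unfold ramp; rewrite Rmax_left by lra; ring. Qed.

Lemma continuity_plus_pt (f g : R -> R) (x : R) :
  continuity_pt f x -> continuity_pt g x -> continuity_pt (fun s => f s + g s) x.
Proof. intros; now apply (continuity_pt_plus f g). Qed.

Section Subsolution.

Variables H Hx Hp : R -> R -> R.
Hypothesis HH : Ham H Hx Hp.
Variables (T : R) (Uo : R -> R) (U : R -> R -> R).
Hypothesis hT : 0 < T.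
Hypothesis U_Lipschitz : Lipschitz_strip T U.
Hypothesis U_viscosity : visc_sol H T Uo U.

(** If the inequality failed, penalize the distance to the curve by [(z - ga s)^2 / ep]. At a
    maximum of the difference, the slope of the penalty is a momentum for which Young's inequality
    contradicts the subsolution inequality. *)
Theorem subsolution_along (ga a w b : R -> R) :
  (forall r, is_derive ga r (w r)) -> (forall r, is_derive a r (b r)) ->
  (forall r, continuity_pt w r) -> (forall r, continuity_pt b r) ->
  (forall r, 0 <= r <= T -> Lag H (ga r) (w r) <= b r) ->
  U T (ga T) <= U 0 (ga 0) + a T - a 0.
Proof.
  intros dga da cw cb hb; apply Rnot_lt_le; intros gap.
  destruct (Lipschitz_strip_nonneg T U U_Lipschitz) as [K [hK hL]].
  set (g := fun s => U s (ga s) - a s).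
  set (c := g T - g 0); assert (hc : 0 < c) by (unfold c, g; lra).
  assert (cga : forall r, continuity_pt ga r) by (intros r; exact (derive_continuity ga r _ (dga r))).
  assert (ca : forall r, continuity_pt a r) by (intros r; exact (derive_continuity a r _ (da r))).
  assert (hbt : exists bt, 0 < bt < T /\ g T - c / 4 <= g bt).
  { set (e := c / (16 * (K + 1))).
    assert (he : 0 < e) by (apply Rdiv_lt_0_compat; lra).
    assert (ee : (K + 1) * e = c / 16) by (unfold e; field; lra).
    destruct (proj1 (continuity_eps ga T) (cga T) e he) as [d1' [hd1 h1]].
    destruct (proj1 (continuity_eps a T) (ca T) e he) as [d2' [hd2 h2]].
    set (k := Rmin (Rmin d1' d2') (Rmin e T) / 2).
    assert (k0 : 0 < k) by (unfold k; assert (0 < Rmin (Rmin d1' d2') (Rmin e T)) by (repeat apply Rmin_glb_lt; lra); lra).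
    assert (k1 : k < d1' /\ k < d2' /\ k < e /\ k < T).
    { pose proof (Rmin_l (Rmin d1' d2') (Rmin e T)); pose proof (Rmin_r (Rmin d1' d2') (Rmin e T)).
      pose proof (Rmin_l d1' d2'); pose proof (Rmin_r d1' d2'); pose proof (Rmin_l e T); pose proof (Rmin_r e T).
      unfold k in *; lra. }
    exists (T - k); split; [lra|].
    assert (ek : Rabs (T - k - T) = k) by (rewrite Rabs_left; lra).
    specialize (h1 (T - k) ltac:(lra)); specialize (h2 (T - k) ltac:(lra)).
    pose proof (hL (T - k) T (ga (T - k)) (ga T) ltac:(lra) ltac:(lra)) as l; rewrite ek in l.
    apply Rabs_le_between in l; apply Rabs_def2 in h2.
    assert (K * (k + Rabs (ga (T - k) - ga T)) <= K * (e + e)) by (apply Rmult_le_compat_l; lra).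
    unfold g; lra. }
  destruct hbt as [bt [hbt gb]].
  (* Budget for the gap [c]: [c/4] for moving from [T] to [bt], [c/8] for the strict slope [de],
     [c/8] for the distance to the curve ([ep1]). [N] makes the ramp equal to [c] at time [T]. *)
  set (N := c / ((T - bt) * (T - bt))).
  assert (hN : 0 < N) by (apply Rdiv_lt_0_compat; nra).
  set (de := c / (8 * T)); assert (hde : 0 < de) by (apply Rdiv_lt_0_compat; lra).
  assert (deT : de * T = c / 8) by (unfold de; field; lra).
  destruct (ham_Lipschitz _ _ _ HH (2 * K)) as [C [hC hH]].
  set (ep := Rmin (c / (8 * (K * K + 1))) (de / (2 * (C * K + 1)))).
  assert (CK : 0 <= C * K) by nra; assert (KK : 0 <= K * K) by nra.
  assert (ep0 : 0 < ep) by (apply Rmin_glb_lt; apply Rdiv_lt_0_compat; lra).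
  assert (ep1 : K * K * ep <= c / 8).
  { pose proof (Rmin_l (c / (8 * (K * K + 1))) (de / (2 * (C * K + 1)))) as m; fold ep in m.
    apply Rmult_le_compat_l with (r := K * K + 1) in m; [|lra].
    replace ((K * K + 1) * (c / (8 * (K * K + 1)))) with (c / 8) in m by (field; lra); lra. }
  assert (ep2 : C * K * ep < de).
  { pose proof (Rmin_r (c / (8 * (K * K + 1))) (de / (2 * (C * K + 1)))) as m; fold ep in m.
    apply Rmult_le_compat_l with (r := C * K + 1) in m; [|lra].
    replace ((C * K + 1) * (de / (2 * (C * K + 1)))) with (de / 2) in m by (field; lra); lra. }
  destruct (continuity_ab_maj (fun s => Rabs (ga s)) 0 T) as [mx [hmx _]]; [lra| |].
  { intros s _; apply (continuity_pt_comp ga Rabs); [apply cga | apply Rcontinuity_abs]. }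
  set (RR := Rabs (ga mx) + K * ep + 1).
  assert (KE : 0 <= K * ep) by nra.
  pose proof (Rabs_pos (ga mx)) as gp.
  set (al := fun s => a s + de * s + N * ramp bt s).
  set (dal := fun s => b s + de + N * (2 * Rmax 0 (s - bt))).
  destruct (quadratic_test_function al (fun _ => 0) ga dal (fun _ => 0) w (/ ep)) as [hCk [hd1 hd2]]; auto.
  { intros s; pose proof (da s); pose proof (ramp_derive bt s); unfold al, dal; dvf; ring. }
  { intros s; apply D_const. }
  { intros s; unfold dal; apply continuity_plus_pt; [apply continuity_plus_pt; auto|].
    - apply continuity_pt_const; intros u v; reflexivity.
    - apply (continuity_pt_mult (fun _ => N)); [apply continuity_pt_const; intros u v; reflexivity
        | apply ramp_derivative_continuity]. }
  { intros s; apply continuity_pt_const; intros u v; reflexivity. }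
  set (phi := fun s z => al s + 0 * (z - ga s) + / ep * ((z - ga s) * (z - ga s))) in *.
  destruct (box_maximum (fun s z => U (clip T s) z - phi s z) 0 T (- RR) RR)
    as (s0 & z0 & hs0 & hz0 & hmax); [lra | unfold RR; lra | |].
  { intros s z; apply continuity_2d_pt_minus;
      [now apply Lipschitz_strip_continuity; try lra | exact (Ck_continuity 1 phi s z hCk)]. }
  cbv beta in hmax.
  assert (inR : forall s, 0 <= s <= T -> - RR <= ga s <= RR).
  { intros s hs; specialize (hmx s hs); apply Rabs_le_between; unfold RR; lra. }
  assert (phig : forall s, phi s (ga s) = al s) by (intros s; unfold phi; ring).
  set (y := z0 - ga s0).
  pose proof (hmax s0 (ga s0) hs0 (inR s0 hs0)) as m1.
  rewrite clip_id in m1 by lra; rewrite phig in m1.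
  pose proof (hL s0 s0 z0 (ga s0) hs0 hs0) as l1; rewrite (Rminus_diag s0), Rabs_R0, Rplus_0_l in l1.
  fold y in l1; apply Rabs_le_between in l1.
  assert (phi0 : phi s0 z0 = al s0 + / ep * (Rabs y * Rabs y)).
  { rewrite Rabs_square; unfold phi; fold y; ring. }
  rewrite phi0 in m1.
  (* Compare with the point of the curve at the same time. The slope [2 * y / ep] is then at most
     [2 * K] whatever [ep] is, which is why [C] could be fixed before [ep]. *)
  assert (hy : Rabs y <= K * ep).
  { assert (q : / ep * (Rabs y * Rabs y) <= K * Rabs y) by lra.
    apply Rmult_le_compat_l with (r := ep) in q; [|lra].
    rewrite <- Rmult_assoc, Rinv_r, Rmult_1_l in q by lra.
    destruct (Req_dec (Rabs y) 0) as [z|z]; [lra|]; pose proof (Rabs_pos y).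
    apply Rmult_le_reg_r with (Rabs y); lra. }
  assert (Ky : K * Rabs y <= c / 8).
  { apply Rle_trans with (K * (K * ep)); [apply Rmult_le_compat_l; lra | lra]. }
  pose proof (Rabs_pos y) as y0.
  assert (iy : 0 <= / ep * (Rabs y * Rabs y)).
  { apply Rmult_le_pos; [apply Rlt_le, Rinv_0_lt_compat; lra | nra]. }
  pose proof (hmax bt (ga bt) ltac:(lra) (inR bt ltac:(lra))) as m2.
  rewrite !clip_id in m2 by lra; rewrite phig, phi0 in m2.
  unfold al in m2 at 1; rewrite (ramp_zero bt bt) in m2 by lra.
  assert (de * bt <= c / 8) by (rewrite <- deT; apply Rmult_le_compat_l; lra).
  assert (low : g T - c / 4 - c / 8 <= U s0 z0 - (al s0 + / ep * (Rabs y * Rabs y))).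
  { unfold g in gb at 2; lra. }
  assert (upp : U s0 z0 <= U s0 (ga s0) + c / 8) by lra.
  destruct (Req_dec s0 0) as [e|n0].
  { subst s0; unfold al in low; rewrite (ramp_zero bt 0) in low by lra.
    assert (g 0 = U 0 (ga 0) - a 0) by reflexivity; unfold c in *; lra. }
  destruct (Req_dec s0 T) as [e|n1].
  { subst s0; unfold al in low.
    assert (N * ramp bt T = c) by (unfold N, ramp; rewrite Rmax_right by lra; field; lra).
    assert (0 < de * T) by lra.
    assert (g T = U T (ga T) - a T) by reflexivity; lra. }
  assert (hz : Rabs z0 < RR).
  { replace z0 with (y + ga s0) by (unfold y; ring).
    eapply Rle_lt_trans; [apply Rabs_triang|]; specialize (hmx s0 hs0); unfold RR; lra. }
  destruct U_viscosity as [_ [_ [sub _]]].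
  specialize (sub phi s0 z0 hCk ltac:(lra)).
  assert (V : d1 phi s0 z0 + H z0 (d2 phi s0 z0) <= 0).
  { apply sub; exists (RR - Rabs z0); split; [lra|]; intros s y' hs h1 h2.
    pose proof (hmax s y' ltac:(lra)) as m; rewrite !clip_id in m by lra; apply m.
    apply Rabs_le_between; replace y' with ((y' - z0) + z0) by ring.
    eapply Rle_trans; [apply Rabs_triang | lra]. }
  rewrite hd1, hd2 in V; fold y in V.
  set (p := 0 + 2 * / ep * y) in *.
  assert (hp : Rabs p <= 2 * K).
  { unfold p; rewrite Rplus_0_l, !Rabs_mult, (Rabs_right 2) by lra.
    rewrite (Rabs_right (/ ep)) by (apply Rle_ge, Rlt_le, Rinv_0_lt_compat; lra).
    apply Rmult_le_reg_l with ep; [lra|].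
    replace (ep * (2 * / ep * Rabs y)) with (2 * Rabs y) by (field; lra); lra. }
  (* Young's inequality makes [b - p * w + H (ga s0) p] nonnegative; the extra slope [de] exceeds
     the error [C * |y|] of moving from [ga s0] to [z0], by [ep2]. *)
  pose proof (hb s0 ltac:(lra)) as lb; pose proof (Young _ _ _ HH (ga s0) p (w s0)) as yo.
  pose proof (hH z0 (ga s0) p p hp hp) as hh; rewrite (Rminus_diag p), Rabs_R0, Rplus_0_r in hh.
  fold y in hh; apply Rabs_le_between in hh.
  assert (C * Rabs y <= C * K * ep) by (rewrite Rmult_assoc; apply Rmult_le_compat_l; auto).
  assert (0 <= N * (2 * Rmax 0 (s0 - bt))) by (apply Rmult_le_pos; [lra|]; pose proof (Rmax_l 0 (s0 - bt)); lra).
  assert (pw : 2 * / ep * y * w s0 = p * w s0) by (unfold p; ring).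
  unfold dal in V; lra.
Qed.

Lemma subsolution_HSol (q p : R -> R) : HSol Hx Hp q p ->
  U T (q T) <= U 0 (q 0) + Act H Hp q p T.
Proof.
  intros h; pose proof (subsolution_along q (Act H Hp q p) (fun s => Hp (q s) (p s))
    (fun s => p s * Hp (q s) (p s) - H (q s) (p s))) as k.
  rewrite Act_0, Rminus_0_r in k; apply k.
  - intros; apply h.
  - intros; exact (Act_derive _ _ _ HH q p r h).
  - intros; exact (continuity_Hp_along _ _ _ HH q p r h).
  - intros; exact (continuity_density_along _ _ _ HH q p r h).
  - intros; rewrite (Lag_eq _ _ _ HH); lra.
Qed.

End Subsolution.

(** * Tilted characteristics *)

Section Tilt.

Variables H Hx Hp : R -> R -> R.
Hypothesis HH : Ham H Hx Hp.

(* Moving the end point of a characteristic linearly in time changes its action by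
   [p(t) h] up to second order: this is where semiconcavity comes from. *)
Lemma tilted_characteristic (P : R) : exists C, 0 <= C /\ forall q p t h, HSol Hx Hp q p ->
  (forall s, Rabs (p s) <= P) -> 0 < t -> Rabs h <= 1 -> Rabs h <= t ->
  let ga := fun r => q r + r * (h / t) in
  let w := fun r => Hp (q r) (p r) + h / t in
  let a := fun r => Act H Hp q p r + r * p r * (h / t) + C * (1 + / (t * t)) * (h * h) * r in
  let b := fun r => p r * Hp (q r) (p r) - H (q r) (p r) + p r * (h / t)
             + r * (- Hx (q r) (p r)) * (h / t) + C * (1 + / (t * t)) * (h * h) in
  (forall r, is_derive ga r (w r)) /\ (forall r, is_derive a r (b r)) /\
  (forall r, continuity_pt w r) /\ (forall r, continuity_pt b r) /\
  (exists M, forall r, Rabs (w r) <= M) /\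
  (forall r, 0 <= r <= t -> Lag H (ga r) (w r) <= b r).
Proof.
  destruct (ham_loc _ _ _ HH P) as [A [hA ha]].
  destruct (Lag_semiconcave _ _ _ HH A) as [C [hC sc]].
  exists C; split; [exact hC|]; intros q p t h hs hP ht h1 h2 ga w a b.
  assert (cst : forall k r, continuity_pt (fun _ : R => k) r)
    by (intros; apply continuity_pt_const; intros u v; reflexivity).
  split; [|split; [|split; [|split; [|split]]]].
  - intros r; destruct (hs r); unfold ga, w; dvf; ring.
  - intros r; destruct (hs r); pose proof (Act_derive _ _ _ HH q p r hs); unfold a, b; dvf; ring.
  - intros r; unfold w; apply continuity_plus_pt; auto; exact (continuity_Hp_along _ _ _ HH q p r hs).
  - intros r; destruct (HSol_continuity _ _ q p hs) as [_ cp]; unfold b.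
    apply continuity_plus_pt; [apply continuity_plus_pt; [apply continuity_plus_pt|]|]; auto.
    + exact (continuity_density_along _ _ _ HH q p r hs).
    + apply (continuity_pt_mult p); auto.
    + apply (continuity_pt_mult (fun r => r * - Hx (q r) (p r))); auto.
      apply (continuity_pt_mult (fun r => r)); [apply (derive_continuity _ _ 1), D_id|].
      apply (continuity_pt_opp (fun r => Hx (q r) (p r))); exact (continuity_Hx_along _ _ _ HH q p r hs).
  - exists (A + Rabs (h / t)); intros r; unfold w; eapply Rle_trans; [apply Rabs_triang|].
    apply Rplus_le_compat_r; now apply ha.
  - intros r hr; unfold ga, w, b.
    assert (w1 : Rabs (h / t) <= 1).
    { apply Rabs_div_le; lra. }
    assert (rt : 0 <= r / t <= 1).
    { split; [apply Rmult_le_pos; [lra | apply Rlt_le, Rinv_0_lt_compat, ht]|].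
      apply Rmult_le_reg_r with t; auto; unfold Rdiv; rewrite Rmult_assoc, Rinv_l by lra; lra. }
    assert (er : r * (h / t) = r / t * h) by (field; lra).
    assert (w2 : Rabs (r * (h / t)) <= 1).
    { rewrite er, Rabs_mult, (Rabs_right (r / t)) by lra; pose proof (Rabs_pos h); nra. }
    (* The first-order terms of the expansion are exactly the derivative of [r * p r * (h / t)], by
       the equation for [p]; only the quadratic remainder has to be estimated. *)
    eapply Rle_trans; [apply (sc (q r) (p r) _ (h / t)); auto; now apply ha|].
    rewrite (Lag_eq _ _ _ HH).
    assert (sq : r * (h / t) * (r * (h / t)) + h / t * (h / t) <= (1 + / (t * t)) * (h * h)).
    { replace (h / t * (h / t)) with (/ (t * t) * (h * h)) by (field; lra).
      rewrite er; replace (r / t * h * (r / t * h)) with (r / t * (r / t) * (h * h)) by ring.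
      assert (0 <= h * h) by nra; assert (r / t * (r / t) <= 1) by nra; nra. }
    apply Rmult_le_compat_l with (r := C) in sq; auto; lra.
Qed.

End Tilt.

(** * Calibrated characteristics *)

Section Reversal.

Variables H Hx Hp : R -> R -> R.
Hypothesis HH : Ham H Hx Hp.

Let rH := fun x p => H x (- p).
Let rHx := fun x p => Hx x (- p).
Let rHp := fun x p => - Hp x (- p).

Lemma HSol_reverse (q p : R -> R) (T : R) : HSol rHx rHp q p ->
  HSol Hx Hp (fun s => q (T - s)) (fun s => - p (T - s)).
Proof.
  intros h t; destruct (h (T - t)) as [h1 h2]; unfold rHx, rHp in *; split.
  - eapply is_derive_eq; [apply (D_comp q (fun s => T - s)); [exact h1 | dv] | ring].
  - eapply is_derive_eq; [apply D_opp, (D_comp p (fun s => T - s)); [exact h2 | dv] | ring].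
Qed.

(** Change of variables in the action: the forward action up to [s] plus the reversed action up to
    [T - s] has zero derivative in [s]. *)
Lemma Act_reverse (q p : R -> R) (T : R) : HSol rHx rHp q p ->
  Act H Hp (fun s => q (T - s)) (fun s => - p (T - s)) T = Act rH rHp q p T.
Proof.
  intros h; pose proof (HSol_reverse q p T h) as h'.
  pose proof (ham_reverse _ _ _ HH) as HR.
  set (A := fun s => Act H Hp (fun s => q (T - s)) (fun s => - p (T - s)) s + Act rH rHp q p (T - s)).
  assert (e : A T = A 0).
  { apply derivative_zero_constant; intros t; unfold A.
    pose proof (Act_derive _ _ _ HH _ _ t h') as d1'.
    pose proof (Act_derive _ _ _ HR q p (T - t) h) as d2'.
    eapply is_derive_eq.
    - apply D_plus; [exact d1' | apply (D_comp (Act rH rHp q p) (fun s => T - s)); [exact d2' | dv]].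
    - unfold rH, rHp; ring. }
  unfold A in e; rewrite Rminus_diag, Rminus_0_r, !Act_0 in e; lra.
Qed.

(* The backward value function with final datum a steep cone touching [U T] from below at [x] is
   semiconvex, so [U] can be tested against it: the minimum of the difference is attained at
   time 0, which yields a characteristic along which [U] is calibrated. *)
Theorem calibrated_characteristic (T : R) (Uo : R -> R) (U : R -> R -> R) : 0 < T ->
  Lipschitz_strip T U -> visc_sol H T Uo U ->
  exists P, 0 <= P /\ forall x, exists q p, HSol Hx Hp q p /\ q T = x /\ (forall s, Rabs (p s) <= P) /\
    U T x = U 0 (q 0) + Act H Hp q p T.
Proof.
  intros hT hUL hUv.
  pose proof (ham_reverse _ _ _ HH) as HR; fold rH rHx rHp in HR.
  destruct (Lipschitz_strip_nonneg T U hUL) as [K [hK hL]].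
  destruct (value_function _ _ _ HR (K + 1) T hT) as [P [hP hval]].
  exists P; split; [exact hP|]; intros x.
  (* The slope exceeds the Lipschitz constant of [U] by 1, so [U T y + f y >= |y - x|]. This margin
     gives coercivity now and identifies the end point later. *)
  set (f := fun y => (K + 1) * Rabs (y - x) - U T x).
  assert (hf : LipK (K + 1) f).
  { intros y z; unfold f.
    replace ((K + 1) * Rabs (y - x) - U T x - ((K + 1) * Rabs (z - x) - U T x))
      with ((K + 1) * (Rabs (y - x) - Rabs (z - x))) by ring.
    rewrite Rabs_mult, (Rabs_right (K + 1)) by lra; apply Rmult_le_compat_l; [lra|].
    eapply Rle_trans; [apply Rabs_triang_inv2|]; right; f_equal; ring. }
  destruct (hval f hf) as [V [V1 V2]].
  pose proof (value_Lipschitz _ _ _ HR (K + 1) T P f V ltac:(lra) hT hf V1 V2) as VL.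
  destruct (Lipschitz_strip_nonneg T V VL) as [KV [hKV hVL]].
  destruct (Lag_superlinear _ _ _ HR (K + 1) ltac:(lra)) as [C [hC hsl]].
  (* The cone survives up to a loss linear in time, because the reversed Lagrangian dominates
     [(K + 1) |v| - C]. *)
  assert (grow : forall t z, 0 <= t <= T -> (K + 1) * Rabs (z - x) - U T x - C * t <= V t z).
  { intros t z ht; destruct (V1 t z ht) as (q & p & h & e & hb & ->).
    assert (mv : forall sg, Rabs sg = 1 -> (K + 1) * (sg * (q t - q 0)) - C * t <= Act rH rHp q p t).
    { intros sg hsg.
      pose proof (derive_ge (fun s => Act rH rHp q p s - (K + 1) * (sg * q s))
        (fun s => p s * rHp (q s) (p s) - rH (q s) (p s) - (K + 1) * (sg * rHp (q s) (p s)))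
        (- C) 0 t ltac:(lra)) as d; cbv beta in d; rewrite Act_0 in d.
      enough (- C * (t - 0) <= Act rH rHp q p t - (K + 1) * (sg * q t) - (0 - (K + 1) * (sg * q 0))) by lra.
      apply d; intros s _.
      - destruct (h s); pose proof (Act_derive _ _ _ HR q p s h); dvf; ring.
      - rewrite <- (Lag_eq _ _ _ HR); pose proof (hsl (q s) (rHp (q s) (p s))) as l.
        assert (sg * rHp (q s) (p s) <= Rabs (rHp (q s) (p s))).
        { eapply Rle_trans; [apply RRle_abs|]; rewrite Rabs_mult, hsg; lra. }
        assert ((K + 1) * (sg * rHp (q s) (p s)) <= (K + 1) * Rabs (rHp (q s) (p s)))
          by (apply Rmult_le_compat_l; lra).
        lra. }
    pose proof (mv 1 Rabs_R1) as m1; pose proof (mv (- 1) ltac:(rewrite Rabs_left; lra)) as m2.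
    assert (Rabs (z - x) <= Rabs (q t - q 0) + Rabs (q 0 - x)).
    { rewrite <- e; replace (q t - x) with ((q t - q 0) + (q 0 - x)) by ring; apply Rabs_triang. }
    assert ((K + 1) * Rabs (q t - q 0) - C * t <= Act rH rHp q p t).
    { unfold Rabs at 1; destruct Rcase_abs; lra. }
    assert ((K + 1) * Rabs (z - x) <= (K + 1) * (Rabs (q t - q 0) + Rabs (q 0 - x)))
      by (apply Rmult_le_compat_l; lra).
    unfold f; lra. }
  set (D := fun s z => U s z + V (T - s) z).
  assert (Dlow : forall s z, 0 <= s <= T -> Rabs (z - x) - (K + C) * (T - s) <= D s z).
  { intros s z hs; pose proof (grow (T - s) z ltac:(lra)) as g.
    pose proof (hL s T z x hs ltac:(lra)) as l; rewrite (Rabs_left1 (s - T)) in l by lra.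
    apply Rabs_le_between in l; unfold D; lra. }
  assert (DT : D T x = 0).
  { unfold D; rewrite Rminus_diag, (value_initial _ _ _ T P f V hT V1).
    unfold f; rewrite Rminus_diag, Rabs_R0; ring. }
  (* Otherwise [D 0] is bounded below by some [c > 0], while [D T x = 0]. Adding a small increasing
     function [th] of time puts the minimum at an interior time, against the supersolution
     property. *)
  assert (contact : exists y, D 0 y <= 0).
  { apply NNPP; intros no.
    assert (pos : forall y, 0 < D 0 y) by (intros y; apply Rnot_le_lt; intros l; apply no; now exists y).
    set (R0 := (K + C) * T + 1); assert (0 <= (K + C) * T) by nra.
    assert (cD : exists c, 0 < c <= 1 /\ forall z, c <= D 0 z).
    { destruct (continuity_ab_min (D 0) (x - R0) (x + R0)) as [m [hm _]]; [unfold R0; lra| |].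
      { intros z _; apply continuity_eps; intros eps he; exists (eps / (K + KV + 1)).
        assert (h0 : 0 < eps / (K + KV + 1)) by (apply Rdiv_lt_0_compat; lra).
        split; [exact h0|]; intros u hu.
        pose proof (hL 0 0 u z ltac:(lra) ltac:(lra)) as a; pose proof (hVL (T - 0) (T - 0) u z ltac:(lra) ltac:(lra)) as b.
        rewrite Rminus_diag, Rabs_R0, Rplus_0_l in a, b.
        unfold D; replace (U 0 u + V (T - 0) u - (U 0 z + V (T - 0) z))
          with ((U 0 u - U 0 z) + (V (T - 0) u - V (T - 0) z)) by ring.
        eapply Rle_lt_trans; [apply Rabs_triang|].
        pose proof (Rabs_pos (u - z)).
        apply Rle_lt_trans with ((K + KV + 1) * Rabs (u - z)); [lra|].
        replace eps with ((K + KV + 1) * (eps / (K + KV + 1))) by (field; lra).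
        apply Rmult_lt_compat_l; lra. }
      exists (Rmin (D 0 m) 1); split; [split; [apply Rmin_glb_lt; [apply pos | lra] | apply Rmin_r]|].
      intros z; destruct (Rle_dec (Rabs (z - x)) R0) as [l|l].
      - apply Rabs_le_between in l; apply Rle_trans with (D 0 m); [apply Rmin_l | apply hm; lra].
      - apply Rle_trans with 1; [apply Rmin_r|]; pose proof (Dlow 0 z ltac:(lra)); unfold R0 in l; lra. }
    destruct cD as [c [hc cD]].
    (* [c/4] pays for moving from [T] to [bt] and another [c/4] for the slope [de], so the penalized
       value at [(bt, x)] stays below [c]. *)
    set (k := Rmin (T / 2) (c / (4 * (K + KV + 1)))).
    assert (k0 : 0 < k) by (apply Rmin_glb_lt; [lra | apply Rdiv_lt_0_compat; lra]).
    assert (k1 : k <= T / 2) by apply Rmin_l.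
    assert (k2 : (K + KV) * k <= c / 4).
    { pose proof (Rmin_r (T / 2) (c / (4 * (K + KV + 1)))) as m; fold k in m.
      apply Rmult_le_compat_l with (r := K + KV + 1) in m; [|lra].
      replace ((K + KV + 1) * (c / (4 * (K + KV + 1)))) with (c / 4) in m by (field; lra); lra. }
    set (bt := T - k).
    set (N := c / (k * k)); assert (hN : 0 < N) by (apply Rdiv_lt_0_compat; nra).
    set (de := c / (4 * T)); assert (hde : 0 < de) by (apply Rdiv_lt_0_compat; lra).
    assert (deT : de * T = c / 4) by (unfold de; field; lra).
    set (th := fun s => de * s + N * ramp bt s).
    assert (th0 : forall s, 0 <= s -> 0 <= th s).
    { intros s hs; unfold th; pose proof (ramp_nonneg bt s).
      apply Rplus_le_le_0_compat; apply Rmult_le_pos; lra. }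
    assert (Db : D bt x + th bt < c).
    { unfold th; rewrite ramp_zero by lra.
      pose proof (hL bt T x x ltac:(unfold bt; lra) ltac:(lra)) as a.
      pose proof (hVL (T - bt) (T - T) x x ltac:(unfold bt; lra) ltac:(lra)) as b.
      replace (bt - T) with (- k) in a by (unfold bt; ring).
      replace (T - bt - (T - T)) with k in b by (unfold bt; ring).
      rewrite Rabs_Ropp in a; rewrite (Rminus_diag x), Rabs_R0, Rplus_0_r, (Rabs_right k) in a, b by lra.
      apply Rabs_le_between in a; apply Rabs_le_between in b.
      assert (de * bt <= de * T) by (apply Rmult_le_compat_l; unfold bt; lra).
      unfold D in DT |- *; lra. }
    set (RR := (K + C) * T + 2).
    destruct (box_maximum (fun s z => - (U (clip T s) z + V (clip T (T - s)) z + th s)) 0 T (x - RR) (x + RR))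
      as (s0 & z0 & hs0 & hz0 & hmax); [lra | unfold RR; lra | |].
    { intros s z; apply continuity_2d_pt_opp, continuity_2d_pt_plus; [apply continuity_2d_pt_plus|].
      - apply Lipschitz_strip_continuity; auto; lra.
      - apply (Lipschitz_continuity_2d _ KV); intros u v _ _.
        eapply Rle_trans; [apply hVL; apply clip_range; lra|].
        apply Rmult_le_compat_l; auto; apply Rplus_le_compat_r.
        eapply Rle_trans; [apply clip_Lipschitz; lra|].
        right; rewrite <- Rabs_Ropp; f_equal; ring.
      - apply (continuity_1d_2d_pt_comp th (fun s _ => s)); [|apply continuity_2d_pt_id1].
        apply (derive_continuity th s (de + N * (2 * Rmax 0 (s - bt)))).
        pose proof (ramp_derive bt s); unfold th; dvf; ring. }
    assert (hmin : forall s z, 0 <= s <= T -> x - RR <= z <= x + RR -> D s0 z0 + th s0 <= D s z + th s).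
    { intros s z hs hz; pose proof (hmax s z hs hz) as m; rewrite !clip_id in m by lra; unfold D; lra. }
    assert (val : D s0 z0 + th s0 < c).
    { eapply Rle_lt_trans; [apply (hmin bt x); unfold bt, RR; lra | exact Db]. }
    assert (n0 : s0 <> 0).
    { intros e; rewrite e in val; pose proof (cD z0); pose proof (th0 0 ltac:(lra)); lra. }
    assert (n1 : s0 <> T).
    { intros e; rewrite e in val; pose proof (Dlow T z0 ltac:(lra)) as l; pose proof (Rabs_pos (z0 - x)).
      assert (N * ramp bt T = c).
      { unfold N, ramp, bt; rewrite Rmax_right by lra; field; lra. }
      assert (0 < de * T) by lra; unfold th in val; lra. }
    assert (hz : Rabs (z0 - x) < RR).
    { pose proof (Dlow s0 z0 hs0); pose proof (th0 s0 ltac:(lra)).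
      assert ((K + C) * (T - s0) <= (K + C) * T) by (apply Rmult_le_compat_l; lra).
      unfold RR; lra. }
    set (t0 := T - s0); assert (ht0 : 0 < t0 < T) by (unfold t0; lra).
    destruct (V1 t0 z0 ltac:(lra)) as (q & p & hs & e & hb & ev).
    destruct (tilted_characteristic _ _ _ HR P) as [C3 [hC3 htilt]].
    (* A bound of [C3 * (1 + 1/t^2) * t] for [t] between [t0 / 2] and [T]; the tilt degenerates as
       [t] tends to 0. *)
    set (C4 := C3 * (1 + 4 / (t0 * t0)) * T).
    (* Tilting the minimizer through [(t0, z0)] gives a C^1 function above [V] near this point, with
       equality at it; minus this function, minus [th], is the test function [phi] for [U]. *)
    assert (touch : forall t z, t0 / 2 <= t <= T -> Rabs (z - q t) <= 1 -> Rabs (z - q t) <= t0 / 2 ->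
      V t z <= f (q 0) + Act rH rHp q p t + p t * (z - q t) + C4 * ((z - q t) * (z - q t))).
    { intros t z ht h1 h2; set (h := z - q t) in *.
      destruct (htilt q p t h hs hb ltac:(lra) h1 ltac:(lra)) as (g1 & g2 & _ & _ & [M g3] & g4).
      pose proof (V2 t _ _ ltac:(lra) (Adm_C1 _ _ _ HR _ _ _ _ 0 t M (fun r _ => g1 r) (fun r _ => g2 r)
        (fun r _ => g3 r) g4)) as v; cbv beta in v; rewrite Act_0 in v.
      replace (q t + t * (h / t)) with z in v by (unfold h; field; lra).
      replace (q 0 + 0 * (h / t)) with (q 0) in v by ring.
      replace (t * p t * (h / t)) with (p t * h) in v by (field; lra).
      assert (C3 * (1 + / (t * t)) * (h * h) * t <= C4 * (h * h)).
      { unfold C4; replace (C3 * (1 + 4 / (t0 * t0)) * T * (h * h)) with (C3 * ((1 + 4 / (t0 * t0)) * T) * (h * h)) by ring.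
        replace (C3 * (1 + / (t * t)) * (h * h) * t) with (C3 * ((1 + / (t * t)) * t) * (h * h)) by ring.
        apply Rmult_le_compat_r; [nra|]; apply Rmult_le_compat_l; auto.
        assert (0 < / (t * t)) by (apply Rinv_0_lt_compat; nra).
        assert (/ (t * t) <= 4 / (t0 * t0)).
        { replace (4 / (t0 * t0)) with (/ (t0 / 2 * (t0 / 2))) by (field; lra).
          apply Rinv_le_contravar; nra. }
        apply Rmult_le_compat; lra. }
      lra. }
    assert (dact : forall s, is_derive (Act rH rHp q p) s (p s * rHp (q s) (p s) - rH (q s) (p s)))
      by (intros; exact (Act_derive _ _ _ HR q p s hs)).
    assert (rv : forall g dg : R -> R, (forall s, is_derive g s (dg s)) ->
      forall s, is_derive (fun s => g (T - s)) s (- dg (T - s))).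
    { intros g dg hg s; eapply is_derive_eq; [apply (D_comp g (fun s => T - s)); [apply hg | dv] | ring]. }
    assert (rc : forall g : R -> R, (forall s, continuity_pt g s) -> forall s, continuity_pt (fun s => g (T - s)) s).
    { intros g hg s; apply (continuity_pt_comp (fun s => T - s) g); auto.
      apply (derive_continuity _ s (- (1))); dvf; ring. }
    assert (no' : forall g : R -> R, (forall s, continuity_pt g s) -> forall s, continuity_pt (fun s => - g s) s)
      by (intros g hg s; now apply (continuity_pt_opp g)).
    set (al := fun s => - th s - f (q 0) - Act rH rHp q p (T - s)).
    set (dal := fun s => (p (T - s) * rHp (q (T - s)) (p (T - s)) - rH (q (T - s)) (p (T - s)))
                         + - (de + N * (2 * Rmax 0 (s - bt)))).
    pose proof (HSol_continuity _ _ q p hs) as [cq cp].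
    destruct (quadratic_test_function al (fun s => - p (T - s)) (fun s => q (T - s)) dal
      (fun s => - - - rHx (q (T - s)) (p (T - s))) (fun s => - rHp (q (T - s)) (p (T - s))) (- C4)) as [hCk [hd1 hd2]].
    { intros s; pose proof (ramp_derive bt s); pose proof (rv _ _ dact s); unfold al, dal, th; dvf; ring. }
    { intros s; apply D_opp, (rv p (fun s => - rHx (q s) (p s))); intros; apply hs. }
    { intros s; apply (rv q (fun s => rHp (q s) (p s))); intros; apply hs. }
    { intros s; unfold dal; apply continuity_plus_pt.
      - apply (rc (fun s => p s * rHp (q s) (p s) - rH (q s) (p s))); intros.
        exact (continuity_density_along _ _ _ HR q p s1 hs).
      - apply no'; intros u; apply continuity_plus_pt; [apply continuity_pt_const; intros ? ?; reflexivity|].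
        apply (continuity_pt_mult (fun _ => N)); [apply continuity_pt_const; intros ? ?; reflexivity
          | apply ramp_derivative_continuity]. }
    { apply no', no', no', (rc (fun s => rHx (q s) (p s))); intros u.
      exact (continuity_Hx_along _ _ _ HR q p u hs). }
    { apply no', (rc (fun s => rHp (q s) (p s))); intros u.
      exact (continuity_Hp_along _ _ _ HR q p u hs). }
    set (phi := fun s z => al s + - p (T - s) * (z - q (T - s)) + - C4 * ((z - q (T - s)) * (z - q (T - s)))) in *.
    destruct hUv as [_ [_ [_ sup]]].
    specialize (sup phi s0 z0 hCk ltac:(lra)).
    assert (W : 0 <= d1 phi s0 z0 + H z0 (d2 phi s0 z0)).
    { apply sup.
      set (m := Rmin 1 (t0 / 2) / 2).
      assert (m0 : 0 < m) by (unfold m; assert (0 < Rmin 1 (t0 / 2)) by (apply Rmin_glb_lt; lra); lra).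
      assert (mm : 2 * m <= 1 /\ 2 * m <= t0 / 2).
      { unfold m; pose proof (Rmin_l 1 (t0 / 2)); pose proof (Rmin_r 1 (t0 / 2)); lra. }
      destruct (proj1 (continuity_eps q t0) (cq t0) m m0) as [d' [hd' hq]].
      exists (Rmin (Rmin d' m) (RR - Rabs (z0 - x))); split; [repeat apply Rmin_glb_lt; lra|].
      intros s z hs' h1 h2.
      pose proof (Rmin_l (Rmin d' m) (RR - Rabs (z0 - x))); pose proof (Rmin_r (Rmin d' m) (RR - Rabs (z0 - x))).
      pose proof (Rmin_l d' m); pose proof (Rmin_r d' m).
      assert (hzx : x - RR <= z <= x + RR).
      { enough (Rabs (z - x) <= RR) as E by (apply Rabs_le_between in E; lra).
        replace (z - x) with ((z - z0) + (z0 - x)) by ring; eapply Rle_trans; [apply Rabs_triang | lra]. }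
      pose proof (hmin s z ltac:(lra) hzx) as mn.
      assert (e1 : Rabs (T - s - t0) < m /\ Rabs (T - s - t0) < d').
      { replace (T - s - t0) with (- (s - s0)) by (unfold t0; ring); rewrite Rabs_Ropp; lra. }
      specialize (hq (T - s) (proj2 e1)).
      assert (e2 : Rabs (z - q (T - s)) <= 2 * m).
      { replace (z - q (T - s)) with ((z - z0) + - (q (T - s) - q t0)) by (rewrite e; ring).
        eapply Rle_trans; [apply Rabs_triang|]; rewrite Rabs_Ropp; lra. }
      destruct e1 as [e1 _]; apply Rabs_def2 in e1.
      pose proof (touch (T - s) z ltac:(lra) ltac:(lra) ltac:(lra)) as tc.
      assert (p0 : phi s0 z0 = - th s0 - V t0 z0).
      { unfold phi, al; fold t0; rewrite e, ev; ring. }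
      rewrite p0; unfold phi, al; unfold D in mn; fold t0 in mn; lra. }
    (* Along the characteristic the action part of [phi] solves the equation exactly. What remains
       is minus the slope of [th], which is negative. *)
    rewrite hd1, hd2 in W; fold t0 in W; rewrite e in W.
    unfold dal in W; fold t0 in W; rewrite e in W.
    replace (- p t0 + 2 * - C4 * (z0 - z0)) with (- p t0) in W by ring.
    fold (rH z0 (p t0)) in W.
    assert (0 <= N * (2 * Rmax 0 (s0 - bt))) by (apply Rmult_le_pos; [lra|]; pose proof (Rmax_l 0 (s0 - bt)); lra).
    rewrite Rminus_diag in W; lra. }
  destruct contact as [y hy].
  destruct (V1 T y ltac:(lra)) as (q & p & h & e & hb & ev).
  unfold D in hy; rewrite Rminus_0_r, ev in hy.
  exists (fun s => q (T - s)), (fun s => - p (T - s)).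
  pose proof (HSol_reverse q p T h) as h'.
  pose proof (subsolution_HSol _ _ _ HH T Uo U hT hUL hUv _ _ h') as sb; cbv beta in sb.
  rewrite (Act_reverse q p T h), Rminus_diag, Rminus_0_r, e in *.
  pose proof (hL T T (q 0) x ltac:(lra) ltac:(lra)) as l.
  rewrite Rminus_diag, Rabs_R0, Rplus_0_l in l; apply Rabs_le_between in l.
  unfold f in hy.
  (* The contact and the growth of [U] along the reversed curve give
     [(K + 1) |q 0 - x| <= U T x - U T (q 0)], while the right-hand side is at most
     [K |q 0 - x|]. *)
  assert (q0 : q 0 = x).
  { destruct (Req_dec (q 0 - x) 0) as [z|z]; [lra|]; apply Rabs_pos_lt in z; lra. }
  rewrite q0, Rminus_diag, Rabs_R0 in *.
  split; [exact h'|]; split; [reflexivity|]; split; [intros s; rewrite Rabs_Ropp; apply hb|].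
  lra.
Qed.

End Reversal.

(** * The final profile *)

Lemma derive_of_quadratic_error (f : R -> R) (y l C r : R) : 0 < r -> 0 <= C ->
  (forall h, Rabs h <= r -> Rabs (f (y + h) - f y - l * h) <= C * (h * h)) -> is_derive f y l.
Proof.
  intros hr hC h; apply is_derive_Reals; intros eps he.
  assert (hd : 0 < Rmin r (eps / (C + 1))) by (apply Rmin_glb_lt; [auto | apply Rdiv_lt_0_compat; lra]).
  exists (mkposreal _ hd); simpl; intros k k0 hk.
  pose proof (Rmin_l r (eps / (C + 1))); pose proof (Rmin_r r (eps / (C + 1))) as m.
  specialize (h k ltac:(lra)).
  replace ((f (y + k) - f y) / k - l) with ((f (y + k) - f y - l * k) / k) by (field; auto).
  unfold Rdiv; rewrite Rabs_mult, Rabs_inv; rewrite <- Rabs_square in h.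
  pose proof (Rabs_pos_lt k k0).
  apply Rle_lt_trans with (C * Rabs k).
  - apply Rmult_le_reg_r with (Rabs k); auto; rewrite Rmult_assoc, Rinv_l by lra; lra.
  - apply Rlt_le_trans with ((C + 1) * (eps / (C + 1))); [|right; field; lra].
    apply Rle_lt_trans with ((C + 1) * Rabs k); [lra | apply Rmult_lt_compat_l; lra].
Qed.

Lemma derivative_of_touched (f : R -> R) (y d p C r : R) : 0 < r -> 0 <= C -> is_derive f y d ->
  (forall h, Rabs h <= r -> f (y + h) <= f y + p * h + C * (h * h)) -> d = p.
Proof.
  intros hr hC hd h.
  set (g := fun z => p * (z - y) + C * ((z - y) * (z - y)) - f z).
  assert (D : is_derive g y (p - d)) by (unfold g; dvf; ring).
  enough (p - d = 0) by lra.
  apply is_derive_Reals in D.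
  rewrite <- (derive_pt_eq_0 g y _ (exist _ _ D) D).
  apply (deriv_minimum g (y - r) (y + r)); try lra.
  intros z h1 h2; unfold g; specialize (h (z - y) ltac:(apply Rabs_le_between; lra)).
  replace (y + (z - y)) with z in h by ring.
  rewrite (Rminus_diag y); lra.
Qed.

Lemma Lipschitz_derivative_bound (f : R -> R) (K y d : R) : 0 <= K -> LipK K f -> is_derive f y d ->
  Rabs d <= K.
Proof.
  intros hK hf hd; apply le_epsilon; intros eps he.
  apply is_derive_Reals in hd; destruct (hd eps he) as [de hde]; pose proof (cond_pos de).
  specialize (hde (de / 2) ltac:(lra) ltac:(rewrite Rabs_right; lra)).
  pose proof (hf (y + de / 2) y) as l; replace (y + de / 2 - y) with (de / 2) in l by ring.
  rewrite (Rabs_right (de / 2)) in l by lra.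
  set (q := (f (y + de / 2) - f y) / (de / 2)) in *.
  assert (Rabs q <= K).
  { apply Rabs_div_le; lra. }
  replace d with (q - (q - d)) by ring; unfold Rminus at 1; eapply Rle_trans; [apply Rabs_triang|].
  rewrite Rabs_Ropp; lra.
Qed.

(** * Left traces of semiconcave functions *)

Section LeftTraces.

Variables (W : R -> R) (K C r : R).
Hypothesis hK : 0 <= K.
Hypothesis hC : 0 <= C.
Hypothesis hr : 0 < r.
Hypothesis WL : LipK K W.
Hypothesis W_touched : forall x, exists p, forall h, Rabs h <= r ->
  W (x + h) <= W x + p * h + C * (h * h).

(** At an interior minimum of [W] plus a parabola, [W] is touched by parabolas from below and from
    above, hence is differentiable there. *)
Lemma semiconcave_differentiable_dense (a b : R) : a < b -> exists y d, a < y < b /\ is_derive W y d.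
Proof.
  intros hab.
  (* With [N * e = K + 1] the parabola rises from the middle to either end by more than [W] can
     fall, so the minimum is interior. *)
  set (m := (a + b) / 2); set (e := (b - a) / 2); set (N := (K + 1) / e).
  assert (he : 0 < e) by (unfold e; lra).
  assert (hN : 0 < N) by (apply Rdiv_lt_0_compat; lra).
  assert (Ne : N * e = K + 1) by (unfold N; field; lra).
  assert (cW : forall x, continuity_pt W x).
  { intros x; apply continuity_eps; intros eps hp; exists (eps / (K + 1)).
    split; [apply Rdiv_lt_0_compat; lra|]; intros u hu.
    eapply Rle_lt_trans; [apply WL|]; pose proof (Rabs_pos (u - x)).
    apply Rle_lt_trans with ((K + 1) * Rabs (u - x)); [lra|].
    replace eps with ((K + 1) * (eps / (K + 1))) by (field; lra); apply Rmult_lt_compat_l; lra. }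
  destruct (continuity_ab_min (fun z => W z + N * ((z - m) * (z - m))) a b) as [y [hm hy]]; [lra| |].
  { intros z _; apply continuity_plus_pt; auto.
    apply (derive_continuity _ z (2 * N * (z - m))); dvf; ring. }
  assert (inner : forall z, Rabs (z - m) = e -> y <> z).
  { intros z hz ->; pose proof (hm m ltac:(unfold m; lra)) as k.
    replace ((z - m) * (z - m)) with (e * e) in k by (rewrite <- hz, Rabs_square; ring).
    pose proof (WL z m) as l; rewrite hz in l; apply Rabs_le_between in l.
    replace (N * (e * e)) with ((K + 1) * e) in k by (rewrite <- Ne; ring).
    rewrite Rminus_diag, !Rmult_0_r in k; lra. }
  pose proof (inner a ltac:(unfold m, e; rewrite Rabs_left; lra)).
  pose proof (inner b ltac:(unfold m, e; rewrite Rabs_right; lra)).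
  destruct (W_touched y) as [p hp].
  set (k := Rmin r (Rmin (y - a) (b - y))).
  assert (k0 : 0 < k) by (repeat apply Rmin_glb_lt; lra).
  assert (k1 : k <= r) by apply Rmin_l.
  assert (k2 : k <= y - a /\ k <= b - y).
  { pose proof (Rmin_r r (Rmin (y - a) (b - y))); pose proof (Rmin_l (y - a) (b - y));
    pose proof (Rmin_r (y - a) (b - y)); unfold k; lra. }
  assert (low : forall h, Rabs h <= k -> W y - 2 * N * (y - m) * h - N * (h * h) <= W (y + h)).
  { intros h hh; apply Rabs_le_between in hh; specialize (hm (y + h) ltac:(lra)).
    replace ((y + h - m) * (y + h - m)) with ((y - m) * (y - m) + 2 * (y - m) * h + h * h) in hm by ring.
    lra. }
  assert (ep : p + 2 * N * (y - m) = 0).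
  { apply (first_order_condition _ (C + N) k); [lra | lra |]; intros h hh.
    specialize (low h hh); specialize (hp h ltac:(lra)); lra. }
  exists y, p; split; [lra|].
  apply (derive_of_quadratic_error W y p (C + N) k); [lra | lra |]; intros h hh.
  specialize (low h hh); specialize (hp h ltac:(lra)).
  replace (2 * N * (y - m)) with (- p) in low by lra.
  assert (0 <= h * h) by nra; assert (0 <= C * (h * h)) by nra; assert (0 <= N * (h * h)) by nra.
  apply Rabs_le_between; lra.
Qed.

(** By semiconcavity [d - 2 * C * y] is nonincreasing over nearby points of differentiability, so
    the derivative has a left limit. It is read off the supremum [m] of the opposite quantity. *)
Lemma semiconcave_left_trace (x : R) : exists l, left_trace W x l.
Proof.
  assert (touch : forall y d, is_derive W y d -> forall h, Rabs h <= r -> W (y + h) <= W y + d * h + C * (h * h)).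
  { intros y d hd; destruct (W_touched y) as [p hp].
    rewrite (derivative_of_touched W y d p C r hr hC hd hp); exact hp. }
  assert (mono : forall y d y' d', y < y' <= y + r -> is_derive W y d -> is_derive W y' d' ->
    d' - 2 * C * y' <= d - 2 * C * y).
  { intros y d y' d' hy h h'.
    pose proof (touch y d h (y' - y) ltac:(rewrite Rabs_right; lra)) as t1.
    pose proof (touch y' d' h' (y - y') ltac:(rewrite Rabs_left; lra)) as t2.
    replace (y + (y' - y)) with y' in t1 by ring; replace (y' + (y - y')) with y in t2 by ring.
    apply Rmult_le_reg_r with (y' - y); [lra|]; nra. }
  destruct (completeness (fun v => exists y d, x - r < y < x /\ is_derive W y d /\ v = - (d - 2 * C * y)))
    as [m [m1 m2]].
  - exists (K + 2 * C * (Rabs x + r)); intros v (y & d & hy & hd & ->).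
    pose proof (Lipschitz_derivative_bound W K y d hK WL hd) as b; apply Rabs_le_between in b.
    pose proof (RRle_abs x); assert (2 * C * y <= 2 * C * (Rabs x + r)) by (apply Rmult_le_compat_l; lra); lra.
  - destruct (semiconcave_differentiable_dense (x - r) x ltac:(lra)) as (y & d & hy & hd).
    exists (- (d - 2 * C * y)), y, d; auto.
  - exists (- m + 2 * C * x); intros eps he.
    assert (ex : exists y d, x - r < y < x /\ is_derive W y d /\ m - eps / 2 < - (d - 2 * C * y)).
    { apply NNPP; intros no.
      assert (m <= m - eps / 2); [|lra]; apply m2; intros v (y & d & hy & hd & ->).
      apply Rnot_lt_le; intros l; apply no; exists y, d; auto. }
    destruct ex as (y0 & d0 & hy0 & hd0 & hv).
    exists (Rmin (x - y0) (eps / (4 * (C + 1)))); split;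
      [apply Rmin_glb_lt; [lra | apply Rdiv_lt_0_compat; lra]|]; intros y d hy hd.
    pose proof (Rmin_l (x - y0) (eps / (4 * (C + 1)))); pose proof (Rmin_r (x - y0) (eps / (4 * (C + 1)))) as mr.
    pose proof (mono y0 d0 y d ltac:(lra) hd0 hd) as mo.
    assert (lo : - (d - 2 * C * y) <= m) by (apply m1; exists y, d; split; [lra | auto]).
    assert (hq : x - y < eps / (4 * (C + 1))) by lra.
    apply Rmult_lt_compat_l with (r := 4 * (C + 1)) in hq; [|lra].
    replace (4 * (C + 1) * (eps / (4 * (C + 1)))) with eps in hq by (field; lra).
    assert (0 <= C * (x - y)) by nra.
    apply Rabs_def1; lra.
Qed.

(** Points of differentiability are dense, so the condition defining a left trace is not vacuous and
    transfers the Lipschitz bound. *)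
Lemma left_trace_bound (x l : R) : left_trace W x l -> Rabs l <= K + 1.
Proof.
  intros h; destruct (h 1 Rlt_0_1) as [de [hde hd]].
  destruct (semiconcave_differentiable_dense (x - de) x ltac:(lra)) as (y & d & hy & hyd).
  specialize (hd y d hy hyd); pose proof (Lipschitz_derivative_bound W K y d hK WL hyd).
  replace l with (d - (d - l)) by ring; unfold Rminus at 1; eapply Rle_trans; [apply Rabs_triang|].
  rewrite Rabs_Ropp; lra.
Qed.

End LeftTraces.

(** * Profiles reached by a viscosity solution *)

Section Reachability.

Variables (H : R -> R -> R) (T : R).
Hypothesis HH : Ham H (d1 H) (d2 H).
Hypothesis hT : 0 < T.

Lemma action_dependence (P : R) : exists M, 0 <= M /\ forall q p q' p' s, HS H q p -> HS H q' p' ->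
  (forall t, Rabs (p t) <= P) -> (forall t, Rabs (p' t) <= P) -> 0 <= s <= T ->
  let e := Rabs (q s - q' s) + Rabs (p s - p' s) in
  Rabs (q 0 - q' 0) <= M * e /\ Rabs (q T - q' T) <= M * e /\
  Rabs (Act H (d2 H) q p T - Act H (d2 H) q' p' T) <= M * e.
Proof.
  destruct (HSol_dependence _ _ _ HH P T) as [A [hA ha]].
  destruct (lagrangian_density_Lipschitz _ _ _ HH P) as [B [hB hb]].
  exists (A + B * A * T); split; [assert (0 <= B * A) by nra; nra|].
  intros q p q' p' s h h' b b' hs e.
  assert (e0 : 0 <= e) by (unfold e; pose proof (Rabs_pos (q s - q' s)); pose proof (Rabs_pos (p s - p' s)); lra).
  assert (all : forall t, 0 <= t <= T -> Rabs (q t - q' t) + Rabs (p t - p' t) <= A * e).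
  { intros t ht; apply (ha q p q' p' h h' b b' s t); apply Rabs_le_between; lra. }
  assert (n0 : 0 <= B * A * T * e) by (assert (0 <= B * A) by nra; repeat apply Rmult_le_pos; lra).
  pose proof (all 0 ltac:(lra)); pose proof (all T ltac:(lra)).
  pose proof (Rabs_pos (p 0 - p' 0)); pose proof (Rabs_pos (p T - p' T)).
  assert (0 <= A * e) by nra.
  split; [lra|]; split; [lra|].
  pose proof (derive_Lipschitz (fun t => Act H (d2 H) q p t - Act H (d2 H) q' p' t)
    (fun t => (p t * d2 H (q t) (p t) - H (q t) (p t)) - (p' t * d2 H (q' t) (p' t) - H (q' t) (p' t)))
    (B * (A * e)) T 0) as d; cbv beta in d.
  rewrite !Act_0, Rminus_diag, !Rminus_0_r, (Rabs_right T) in d by lra.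
  enough (Rabs (Act H (d2 H) q p T - Act H (d2 H) q' p' T) <= B * (A * e) * T) by lra.
  apply d; intros t; rewrite Rmin_right, Rmax_left by lra; intros ht.
  - apply D_minus; [exact (Act_derive _ _ _ HH q p t h) | exact (Act_derive _ _ _ HH q' p' t h')].
  - eapply Rle_trans; [apply hb; auto|]; apply Rmult_le_compat_l; auto.
Qed.

Lemma Act_RInt (q p : R -> R) : HS H q p ->
  RInt (fun s => Lag H (q s) (Derive q s)) 0 T = Act H (d2 H) q p T.
Proof.
  intros h; unfold Act; rewrite Rplus_0_l; apply RInt_ext; intros s _.
  rewrite (is_derive_unique q s _ (proj1 (h s))); apply (Lag_eq _ _ _ HH).
Qed.

Lemma Ustar_ge (W q p : R -> R) : HS H q p ->
  Rbar_le (W (q T) - Act H (d2 H) q p T) (Ustar H T W (q 0)).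
Proof.
  intros h; unfold Ustar.
  apply (proj1 (Lub_Rbar_correct (fun y => exists q0, in_RT H q0 /\ q0 0 = q 0 /\
              y = W (q0 T) - RInt (fun s => Lag H (q0 s) (Derive q0 s)) 0 T))).
  exists q; split; [now exists p|]; split; [reflexivity|]; now rewrite (Act_RInt q p h).
Qed.

Lemma Ustar_le (W : R -> R) (x c : R) :
  (forall q p, HS H q p -> q 0 = x -> W (q T) - Act H (d2 H) q p T <= c) ->
  Rbar_le (Ustar H T W x) c.
Proof.
  intros h; unfold Ustar.
  apply (proj2 (Lub_Rbar_correct (fun y => exists q0, in_RT H q0 /\ q0 0 = x /\
              y = W (q0 T) - RInt (fun s => Lag H (q0 s) (Derive q0 s)) 0 T))).
  intros y (q & [p hs] & e & ->); rewrite (Act_RInt q p hs); simpl; now apply h.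
Qed.

Variables (W Uo : R -> R) (U : R -> R -> R).
Hypothesis W_Lipschitz : Lipschitz W.
Hypothesis U_Lipschitz : Lipschitz_strip T U.
Hypothesis U_viscosity : visc_sol H T Uo U.
Hypothesis U_final : forall x, U T x = W x.

Lemma LipK_of_Lipschitz (f : R -> R) : Lipschitz f -> exists K, 0 <= K /\ LipK K f.
Proof.
  intros [K h]; exists (Rabs K); split; [apply Rabs_pos|]; intros x y.
  eapply Rle_trans; [apply h|]; apply Rmult_le_compat_r; [apply Rabs_pos | apply RRle_abs].
Qed.

(** Equality holds along the calibrated characteristic and the subsolution inequality along its tilt
    to [x + h]; subtracting leaves the second-order cost of the tilt. *)
Lemma final_semiconcave : exists P C, 0 <= C /\ forall x, exists q p, HS H q p /\ q T = x /\
  (forall s, Rabs (p s) <= P) /\ W x = Uo (q 0) + Act H (d2 H) q p T /\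
  forall h, Rabs h <= Rmin 1 T -> W (x + h) <= W x + p T * h + C * (h * h).
Proof.
  destruct (calibrated_characteristic _ _ _ HH T Uo U hT U_Lipschitz U_viscosity) as [P [hP hcal]].
  destruct (tilted_characteristic _ _ _ HH P) as [C [hC htilt]].
  pose proof U_viscosity as [_ [U0 _]].
  exists P, (C * (1 + / (T * T)) * T); split.
  { assert (0 < / (T * T)) by (apply Rinv_0_lt_compat; nra).
    apply Rmult_le_pos; [apply Rmult_le_pos; lra | lra]. }
  intros x; destruct (hcal x) as (q & p & hs & e & hb & ev); rewrite U_final, U0 in ev.
  exists q, p; split; [exact hs|]; split; [exact e|]; split; [exact hb|]; split; [exact ev|].
  intros h hh; pose proof (Rmin_l 1 T); pose proof (Rmin_r 1 T).
  destruct (htilt q p T h hs hb hT ltac:(lra) ltac:(lra)) as (g1 & g2 & g3 & g4 & _ & g5).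
  pose proof (subsolution_along _ _ _ HH T Uo U hT U_Lipschitz U_viscosity _ _ _ _ g1 g2 g3 g4 g5) as s.
  cbv beta in s; rewrite Act_0, U_final, U0, e in s.
  replace (x + T * (h / T)) with (x + h) in s by (field; lra).
  replace (q 0 + 0 * (h / T)) with (q 0) in s by ring.
  replace (T * p T * (h / T)) with (p T * h) in s by (field; lra).
  lra.
Qed.

Lemma final_touched : exists C, 0 <= C /\ forall x, exists p, forall h, Rabs h <= Rmin 1 T ->
  W (x + h) <= W x + p * h + C * (h * h).
Proof.
  destruct final_semiconcave as (P & C & hC & hx); exists C; split; [exact hC|]; intros x.
  destruct (hx x) as (q & p & _ & _ & _ & _ & k); now exists (p T).
Qed.

Lemma final_left_trace (x : R) : exists l, left_trace W x l.
Proof.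
  destruct final_touched as [C [hC ht]]; destruct (LipK_of_Lipschitz W W_Lipschitz) as [K [hK hL]].
  apply (semiconcave_left_trace W K C (Rmin 1 T)); auto; apply Rmin_glb_lt; lra.
Qed.

Lemma final_left_trace_bound : exists K, 0 <= K /\ forall x l, left_trace W x l -> Rabs l <= K.
Proof.
  destruct final_touched as [C [hC ht]]; destruct (LipK_of_Lipschitz W W_Lipschitz) as [K [hK hL]].
  exists (K + 1); split; [lra|]; intros x l.
  apply (left_trace_bound W K C (Rmin 1 T)); auto; apply Rmin_glb_lt; lra.
Qed.

Lemma Ustar_below (q p : R -> R) : HS H q p -> W (q T) - Act H (d2 H) q p T <= Uo (q 0).
Proof.
  intros h; pose proof U_viscosity as [_ [U0 _]].
  pose proof (subsolution_HSol _ _ _ HH T Uo U hT U_Lipschitz U_viscosity q p h) as s.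
  rewrite U_final, U0 in s; lra.
Qed.

Lemma Uo_Lipschitz_of_solution : exists K, 0 <= K /\ LipK K Uo.
Proof.
  destruct (Lipschitz_strip_nonneg T U U_Lipschitz) as [K [hK hL]]; exists K; split; [exact hK|].
  intros x y; pose proof (hL 0 0 x y ltac:(lra) ltac:(lra)) as l.
  pose proof U_viscosity as [_ [U0 _]]; rewrite !U0 in l.
  now rewrite Rminus_diag, Rabs_R0, Rplus_0_l in l.
Qed.

(* The characteristic issued from a left trace is a limit of the calibrated characteristics
   ending at points of differentiability. *)
Lemma left_trace_calibrated (x l : R) (q p : R -> R) : left_trace W x l -> HS H q p ->
  q T = x -> p T = l -> W x = Uo (q 0) + Act H (d2 H) q p T.
Proof.
  intros hl hs eq ep.
  destruct final_semiconcave as (P & C & hC & hx).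
  destruct (HSol_bounded _ _ _ HH (Rabs l)) as [P' [hP' hb]].
  destruct (LipK_of_Lipschitz W W_Lipschitz) as [K [hK hL]].
  destruct Uo_Lipschitz_of_solution as [K0 [hK0 hL0]].
  destruct (action_dependence (Rabs P + P')) as [M [hM hdep]].
  assert (r0 : 0 < Rmin 1 T) by (apply Rmin_glb_lt; lra).
  (* The total defect at distance at most [2 * eps] is bounded by [(K + K0 * M + M) * (2 * eps)],
     from [W], [Uo] and the action; [eps] is chosen to make this less than the assumed defect
     [D]. *)
  set (B := 2 * (K + K0 * M + M) + 1).
  assert (hB : 0 < B) by (unfold B; assert (0 <= K0 * M) by nra; lra).
  apply Rminus_diag_uniq.
  destruct (Req_dec (W x - (Uo (q 0) + Act H (d2 H) q p T)) 0) as [z|z]; auto; exfalso.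
  apply Rabs_pos_lt in z; set (D := Rabs (W x - (Uo (q 0) + Act H (d2 H) q p T))) in *.
  set (eps := D / (2 * B)); assert (he : 0 < eps) by (apply Rdiv_lt_0_compat; lra).
  assert (eB : B * eps = D / 2) by (unfold eps; field; lra).
  destruct (hl eps he) as [de [hde hd]].
  destruct (semiconcave_differentiable_dense W K C (Rmin 1 T) hK hC r0 hL) with (a := x - Rmin de eps) (b := x)
    as (y & d & hy & hyd).
  { intros u; destruct (hx u) as (q' & p' & _ & _ & _ & _ & k); now exists (p' T). }
  { assert (0 < Rmin de eps) by (apply Rmin_glb_lt; lra); lra. }
  pose proof (Rmin_l de eps); pose proof (Rmin_r de eps).
  specialize (hd y d ltac:(lra) hyd).
  destruct (hx y) as (q' & p' & hs' & eq' & hb' & ev & ht).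
  pose proof (derivative_of_touched W y d (p' T) C (Rmin 1 T) r0 hC hyd ht) as ed.
  destruct (hdep q p q' p' T hs hs') as (a1 & _ & a3); [| |lra|].
  { intros t; apply Rle_trans with P'; [apply (hb q p T hs); rewrite ep; lra | pose proof (Rabs_pos P); lra]. }
  { intros t; apply Rle_trans with P; auto; pose proof (RRle_abs P); lra. }
  rewrite eq, ep, eq', <- ed, (Rabs_minus_sym l) in a1, a3.
  set (e := Rabs (x - y) + Rabs (d - l)) in *.
  assert (ee : e <= 2 * eps) by (unfold e; rewrite Rabs_right by lra; lra).
  assert (exy : Rabs (x - y) <= e) by (unfold e; pose proof (Rabs_pos (d - l)); lra).
  pose proof (hL x y) as w; pose proof (hL0 (q 0) (q' 0)) as u.
  assert (K * Rabs (x - y) <= K * e) by (apply Rmult_le_compat_l; auto).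
  assert (K0 * Rabs (q 0 - q' 0) <= K0 * (M * e)) by (apply Rmult_le_compat_l; auto).
  assert (D <= (K + K0 * M + M) * e).
  { unfold D; replace (W x - (Uo (q 0) + Act H (d2 H) q p T))
      with ((W x - W y) + - (Uo (q 0) - Uo (q' 0)) + - (Act H (d2 H) q p T - Act H (d2 H) q' p' T))
      by (rewrite ev; ring).
    eapply Rle_trans; [apply Rabs_triang|]; rewrite Rabs_Ropp.
    pose proof (Rabs_triang (W x - W y) (- (Uo (q 0) - Uo (q' 0)))) as tr; rewrite Rabs_Ropp in tr.
    lra. }
  assert ((K + K0 * M + M) * e <= (K + K0 * M + M) * (2 * eps)) by (assert (0 <= K0 * M) by nra; apply Rmult_le_compat_l; lra).
  unfold B in eB; lra.
Qed.

(** On the image of [pi], the calibrated characteristic is itself a competitor reaching [Uo]. At a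
    limit point [x] this competitor is perturbed rather than passing to the limit in [Ustar]. *)
Lemma necessary_conditions :
  (forall x, Rbar_le (Ustar H T W x) (Finite (Uo x))) /\
  (forall x, in_closure (piW_image H T W) x -> Ustar H T W x = Finite (Uo x)).
Proof.
  assert (below : forall x, Rbar_le (Ustar H T W x) (Finite (Uo x))).
  { intros x; apply Ustar_le; intros q p h <-; now apply Ustar_below. }
  split; [exact below|]; intros x hx; apply Rbar_le_antisym; [apply below|].
  destruct final_left_trace_bound as [L [hL hl]].
  destruct (HSol_bounded _ _ _ HH L) as [P [hP hb]].
  destruct (HSol_bounded _ _ _ HH P) as [P' [hP' hb']].
  destruct (action_dependence (P + P')) as [M [hM hdep]].
  destruct (LipK_of_Lipschitz W W_Lipschitz) as [K [hK hLW]].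
  destruct Uo_Lipschitz_of_solution as [K0 [hK0 hL0]].
  assert (G : forall eps, 0 < eps -> Rbar_le (Uo x - eps) (Ustar H T W x)).
  { intros eps he.
    set (B := K0 + K * M + M + 1); assert (hB : 0 < B) by (unfold B; assert (0 <= K * M) by nra; lra).
    destruct (hx (eps / B) ltac:(apply Rdiv_lt_0_compat; lra)) as [y [(x' & l & q & p & ht & hs & e1 & e2 & ->) hy]].
    (* The competitor starts at [x] with the initial momentum of the nearby calibrated
       characteristic; by continuous dependence its value misses [Uo x] by less than [eps]. *)
    destruct (flow_exists _ _ _ HH 0 x (p 0)) as (q' & p' & hs' & i1 & i2).
    assert (bp : forall t, Rabs (p t) <= P) by (intros t; apply (hb q p T hs); rewrite e2; now apply (hl x')).
    assert (bp' : forall t, Rabs (p' t) <= P') by (intros t; apply (hb' q' p' 0 hs'); rewrite i2; auto).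
    destruct (hdep q p q' p' 0 hs hs') as (_ & a2 & a3); [| |lra|].
    { intros t; specialize (bp t); lra. }
    { intros t; specialize (bp' t); lra. }
    rewrite i1, i2, (Rminus_diag (p 0)), Rabs_R0, Rplus_0_r in a2, a3.
    pose proof (left_trace_calibrated x' l q p ht hs e1 e2) as cal; rewrite <- e1 in cal.
    apply Rbar_le_trans with (2 := (eq_ind _ (fun z => Rbar_le _ (Ustar H T W z)) (Ustar_ge W q' p' hs') _ i1)).
    simpl.
    pose proof (hLW (q T) (q' T)) as w; apply Rabs_le_between in w; apply Rabs_le_between in a3.
    pose proof (hL0 (q 0) x) as u; apply Rabs_le_between in u.
    assert (K * Rabs (q T - q' T) <= K * (M * Rabs (q 0 - x))) by (apply Rmult_le_compat_l; auto).
    apply Rmult_lt_compat_l with (r := B) in hy; [|exact hB].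
    replace (B * (eps / B)) with eps in hy by (field; lra).
    pose proof (Rabs_pos (q 0 - x)); unfold B in hy; lra. }
  (* The lower bound [G] also excludes the value minus infinity of the extended supremum. *)
  destruct (Ustar H T W x) as [v| |]; simpl in *; auto.
  - apply le_epsilon; intros eps he; specialize (G eps he); lra.
  - apply (G 1 Rlt_0_1).
Qed.

End Reachability.

Theorem theorem3p3 (H : R -> R -> R) (T : R) (W : R -> R) :
  hyp_C3 H -> hyp_CNH H -> hyp_CVX H -> 0 < T -> Lipschitz W ->
  (exists Uo, in_IHJ H T W Uo) ->
  forall Uo : R -> R, Lipschitz Uo ->
    (in_IHJ H T W Uo <->
     ((forall x, Rbar_le (Ustar H T W x) (Finite (Uo x))) /\
      (forall x, in_closure (piW_image H T W) x -> Ustar H T W x = Finite (Uo x)))).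
Proof.
  intros hC3 hCNH hCVX hT hW [U1o [_ [U1 [L1 [v1 f1]]]]] Uo hUo.
  pose proof (ham_of_hypotheses H hC3 hCNH hCVX) as HH.
  split.
  - intros [_ [U [LU [vU fU]]]]; exact (necessary_conditions H T HH hT W Uo U hW LU vU fU).
  - intros [ge eq]; split; [exact hUo|].
    destruct (LipK_of_Lipschitz Uo hUo) as [K [hK hL]].
    destruct (value_function _ _ _ HH K T hT) as [P [hP hval]].
    destruct (hval Uo hL) as [V [V1 V2]].
    exists V; split; [exact (value_Lipschitz _ _ _ HH K T P Uo V hK hT hL V1 V2)|].
    split; [exact (value_viscosity_solution _ _ _ HH K T P Uo V hK hT hL V1 V2)|].
    intros x; apply Rle_antisym.
    + destruct (final_left_trace H T HH hT W U1o U1 hW L1 v1 f1 x) as [l hl].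
      destruct (flow_exists _ _ _ HH T x l) as (q & p & hs & e1 & e2).
      assert (im : in_closure (piW_image H T W) (q 0)).
      { intros eps he; exists (q 0); split; [exists x, l, q, p; auto | now rewrite Rminus_diag, Rabs_R0]. }
      (* At the foot of this characteristic both [Uo] and the given datum [U1o] equal [Ustar], so
         the calibration known for [U1o] holds for [Uo] as well. *)
      pose proof (eq _ im) as a.
      destruct (necessary_conditions H T HH hT W U1o U1 hW L1 v1 f1) as [_ n].
      rewrite (n _ im) in a; injection a as a.
      rewrite (left_trace_calibrated H T HH hT W U1o U1 hW L1 v1 f1 x l q p hl hs e1 e2), a.
      rewrite <- e1; exact (value_HSol _ _ _ HH T Uo V V2 q p T hs ltac:(lra)).
    + destruct (V1 T x ltac:(lra)) as (q & p & hs & e & _ & ->).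
      pose proof (Rbar_le_trans _ _ _ (Ustar_ge H T HH W q p hs) (ge (q 0))) as b; simpl in b.
      rewrite e in b; lra.
Qed.
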